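(* Let $K$ be a field, let $A$ be a finitely generated prime (unital, associative) $K$-algebra, and let $Z$ denote the extended centre of $A$. If $A$ is not PI and $A$ has no nonzero locally nilpotent ideals, then $$\operatorname{trdeg}(Z)+2\ \le\ \operatorname{GKdim}(A),$$ where $\operatorname{trdeg}(Z)$ is the transcendence degree of $Z$ over $K$.
   Context: All algebras are associative with identity; ideals are two-sided. An algebra is PI if it satisfies a (nontrivial) polynomial identity. An ideal $I$ of $A$ is locally nilpotent if for every finite-dimensional $K$-subspace $W\subseteq I$ there is $n\ge 1$ with $W^n=(0)$. GK dimension: for a $K$-subspace $V$ of $A$, $V^n$ denotes the $K$-span of all products of $n$ elements of $V$. A frame for $A$ is a finite-dimensional $K$-subspace $V$ with $1\in V$ that generates $A$ as a $K$-algebra. For finitely generated $A$ with frame $V$, $$\operatorname{GKdim}(A)=\limsup_{n\to\infty}\frac{\log(\dim_K V^n)}{\log n},$$ which may be infinite and does not depend on the choice of $V$. Extended centre: for a prime algebra $A$, the Martindale ring of quotients is the set of equivalence classes of pairs $(I,f)$, where $I$ is a nonzero ideal of $A$ and $f:I\to A$ is a homomorphism of right $A$-modules, with $(I,f)\sim(J,g)$ if $f$ and $g$ agree on some nonzero ideal contained in $I\cap J$; addition is pointwise on $I\cap J$, and the product of the classes of $(I,f)$ and $(J,g)$ is the class of $(JI, f\circ g)$. It contains $A$ via left multiplications. The extended centre of $A$ is the centre of this ring; it is a field containing $K$. *)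

(* Defs.v *)
From HB Require Import structures.
From mathcomp Require Import all_boot all_order all_algebra.
From mathcomp Require Import generic_quotient.
From mathcomp Require Import all_classical all_reals all_analysis.
From mathcomp Require mpoly monalg.
(* Without their notations, which clash with those of the analysis library. *)
Import -(notations) mpoly monalg.

Set Implicit Arguments.
Unset Strict Implicit.
Unset Printing Implicit Defensive.

Import GRing.Theory.

Local Open Scope classical_set_scope.
Local Open Scope ring_scope.
Local Open Scope quotient_scope.

Section Subspaces.
Context {K : fieldType} {A : algType K}.
Implicit Types (X V W : set A) (n d : nat).

Definition span X : set A :=
  [set x | exists2 s : seq (K * A),
     (forall p, p \in s -> X p.2) & x = \sum_(p <- s) p.1 *: p.2].

Definition lin_indep d (b : 'I_d -> A) : Prop :=
  forall c : 'I_d -> K, \sum_i c i *: b i = 0 -> forall i, c i = 0.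

Definition is_basis d (b : 'I_d -> A) W : Prop :=
  lin_indep b /\ span (range b) = W.

Definition findim_subspace W : Prop :=
  exists s : seq A, W = span [set x | x \in s].

(* Only meaningful on finite-dimensional subspaces; 0 on other sets. *)
Definition dimK W : nat :=
  xget 0%N [set d | exists b : 'I_d -> A, is_basis b W].

Definition subspace_exp V n : set A :=
  span [set x | exists2 v : 'I_n -> A,
          (forall i, V (v i)) & x = \prod_(i < n) v i].

Definition generates V : Prop :=
  forall B : {pred A}, GRing.subalg_closed B ->
    (forall x, V x -> x \in B) -> forall x, x \in B.

Definition is_frame V : Prop :=
  [/\ findim_subspace V, V 1 & generates V].

(* Gelfand-Kirillov dimension of A computed with the frame V; the value does
   not depend on V.  The terms n = 0, 1, where the quotient is 0 because
   ln 0 = ln 1 = 0 and _ / 0 = 0, do not affect the upper limit. *)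
Definition GKdim (R : realType) V : \bar R :=
  limn_esup (fun n : nat =>
    (ln (dimK (subspace_exp V n))%:R / ln n%:R : R)%:E).

End Subspaces.

Section Ideals.
Context {K : fieldType} {A : algType K}.
Implicit Types I J : set A.

Definition is_ideal I : Prop :=
  [/\ I 0, forall x y, I x -> I y -> I (x + y)
    & forall a x, I x -> I (a * x) /\ I (x * a)].

Definition ideal_mul I J : set A :=
  [set x | exists2 s : seq (A * A),
     (forall p, p \in s -> I p.1 /\ J p.2) & x = \sum_(p <- s) p.1 * p.2].

Definition locally_nilpotent I : Prop :=
  forall W, findim_subspace W -> W `<=` I ->
    exists2 n, (0 < n)%N & subspace_exp W n = [set 0].

End Ideals.

Definition prime_algebra (K : fieldType) (A : algType K) : Prop :=
  forall I J : set A, is_ideal I -> is_ideal J ->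
    ideal_mul I J = [set 0] -> I = [set 0] \/ J = [set 0].

(* Polynomial identities are elements of the free algebra K<x_0, x_1, ...>,
   realised as the monoid algebra of the free monoid on nat. *)
Definition PI_algebra (K : fieldType) (A : algType K) : Prop :=
  exists f : monalg.malg (monalg.fmonom nat) K, f <> 0 /\
    forall a : nat -> A,
      monalg.mmap (in_alg A)
        (fun m : monalg.fmonom nat => \prod_(i <- monalg.fmonom_val m) a i) f
      = 0.

Definition alg_indep (K : fieldType) (F : comAlgType K) d (z : 'I_d -> F) :=
  forall p : mpoly.mpoly d K, mpoly.mmap (in_alg F) z p = 0 -> p = 0.

(* The supremum of the sizes of the finite algebraically independent families:
   this is +oo exactly when the transcendence degree is infinite. *)
Definition trdeg (R : realType) (K : fieldType) (F : comAlgType K) : \bar R :=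
  ereal_sup [set d%:R%:E | d in [set d | exists z : 'I_d -> F, alg_indep z]].

Section MartindalePairs.
Context {K : fieldType} {A : algType K}.
Implicit Types I J : set A.

(* A pair (I, f); the map f is represented by a total function on A, of which
   only the values on I matter. *)
Record mpair := MPair {
  mdom : set A;
  mfun : A -> A;
  mdom_ideal : is_ideal mdom;
  mdom_neq0 : mdom <> [set 0];
  mfunD : forall x y, mdom x -> mdom y -> mfun (x + y) = mfun x + mfun y;
  mfunM : forall x a, mdom x -> mfun (x * a) = mfun x * a }.

HB.instance Definition _ := gen_eqMixin mpair.
HB.instance Definition _ := gen_choiceMixin mpair.

(* f and g agree on some nonzero ideal contained in both domains. *)
Definition mequiv (p q : mpair) : bool :=
  `[< exists I, [/\ is_ideal I, I <> [set 0], I `<=` mdom p `&` mdom q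
        & forall x, I x -> mfun p x = mfun q x] >].

Lemma ideal0 I : is_ideal I -> I 0.
Proof. by case. Qed.

Lemma idealD I x y : is_ideal I -> I x -> I y -> I (x + y).
Proof. by case=> _ + _; apply. Qed.

Lemma idealMl I a x : is_ideal I -> I x -> I (a * x).
Proof. by case=> _ _ h /(h a) []. Qed.

Lemma idealMr I a x : is_ideal I -> I x -> I (x * a).
Proof. by case=> _ _ h /(h a) []. Qed.

Lemma ideal_sum I (T : eqType) (s : seq T) (F : T -> A) : is_ideal I ->
  (forall i, i \in s -> I (F i)) -> I (\sum_(i <- s) F i).
Proof.
move=> idI sI; rewrite big_seq.
by elim/big_ind: _ => //; [exact: ideal0 | move=> x y; exact: idealD].
Qed.

Lemma is_ideal_setT : is_ideal [set: A].
Proof. by []. Qed.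

Lemma setT_neq0 : [set: A] <> [set 0].
Proof.
move=> T0; have : [set: A] 1 by [].
by rewrite T0 /= => /eqP; rewrite oner_eq0.
Qed.

Lemma is_idealI I J : is_ideal I -> is_ideal J -> is_ideal (I `&` J).
Proof.
move=> idI idJ; split.
- by split; exact: ideal0.
- by move=> x y [? ?] [? ?]; split; exact: idealD.
- by move=> a x [? ?]; do ![split]; do [exact: idealMl | exact: idealMr].
Qed.

Lemma is_ideal_mul I J : is_ideal I -> is_ideal J -> is_ideal (ideal_mul I J).
Proof.
move=> idI idJ; split.
- by exists [::]; rewrite ?big_nil.
- move=> _ _ [s sP ->] [t tP ->]; exists (s ++ t); last by rewrite big_cat.
  by move=> p; rewrite mem_cat => /orP[/sP|/tP].
- move=> a _ [s sP ->]; split.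
  + exists [seq (a * p.1, p.2) | p <- s].
      by move=> _ /mapP[p /sP[? ?] ->]; split=> //; exact: idealMl.
    by rewrite big_map mulr_sumr; apply: eq_bigr => p _; rewrite mulrA.
  + exists [seq (p.1, p.2 * a) | p <- s].
      by move=> _ /mapP[p /sP[? ?] ->]; split=> //; exact: idealMr.
    by rewrite big_map mulr_suml; apply: eq_bigr => p _; rewrite mulrA.
Qed.

Lemma ideal_mul_subl I J : is_ideal I -> ideal_mul I J `<=` I.
Proof.
move=> idI _ [s sP ->]; apply: ideal_sum => // p /sP[? _]; exact: idealMr.
Qed.

Lemma ideal_mul_subr I J : is_ideal J -> ideal_mul I J `<=` J.
Proof.
move=> idJ _ [s sP ->]; apply: ideal_sum => // p /sP[_ ?]; exact: idealMl.
Qed.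

Lemma ideal_mulS I J I' J' : I `<=` I' -> J `<=` J' ->
  ideal_mul I J `<=` ideal_mul I' J'.
Proof. by move=> sI sJ _ [s sP ->]; exists s => // p /sP[/sI ? /sJ ?]. Qed.

Lemma mfun0 p : mfun p 0 = 0.
Proof.
by have := mfunM 0 (ideal0 (mdom_ideal p)); rewrite !mulr0.
Qed.

Lemma mfun_sum p (T : eqType) (s : seq T) (F : T -> A) :
  (forall i, i \in s -> mdom p (F i)) ->
  mfun p (\sum_(i <- s) F i) = \sum_(i <- s) mfun p (F i).
Proof.
have idp := mdom_ideal p.
elim: s => [|i s IHs] sP; first by rewrite !big_nil mfun0.
have sP' j : j \in s -> mdom p (F j) by move=> js; apply: sP; rewrite inE js orbT.
rewrite !big_cons mfunD ?IHs //; first by apply: sP; rewrite mem_head.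
exact: ideal_sum.
Qed.

Lemma mfun_mul p q x : ideal_mul (mdom q) (mdom p) x -> mdom p (mfun q x).
Proof.
have [idp idq] := (mdom_ideal p, mdom_ideal q).
move=> [s sP ->]; rewrite mfun_sum => [|i /sP[? _]]; last exact: idealMr.
by apply: ideal_sum => // i /sP[? ?]; rewrite mfunM //; exact: idealMl.
Qed.

End MartindalePairs.

Arguments mpair {K} A.

Section Martindale.
Context {K : fieldType} {A : algType K} (primeA : prime_algebra A).
Implicit Types (I J : set A) (p q r : mpair A) (k : K).

Lemma ideal_mul_neq0 I J : is_ideal I -> is_ideal J ->
  I <> [set 0] -> J <> [set 0] -> ideal_mul I J <> [set 0].
Proof. by move=> idI idJ I0 J0 /(primeA idI idJ)[]. Qed.

Lemma idealI_neq0 I J : is_ideal I -> is_ideal J ->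
  I <> [set 0] -> J <> [set 0] -> I `&` J <> [set 0].
Proof.
move=> idI idJ I0 J0 IJ0; apply: (ideal_mul_neq0 idI idJ I0 J0).
apply/seteqP; split=> [x IJx|_ ->]; last by apply: ideal0; exact: is_ideal_mul.
by rewrite -IJ0; split; [exact: ideal_mul_subl IJx | exact: ideal_mul_subr IJx].
Qed.

Lemma mequivI p q :
  (forall x, mdom p x -> mdom q x -> mfun p x = mfun q x) -> mequiv p q.
Proof.
move=> pq; apply/asboolP; exists (mdom p `&` mdom q); split=> //.
- exact/is_idealI/mdom_ideal/mdom_ideal.
- exact: idealI_neq0 (mdom_ideal p) (mdom_ideal q) (@mdom_neq0 _ _ p)
    (@mdom_neq0 _ _ q).
- by move=> x []; exact: pq.
Qed.

Lemma mequiv_is_equiv : equiv_class_of (@mequiv K A).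
Proof.
split=> [p|p q|q p r].
- exact: mequivI.
- by apply: asbool_equiv_eq; split=> -[I [idI I0 sI eI]]; exists I;
    rewrite setIC; split=> // x /eI.
- move=> /asboolP[I [idI I0 sI eI]] /asboolP[J [idJ J0 sJ eJ]].
  apply/asboolP; exists (I `&` J); split.
  + exact: is_idealI.
  + exact: idealI_neq0.
  + by move=> x [/sI[? _] /sJ[_ ?]].
  + by move=> x [/eI -> /eJ ->].
Qed.

Canonical mequiv_equiv := EquivRelPack mequiv_is_equiv.

Definition martindale := {eq_quot mequiv_equiv}.

HB.instance Definition _ := Choice.on martindale.
HB.instance Definition _ := EqQuotient.on martindale.

Lemma martindale_eqP p q :
  reflect (\pi_martindale p = \pi_martindale q) (mequiv p q).
Proof. exact: (iffP (@eqquotP _ _ martindale p q)). Qed.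

Definition pzero : mpair A :=
  @MPair _ _ setT (fun=> 0) is_ideal_setT setT_neq0
    (fun _ _ _ _ => esym (addr0 0)) (fun _ a _ => esym (mul0r a)).

(* The class of (A, left multiplication by a). *)
Definition plmul (a : A) : mpair A :=
  @MPair _ _ setT (fun x => a * x) is_ideal_setT setT_neq0
    (fun x y _ _ => mulrDr a x y) (fun x b _ => mulrA a x b).

Fact popp_subproofD p x y : mdom p x -> mdom p y ->
  - mfun p (x + y) = - mfun p x + - mfun p y.
Proof. by move=> px py; rewrite mfunD // opprD. Qed.

Fact popp_subproofM p x a : mdom p x -> - mfun p (x * a) = - mfun p x * a.
Proof. by move=> px; rewrite mfunM // mulNr. Qed.

Definition popp p : mpair A :=
  MPair (mdom_ideal p) (@mdom_neq0 _ _ p)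
    (@popp_subproofD p) (@popp_subproofM p).

Fact pscale_subproofD k p x y : mdom p x -> mdom p y ->
  k *: mfun p (x + y) = k *: mfun p x + k *: mfun p y.
Proof. by move=> px py; rewrite mfunD // scalerDr. Qed.

Fact pscale_subproofM k p x a : mdom p x ->
  k *: mfun p (x * a) = k *: mfun p x * a.
Proof. by move=> px; rewrite mfunM // scalerAl. Qed.

Definition pscale k p : mpair A :=
  MPair (mdom_ideal p) (@mdom_neq0 _ _ p)
    (@pscale_subproofD k p) (@pscale_subproofM k p).

Fact padd_subproofD p q x y : (mdom p `&` mdom q) x -> (mdom p `&` mdom q) y ->
  mfun p (x + y) + mfun q (x + y) = mfun p x + mfun q x + (mfun p y + mfun q y).
Proof. by move=> [? ?] [? ?]; rewrite !mfunD // addrACA. Qed.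

Fact padd_subproofM p q x a : (mdom p `&` mdom q) x ->
  mfun p (x * a) + mfun q (x * a) = (mfun p x + mfun q x) * a.
Proof. by move=> [? ?]; rewrite !mfunM // mulrDl. Qed.

Definition padd p q : mpair A :=
  MPair (is_idealI (mdom_ideal p) (mdom_ideal q))
    (idealI_neq0 (mdom_ideal p) (mdom_ideal q) (@mdom_neq0 _ _ p)
       (@mdom_neq0 _ _ q))
    (@padd_subproofD p q) (@padd_subproofM p q).

Fact pmul_subproofD p q x y :
  ideal_mul (mdom q) (mdom p) x -> ideal_mul (mdom q) (mdom p) y ->
  mfun p (mfun q (x + y)) = mfun p (mfun q x) + mfun p (mfun q y).
Proof.
move=> qpx qpy; have qS := ideal_mul_subl (mdom_ideal q).
rewrite [mfun q _]mfunD; [|exact: qS qpx|exact: qS qpy].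
by rewrite mfunD //; exact: mfun_mul.
Qed.

Fact pmul_subproofM p q x a : ideal_mul (mdom q) (mdom p) x ->
  mfun p (mfun q (x * a)) = mfun p (mfun q x) * a.
Proof.
move=> qpx.
rewrite [mfun q _]mfunM; last exact: ideal_mul_subl (mdom_ideal q) _ qpx.
by rewrite mfunM //; exact: mfun_mul.
Qed.

(* (I, f) * (J, g) = (J I, f \o g). *)
Definition pmul p q : mpair A :=
  MPair (is_ideal_mul (mdom_ideal q) (mdom_ideal p))
    (ideal_mul_neq0 (mdom_ideal q) (mdom_ideal p) (@mdom_neq0 _ _ q)
       (@mdom_neq0 _ _ p))
    (@pmul_subproofD p q) (@pmul_subproofM p q).

Implicit Types x y z : martindale.

Definition mtd_add x y : martindale := \pi_martindale (padd (repr x) (repr y)).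
Definition mtd_opp x : martindale := \pi_martindale (popp (repr x)).
Definition mtd_mul x y : martindale := \pi_martindale (pmul (repr x) (repr y)).
Definition mtd_scale k x : martindale := \pi_martindale (pscale k (repr x)).

Lemma repr_mequiv p : mequiv (repr (\pi_martindale p)) p.
Proof. by apply/martindale_eqP; rewrite reprK. Qed.

Lemma pi_add p q :
  mtd_add (\pi_martindale p) (\pi_martindale q) = \pi_martindale (padd p q).
Proof.
apply/martindale_eqP; apply/asboolP.
have /asboolP[I [idI I0 sI eI]] := repr_mequiv p.
have /asboolP[J [idJ J0 sJ eJ]] := repr_mequiv q.
exists (I `&` J); split; [exact: is_idealI|exact: idealI_neq0| |].
  by move=> x [/sI[? ?] /sJ[? ?]].
by move=> x [/eI /= -> /eJ ->].
Qed.

Lemma pi_opp p : mtd_opp (\pi_martindale p) = \pi_martindale (popp p).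
Proof.
apply/martindale_eqP; apply/asboolP.
have /asboolP[I [idI I0 sI eI]] := repr_mequiv p.
by exists I; split=> // x /eI /= ->.
Qed.

Lemma pi_scale k p :
  mtd_scale k (\pi_martindale p) = \pi_martindale (pscale k p).
Proof.
apply/martindale_eqP; apply/asboolP.
have /asboolP[I [idI I0 sI eI]] := repr_mequiv p.
by exists I; split=> // x /eI /= ->.
Qed.

Lemma pi_mul p q :
  mtd_mul (\pi_martindale p) (\pi_martindale q) = \pi_martindale (pmul p q).
Proof.
apply/martindale_eqP; apply/asboolP.
have /asboolP[I [idI I0 sI eI]] := repr_mequiv p.
have /asboolP[J [idJ J0 sJ eJ]] := repr_mequiv q.
exists (ideal_mul J I); split; [exact: is_ideal_mul|exact: ideal_mul_neq0| |].
  move=> x JIx; split; (apply: ideal_mulS JIx; first by move=> y /sJ[]);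
    by move=> y /sI[].
move=> x JIx /=; rewrite -eJ; last exact: ideal_mul_subl idJ _ JIx.
rewrite eI // eJ; last exact: ideal_mul_subl idJ _ JIx.
case: JIx => s sP ->; rewrite mfun_sum => [|i /sP[/sJ[_ Ji] _]]; last first.
  exact: idealMr (mdom_ideal q) Ji.
apply: ideal_sum => // i /sP[/sJ[_ Ji] Ii].
by rewrite mfunM //; exact: idealMl.
Qed.

Lemma martindale_ind (P : martindale -> Prop) :
  (forall p, P (\pi_martindale p)) -> forall x, P x.
Proof. by move=> Pp x; rewrite -[x]reprK; exact: Pp. Qed.

Fact mtd_addA : associative mtd_add.
Proof.
elim/martindale_ind=> p; elim/martindale_ind=> q; elim/martindale_ind=> r.
by rewrite !pi_add; apply/martindale_eqP/mequivI => x _ _ /=; rewrite addrA.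
Qed.

Fact mtd_addC : commutative mtd_add.
Proof.
elim/martindale_ind=> p; elim/martindale_ind=> q.
by rewrite !pi_add; apply/martindale_eqP/mequivI => x _ _ /=; rewrite addrC.
Qed.

Fact mtd_add0 : left_id (\pi_martindale pzero) mtd_add.
Proof.
elim/martindale_ind=> p.
by rewrite !pi_add; apply/martindale_eqP/mequivI => x _ _ /=; rewrite add0r.
Qed.

Fact mtd_addN : left_inverse (\pi_martindale pzero) mtd_opp mtd_add.
Proof.
elim/martindale_ind=> p; rewrite pi_opp pi_add.
by apply/martindale_eqP/mequivI => x _ _ /=; rewrite addNr.
Qed.

HB.instance Definition _ :=
  GRing.isZmodule.Build martindale mtd_addA mtd_addC mtd_add0 mtd_addN.

Fact mtd_mulA : associative mtd_mul.
Proof.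
elim/martindale_ind=> p; elim/martindale_ind=> q; elim/martindale_ind=> r.
by rewrite !pi_mul; exact/martindale_eqP/mequivI.
Qed.

Fact mtd_mul1 : left_id (\pi_martindale (plmul 1)) mtd_mul.
Proof.
elim/martindale_ind=> p; rewrite pi_mul.
by apply/martindale_eqP/mequivI => x _ _ /=; rewrite mul1r.
Qed.

Fact mtd_mulr1 : right_id (\pi_martindale (plmul 1)) mtd_mul.
Proof.
elim/martindale_ind=> p; rewrite pi_mul.
by apply/martindale_eqP/mequivI => x _ _ /=; rewrite mul1r.
Qed.

Fact mtd_mulDl : left_distributive mtd_mul mtd_add.
Proof.
elim/martindale_ind=> p; elim/martindale_ind=> q; elim/martindale_ind=> r.
by rewrite !(pi_mul, pi_add); exact/martindale_eqP/mequivI.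
Qed.

Fact mtd_mulDr : right_distributive mtd_mul mtd_add.
Proof.
elim/martindale_ind=> p; elim/martindale_ind=> q; elim/martindale_ind=> r.
rewrite !(pi_mul, pi_add); apply/martindale_eqP/mequivI => x _ [qx rx] /=.
by rewrite mfunD //; exact: mfun_mul.
Qed.

Fact mtd_1_neq0 : \pi_martindale (plmul 1) != 0 :> martindale.
Proof.
apply/eqP => /martindale_eqP/asboolP[I [idI I0 _ eI]]; apply: I0.
apply/seteqP; split=> [x /eI|_ ->]; last exact: ideal0.
by rewrite /= mul1r.
Qed.

HB.instance Definition _ := GRing.Zmodule_isNzRing.Build martindale
  mtd_mulA mtd_mul1 mtd_mulr1 mtd_mulDl mtd_mulDr mtd_1_neq0.

Fact mtd_scaleA k l x : mtd_scale k (mtd_scale l x) = mtd_scale (k * l) x.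
Proof.
elim/martindale_ind: x => p; rewrite !pi_scale.
by apply/martindale_eqP/mequivI => x _ _ /=; rewrite scalerA.
Qed.

Fact mtd_scale1 : left_id 1 mtd_scale.
Proof.
elim/martindale_ind=> p; rewrite !pi_scale.
by apply/martindale_eqP/mequivI => x _ _ /=; rewrite scale1r.
Qed.

Fact mtd_scaleDr : right_distributive mtd_scale mtd_add.
Proof.
move=> k; elim/martindale_ind=> p; elim/martindale_ind=> q.
rewrite pi_add !pi_scale pi_add.
by apply/martindale_eqP/mequivI => x _ _ /=; rewrite scalerDr.
Qed.

Fact mtd_scaleDl x k l :
  mtd_scale (k + l) x = mtd_add (mtd_scale k x) (mtd_scale l x).
Proof.
elim/martindale_ind: x => p; rewrite !pi_scale pi_add.
by apply/martindale_eqP/mequivI => x _ _ /=; rewrite scalerDl.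
Qed.

HB.instance Definition _ := GRing.Zmodule_isLmodule.Build K martindale
  mtd_scaleA mtd_scale1 mtd_scaleDr mtd_scaleDl.

Fact mtd_scaleAl k x y : mtd_scale k (mtd_mul x y) = mtd_mul (mtd_scale k x) y.
Proof.
elim/martindale_ind: x => p; elim/martindale_ind: y => q.
by rewrite pi_mul !pi_scale pi_mul; apply/martindale_eqP/mequivI.
Qed.

HB.instance Definition _ :=
  GRing.Lmodule_isLalgebra.Build K martindale mtd_scaleAl.

Fact mtd_scaleAr k x y : mtd_scale k (mtd_mul x y) = mtd_mul x (mtd_scale k y).
Proof.
elim/martindale_ind: x => p; elim/martindale_ind: y => q.
rewrite pi_mul !pi_scale pi_mul.
apply/martindale_eqP/mequivI => x px _ /=.
rewrite -[in RHS](mulr1 (mfun q x)) scalerAr mfunM; last exact: mfun_mul px.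
by rewrite -scalerAr mulr1.
Qed.

HB.instance Definition _ :=
  GRing.Lalgebra_isAlgebra.Build K martindale mtd_scaleAr.

(* The extended centre is the centre of the Martindale ring of quotients. *)
Definition central : {pred martindale} :=
  fun x => `[< forall y, x * y = y * x >].

Fact central_subalg : GRing.subalg_closed central.
Proof.
split=> [|k x y|x y].
- by apply/asboolP => y; rewrite mul1r mulr1.
- move=> /asboolP xC /asboolP yC; apply/asboolP => z.
  by rewrite mulrDl mulrDr -scalerAl -scalerAr xC yC.
- move=> /asboolP xC /asboolP yC; apply/asboolP => z.
  by rewrite -mulrA yC mulrA xC mulrA.
Qed.

HB.instance Definition _ :=
  GRing.isSubalgClosed.Build K martindale central central_subalg.

Record extended_centre := ExtendedCentre {
  ecval :> martindale;
  ecvalP : ecval \in central }.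

HB.instance Definition _ := [isSub for ecval].
HB.instance Definition _ := [Choice of extended_centre by <:].
HB.instance Definition _ :=
  [SubChoice_isSubAlgebra of extended_centre by <:].

Fact extended_centre_mulC : commutative (@GRing.mul extended_centre).
Proof.
by move=> x y; apply: val_inj; rewrite !rmorphM; exact: (asboolP _ (ecvalP x)).
Qed.

HB.instance Definition _ :=
  GRing.PzRing_hasCommutativeMul.Build extended_centre extended_centre_mulC.

End Martindale.

(* Main.v *)
From HB Require Import structures.
Require Import Defs.
From mathcomp Require Import all_boot all_order all_algebra.
From mathcomp Require Import all_fingroup.
From mathcomp Require Import all_classical all_reals all_analysis.
From mathcomp Require mpoly monalg.
Import -(notations) mpoly monalg.
From mathcomp Require Import zify ring lra.

Set Implicit Arguments.
Unset Strict Implicit.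
Unset Printing Implicit Defensive.

Import Order.TTheory GRing.Theory Num.Theory.

Local Open Scope classical_set_scope.
Local Open Scope ring_scope.

(** Let [Z] be the extended centre and [z_1, ..., z_d] in [Z] algebraically
independent over [K].  They multiply some nonzero ideal [I] of [A] into [A].
By hypothesis [I] is not locally nilpotent, so it contains a finite-dimensional
[W] none of whose powers is zero.  A monomial of degree at most [n] in the
[z_i] can be distributed over the factors of a product of [n] elements of [W];
hence it maps the products that span [V^(Cn) W^n V^(Cn)] into some [V^(C'n)].
Monomials being independent over [K], the dimension of [V^(C'n)] over [K] is
at least about [n^d] times the dimension over [Z] of the span of
[V^(Cn) W^n V^(Cn)] in the central closure [B = A Z] ([trdeg_growth]).  What
remains concerns only the algebra [B] over the field [Z], which is prime,
finitely generated and satisfies no standard identity: the last dimension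
grows at least like [n^2] ([power_growth]).

That is proved by producing [n] independent vectors in each of [n] steps, or
else by finding a finiteness condition that reduces [W] to something larger.

(1) Consider the right ideals [W^m B].  If [W^m B / W^(m+1) B] is always
infinite-dimensional, every step of this chain contributes [n] dimensions,
because a finitely generated module of infinite dimension grows by at least
one dimension at a time ([growth], [right_chain_dichotomy]).  Otherwise put
[U = W^m]; the [p] with [U B p] inside [W U B] form an ideal [P] of finite
codimension.  It is generated by a finite-dimensional [Q] that [V] can be
pushed through ([V_idgen]), and [U Q] lies in [W U V^c].  So [U Q^n] lies in
[W^n U V^(Cn)]: powers of [Q] may replace powers of [W] ([idgen_shiftn]).

(2) Consider the left ideals [B Y V^j] for [Y = U Q^N].  Either they again give
[n^2] dimensions, or some [Y V^j] has zero right annihilator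
([rann_dichotomy]).  In the second case left multiplication by a basis of
[Y V^j] embeds the span of [Q^n, ..., Q^(Cn)] into finitely many copies of
[Y V^j (Q^n + ... + Q^(Cn))], so only [Q] matters ([rann_dim]).

(3) For [Q] Bergman's gap argument applies.  If [Q^k] has dimension more than
[k] modulo the higher powers for all [k], these dimensions add up to [n^2].
Otherwise, for one [k], at most [k] words of length [k] are normal, that is,
not in the span of smaller words and of the higher powers.  A word all of
whose factors of length [k] are normal is then periodic up to its ends
([few_factors_period]), so there is a bounded number of them in each length,
and [V^n] is contained in [Q^n + ... + Q^(n+c)] up to linearly many dimensions
([idgen_growth]).  It then suffices that [V^n] itself grows
quadratically.

(4) The same argument for [V] leaves linear growth as the only other
possibility.  Then the periodic words yield an element [t] transcendental over
[Z], and linear growth bounds the rank [r] of [B] as a right [Z[t]]-module.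
The action of [B] on [B] modulo torsion is by [r x r] matrices over [Z(t)], so
a standard polynomial of large degree takes values [y] with [y B] torsion.  If
[y] were not zero, [rann_dichotomy] would contradict either linear growth or
the transcendence of [t].  So [B] would satisfy a standard identity
([no_linear_growth]). *)

(** * Subspaces of an algebra as an idempotent semiring *)

(* A set of vectors, hence a subspace, can be applied to a vector. *)
Identity Coercion fun_of_set : set >-> Funclass.

Section Subspaces.
Context {F : fieldType} {B : algType F}.

(** Bundled so that sum and product of subspaces form a semiring.  Powers, big
sums and their laws then come with the semiring structure, and inclusion of
carriers serves as the order. *)
Record subsp := Subsp {
  sub_set :> set B;
  sub_closed : sub_set 0 /\
    forall c x y, sub_set x -> sub_set y -> sub_set (c *: x + y) }.

Arguments sub_set : simpl never.

HB.instance Definition _ := gen_eqMixin subsp.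
HB.instance Definition _ := gen_choiceMixin subsp.

Implicit Types (X Y M N U V W : subsp) (x y z : B) (s t : seq B).

Lemma sub0 X : X 0. Proof. by case: X => ? []. Qed.

Lemma subL X c x y : X x -> X y -> X (c *: x + y).
Proof. by case: X => ? [? h]; exact: h. Qed.

Lemma subZ X c x : X x -> X (c *: x).
Proof. by move=> Xx; rewrite -[_ *: _]addr0; apply: subL => //; exact: sub0. Qed.

Lemma subD X x y : X x -> X y -> X (x + y).
Proof. by move=> Xx Xy; rewrite -[x]scale1r; exact: subL. Qed.

Lemma subN X x : X x -> X (- x).
Proof. by move=> Xx; rewrite -scaleN1r; exact: subZ. Qed.

Lemma subB X x y : X x -> X y -> X (x - y).
Proof. by move=> Xx Xy; apply: subD => //; exact: subN. Qed.

Lemma sub_sum X (I : Type) (r : seq I) (P : pred I) (G : I -> B) :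
  (forall i, P i -> X (G i)) -> X (\sum_(i <- r | P i) G i).
Proof.
move=> h; elim/big_ind: _ => //; [exact: sub0 | move=> x y; exact: subD].
Qed.

Lemma sub_cancelr X x y : X y -> X (x + y) -> X x.
Proof. by move=> Xy Xxy; rewrite -[x](addrK y); exact: subB. Qed.

Lemma subsp_eqP X Y : X `<=` Y -> Y `<=` X -> X = Y.
Proof.
case: X Y => X Xc [Y Yc] /= XY YX.
have E : X = Y by apply/seteqP.
by case: _ / E in Yc XY YX *; congr Subsp; exact: Prop_irrelevance.
Qed.

Fact zero_closed : [set 0 : B] 0 /\ forall c x y,
  [set 0] x -> [set 0] y -> [set (0 : B)] (c *: x + y).
Proof. by split=> // c x y -> ->; rewrite /= scaler0 addr0. Qed.
Definition sub_zero := Subsp zero_closed.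

Fact add_closed X Y : [set x + y | x in X & y in Y] 0 /\ forall c x y,
  [set x + y | x in X & y in Y] x -> [set x + y | x in X & y in Y] y ->
  [set x + y | x in X & y in Y] (c *: x + y).
Proof.
split; first by exists 0; [exact: sub0 | exists 0; [exact: sub0 | rewrite addr0]].
move=> c _ _ [x Xx [y Yy <-]] [x' Xx' [y' Yy' <-]].
exists (c *: x + x'); first exact: subL.
by exists (c *: y + y'); [exact: subL | rewrite scalerDr addrACA].
Qed.
Definition sub_add X Y := Subsp (add_closed X Y).

Fact mul_closed X Y : ideal_mul X Y 0 /\ forall c x y,
  ideal_mul X Y x -> ideal_mul X Y y -> ideal_mul X Y (c *: x + y).
Proof.
split; first by exists [::]; rewrite ?big_nil.
move=> c _ _ [s sP ->] [t tP ->].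
exists ([seq (c *: p.1, p.2) | p <- s] ++ t).
  move=> p; rewrite mem_cat => /orP[/mapP[q /sP[? ?] ->]|/tP //].
  by split=> //=; exact: subZ.
rewrite big_cat big_map scaler_sumr /=; congr (_ + _).
by apply: eq_bigr => p _; rewrite scalerAl.
Qed.
Definition sub_mul X Y := Subsp (mul_closed X Y).

Fact line_closed x : range (fun c => c *: x) 0 /\ forall c y z,
  range ( *:%R^~ x) y -> range ( *:%R^~ x) z -> range ( *:%R^~ x) (c *: y + z).
Proof.
split; first by exists 0; rewrite ?scale0r.
by move=> c _ _ [a _ <-] [b _ <-]; exists (c * a + b); rewrite // scalerDl scalerA.
Qed.
Definition line x := Subsp (line_closed x).

Lemma sub_mulM X Y x y : X x -> Y y -> sub_mul X Y (x * y).
Proof.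
move=> Xx Yy; exists [:: (x, y)]; last by rewrite big_seq1.
by move=> p; rewrite inE => /eqP ->.
Qed.

Lemma sub_mul_le X Y N : (forall x y, X x -> Y y -> N (x * y)) ->
  sub_mul X Y `<=` N.
Proof.
move=> h _ [s sP ->]; rewrite big_seq; apply: sub_sum => p /sP[? ?]; exact: h.
Qed.

Lemma sub_add_le X Y N : X `<=` N -> Y `<=` N -> sub_add X Y `<=` N.
Proof. by move=> XN YN _ [x /XN ? [y /YN ? <-]]; exact: subD. Qed.

Lemma sub_add_left X Y : X `<=` sub_add X Y.
Proof. by move=> x Xx; exists x => //; exists 0; [exact: sub0 | rewrite addr0]. Qed.

Lemma sub_add_right X Y : Y `<=` sub_add X Y.
Proof. by move=> y Yy; exists 0; [exact: sub0 | exists y => //; rewrite add0r]. Qed.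

Fact sub_addA : associative sub_add.
Proof.
move=> X Y Z; apply: subsp_eqP.
  move=> _ [x Xx [_ [y Yy [z Zz <-]] <-]]; rewrite addrA.
  by exists (x + y); [exists x => //; exists y | exists z].
move=> _ [_ [x Xx [y Yy <-]] [z Zz <-]]; rewrite -addrA.
by exists x => //; exists (y + z) => //; exists y => //; exists z.
Qed.

Fact sub_addC : commutative sub_add.
Proof.
by move=> X Y; apply: subsp_eqP => _ [x ? [y ? <-]];
  rewrite addrC; exists y => //; exists x.
Qed.

Fact sub_add0 : left_id sub_zero sub_add.
Proof.
move=> X; apply: subsp_eqP; last exact: sub_add_right.
by move=> _ [_ -> [x Xx <-]]; rewrite add0r.
Qed.

HB.instance Definition _ :=
  GRing.isNmodule.Build subsp sub_addA sub_addC sub_add0.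

Fact sub_mulA : associative sub_mul.
Proof.
move=> X Y Z; apply: subsp_eqP.
- apply: sub_mul_le => x _ Xx [s sP ->]; rewrite mulr_sumr big_seq.
  apply: sub_sum => p /sP[? ?]; rewrite mulrA.
  by apply: sub_mulM => //; exact: sub_mulM.
- apply: sub_mul_le => _ z [s sP ->] Zz; rewrite mulr_suml big_seq.
  apply: sub_sum => p /sP[? ?]; rewrite -mulrA.
  by apply: sub_mulM => //; exact: sub_mulM.
Qed.

Lemma mem_line x : line x x.
Proof. by exists 1; rewrite ?scale1r. Qed.

Lemma line_le x N : N x -> line x `<=` N.
Proof. by move=> Nx _ [c _ <-]; exact: subZ. Qed.

Fact sub_mul1 : left_id (line 1) sub_mul.
Proof.
move=> X; apply: subsp_eqP.
  apply: sub_mul_le => _ x [c _ <-] Xx.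
  by rewrite -scalerAl mul1r; exact: subZ.
by move=> x Xx; rewrite -[x]mul1r; apply: sub_mulM => //; exact: mem_line.
Qed.

Fact sub_mulr1 : right_id (line 1) sub_mul.
Proof.
move=> X; apply: subsp_eqP.
  apply: sub_mul_le => x _ Xx [c _ <-].
  by rewrite -scalerAr mulr1; exact: subZ.
by move=> x Xx; rewrite -[x]mulr1; apply: sub_mulM => //; exact: mem_line.
Qed.

Fact sub_mulDl : left_distributive sub_mul sub_add.
Proof.
move=> X Y Z; apply: subsp_eqP.
  apply: sub_mul_le => _ z [x Xx [y Yy <-]] Zz; rewrite mulrDl.
  by apply: subD; [apply: sub_add_left|apply: sub_add_right]; exact: sub_mulM.
by apply: sub_add_le; apply: sub_mul_le => x z Xx Zz; apply: sub_mulM => //;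
  [exact: sub_add_left|exact: sub_add_right].
Qed.

Fact sub_mulDr : right_distributive sub_mul sub_add.
Proof.
move=> X Y Z; apply: subsp_eqP.
  apply: sub_mul_le => x _ Xx [y Yy [z Zz <-]]; rewrite mulrDr.
  by apply: subD; [apply: sub_add_left|apply: sub_add_right]; exact: sub_mulM.
by apply: sub_add_le; apply: sub_mul_le => x z Xx Zz; apply: sub_mulM => //;
  [exact: sub_add_left|exact: sub_add_right].
Qed.

Fact sub_mul0l : left_zero sub_zero sub_mul.
Proof.
move=> X; apply: subsp_eqP; last by move=> _ ->; exact: sub0.
by apply: sub_mul_le => _ x -> _ /=; rewrite mul0r.
Qed.

Fact sub_mul0r : right_zero sub_zero sub_mul.
Proof.
move=> X; apply: subsp_eqP; last by move=> _ ->; exact: sub0.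
by apply: sub_mul_le => x _ _ -> /=; rewrite mulr0.
Qed.

HB.instance Definition _ := GRing.Nmodule_isPzSemiRing.Build subsp
  sub_mulA sub_mul1 sub_mulr1 sub_mulDl sub_mulDr sub_mul0l sub_mul0r.

Fact top_closed : [set: B] 0 /\ forall c x y,
  [set: B] x -> [set: B] y -> [set: B] (c *: x + y).
Proof. by []. Qed.
Definition top := Subsp top_closed.

Lemma memM X Y x y : X x -> Y y -> (X * Y)%R (x * y).
Proof. exact: sub_mulM. Qed.

Lemma mulS_le X Y N : (forall x y, X x -> Y y -> N (x * y)) -> X * Y `<=` N.
Proof. exact: sub_mul_le. Qed.

Lemma addS_le X Y N : X `<=` N -> Y `<=` N -> X + Y `<=` N.
Proof. exact: sub_add_le. Qed.

Lemma le_addl X Y : X `<=` X + Y. Proof. exact: sub_add_left. Qed.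

Lemma le_addr X Y : Y `<=` X + Y. Proof. exact: sub_add_right. Qed.

Lemma leD X X' Y Y' : X `<=` X' -> Y `<=` Y' -> X + Y `<=` X' + Y'.
Proof.
by move=> XX YY; apply: addS_le => x h; [apply/le_addl/XX | apply/le_addr/YY].
Qed.

Lemma leM X X' Y Y' : X `<=` X' -> Y `<=` Y' -> X * Y `<=` X' * Y'.
Proof.
by move=> XX YY; apply: mulS_le => x y Xx Yy; apply: memM; [exact: XX|exact: YY].
Qed.

Lemma leXS X Y n : X `<=` Y -> X ^+ n `<=` Y ^+ n.
Proof. by move=> XY; elim: n => // n IH; rewrite !exprS; exact: leM. Qed.

Lemma sum_le (I : eqType) (r : seq I) (P : pred I) (G : I -> subsp) N :
  (forall i, i \in r -> P i -> G i `<=` N) -> \sum_(i <- r | P i) G i `<=` N.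
Proof.
move=> h; rewrite big_seq_cond; elim/big_ind: _.
- by move=> _ ->; exact: sub0.
- by move=> X Y; exact: addS_le.
- by move=> i /andP[]; exact: h.
Qed.

Lemma le_sum (I : eqType) (r : seq I) (P : pred I) (G : I -> subsp) i :
  i \in r -> P i -> G i `<=` \sum_(i <- r | P i) G i.
Proof.
elim: r => // j r IH; rewrite inE big_cons => /orP[/eqP -> -> |ir Pi].
  exact: le_addl.
by case: ifP => _; [move=> x /(IH ir Pi); exact: le_addr | exact: IH].
Qed.

Lemma le_mulr X V : V 1 -> X `<=` X * V.
Proof. by move=> V1 x Xx; rewrite -[x]mulr1; exact: memM. Qed.

Lemma le_mull X V : V 1 -> X `<=` V * X.
Proof. by move=> V1 x Xx; rewrite -[x]mul1r; exact: memM. Qed.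

Lemma le_exp V m n : V 1 -> (m <= n)%N -> V ^+ m `<=` V ^+ n.
Proof.
move=> V1 /subnK <-; elim: (n - m)%N => // k IH.
by rewrite addSn exprS => x /IH; exact: le_mull.
Qed.

Lemma mem1X V n : V 1 -> (V ^+ n)%R 1.
Proof. by move=> V1; apply: (le_exp V1 (leq0n n)); exact: mem_line. Qed.

Lemma le0S X : (0 : subsp) `<=` X.
Proof. by move=> _ ->; exact: sub0. Qed.

Lemma neq0_ex X : X <> 0 -> exists2 x, X x & x != 0.
Proof.
move=> X0; apply: contrapT => h; apply: X0; apply: subsp_eqP; last exact: le0S.
by move=> x Xx; apply: contrapT => /eqP x0; apply: h; exists x.
Qed.

Definition fspan s : subsp := \sum_(y <- s) line y.

Lemma fspan_nil : fspan [::] = 0. Proof. by rewrite /fspan big_nil. Qed.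
Lemma fspan_cons x s : fspan (x :: s) = line x + fspan s.
Proof. by rewrite /fspan big_cons. Qed.
Lemma fspan_cat s t : fspan (s ++ t) = fspan s + fspan t.
Proof. by rewrite /fspan big_cat. Qed.

Lemma fspan_le s N : (forall x, x \in s -> N x) -> fspan s `<=` N.
Proof. by move=> h; apply: sum_le => x xs _; apply: line_le; exact: h. Qed.

Lemma mem_fspan s x : x \in s -> fspan s x.
Proof. by move=> xs; apply: (le_sum xs) => //; exact: mem_line. Qed.

Lemma fspanM s t : fspan s * fspan t = fspan [seq x * y | x <- s, y <- t].
Proof.
apply: subsp_eqP.
  rewrite /fspan mulr_suml; apply: sum_le => x xs _.
  rewrite mulr_sumr; apply: sum_le => y yt _.
  apply: mulS_le => _ _ [c _ <-] [d _ <-].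
  rewrite -scalerAl -scalerAr; do 2 apply: subZ.
  by apply: mem_fspan; apply/allpairsP; exists (x, y).
by apply: fspan_le => _ /allpairsP[[x y] /= [xs yt ->]]; apply: memM; exact: mem_fspan.
Qed.

(** Linear independence of [s] modulo [M].  In this form, which asks every
entry to lie outside the span of [M] and of the later entries, independence
passes along chains of subspaces without any coefficients. *)
Fixpoint free_mod M s : Prop :=
  if s is x :: s' then ~ (M + fspan s')%R x /\ free_mod M s' else True.

(** Bounds on the dimension of [(X + M) / M].  That quotient is infinite-dimensional
in many uses, so only the bounds are given a name. *)
Definition dim_ge M X n := exists s, [/\ size s = n, forall x, x \in s -> X x
  & free_mod M s].
Definition dim_le M X n := exists s, [/\ (size s <= n)%N, forall x, x \in s -> X x
  & X `<=` M + fspan s].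

Lemma free_modS M M' s : M `<=` M' -> free_mod M' s -> free_mod M s.
Proof.
move=> MM; elim: s => //= x s IH [xs /IH fs]; split=> //; apply: contra_not xs.
by apply: leD.
Qed.

Lemma free_mod_cat M s t :
  free_mod M t -> free_mod (M + fspan t) s -> free_mod M (s ++ t).
Proof.
move=> ft; elim: s => //= x s IH [xs /IH fs]; split=> //.
by rewrite fspan_cat [fspan s + _]addrC addrA.
Qed.

Lemma line_addP M x y : (M + line y)%R x -> M x \/ (M + line x)%R y.
Proof.
move=> [m Mm [_ [c _ <-] <-]]; have [->|c0] := eqVneq c 0.
  by left; rewrite scale0r addr0.
right; exists (- (c^-1 *: m)); first by apply: subN; exact: subZ.
exists (c^-1 *: (m + c *: y)); first by exists c^-1.
by rewrite scalerDr scalerA mulVf // scale1r addKr.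
Qed.

Lemma free_mod_line M s y : free_mod M s -> ~ (M + fspan s)%R y ->
  free_mod (M + line y) s.
Proof.
elim: s => //= x s IH [xs fs] ys; split; last first.
  apply: IH => //; apply: contra_not ys; rewrite fspan_cons.
  by apply: leD => //; exact: le_addr.
rewrite addrAC => /line_addP[//|]; rewrite -addrA [fspan s + _]addrC => h.
by apply: ys; rewrite fspan_cons.
Qed.

(** A line costs at most one vector.  Read from the right, the first entry that
becomes dependent is dropped; it shows that [y] lies in the span of [M] and of
the entries up to it, so the entries further left see no change. *)
Lemma free_mod_exchange M s y : free_mod M s ->
  exists t, [/\ free_mod (M + line y) t, (size s <= (size t).+1)%N
    & {subset t <= s}].
Proof.
elim: s => [|x s IH] /=; first by exists [::].
move=> [xs fs]; have [t [ft st ts]] := IH fs.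
have [fs'|nfs] := pselect (free_mod (M + line y) s).
  by exists s; split=> // z zs; rewrite inE zs orbT.
have ys : (M + fspan s)%R y by apply: contrapT => ys; apply: nfs; exact: free_mod_line.
exists (x :: t); split=> //=; last first.
  by move=> z; rewrite !inE => /orP[->//|/ts ->]; rewrite orbT.
split=> //; apply: contra_not xs; apply: addS_le.
  by apply: addS_le; [exact: le_addl | exact: line_le].
by apply: fspan_le => z /ts zs; apply: le_addr; exact: mem_fspan.
Qed.

Lemma steinitz M s t : free_mod M s -> (forall x, x \in s -> (M + fspan t)%R x) ->
  (size s <= size t)%N.
Proof.
elim: t M s => [|y t IH] M s fs sub.
  case: s fs sub => // x s [xs _] /(_ x (mem_head _ _)).
  by rewrite fspan_nil addr0 => Mx; case: xs; exact: le_addl.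
have [u [fu su us]] := free_mod_exchange y fs.
apply: leq_trans su _; rewrite /= ltnS; apply: (IH (M + line y)) => // x /us /sub.
by rewrite fspan_cons addrA.
Qed.

Lemma dim_ge_dim_le M X m n : dim_ge M X m -> dim_le M X n -> (m <= n)%N.
Proof.
move=> [s [<- sX fs]] [t [tn _ XM]]; apply: leq_trans tn.
by apply: (steinitz fs) => x /sX /XM.
Qed.

Lemma dim_ge0 M X : dim_ge M X 0. Proof. by exists [::]. Qed.

Lemma dim_geS M X n : dim_ge M X n.+1 -> dim_ge M X n.
Proof.
move=> [[|x s] [] // [sn] sX [_ fs]]; exists s; split=> // y ys.
by apply: sX; rewrite inE ys orbT.
Qed.

Lemma dim_ge_leq M X m n : (m <= n)%N -> dim_ge M X n -> dim_ge M X m.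
Proof. by move=> /subnK <-; elim: (n - m)%N => // k IH /dim_geS. Qed.

Lemma dim_geNdim_le M X n : ~ dim_ge M X n.+1 -> dim_le M X n.
Proof.
elim: n => [|n IH] h.
  have XM : X `<=` M.
    move=> x Xx; apply: contrapT => Mx; apply: h; exists [:: x]; split=> //=.
    - by move=> y; rewrite inE => /eqP ->.
    - by split=> //; rewrite fspan_nil addr0.
  by exists [::]; split=> // x /XM Mx; exact: le_addl.
have [[s [sn sX fs]]|hn] := pselect (dim_ge M X n.+1); last first.
  by have [s [ss sX XM]] := IH hn; exists s; split=> //; exact: ltnW.
exists s; split=> //; first by rewrite sn.
move=> x Xx; apply: contrapT => xs; apply: h; exists (x :: s); split=> //=.
- by rewrite sn.
- by move=> y; rewrite inE => /orP[/eqP -> |/sX].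
Qed.

Lemma dim_ge_mono M M' X X' n : M' `<=` M -> X `<=` X' -> dim_ge M X n -> dim_ge M' X' n.
Proof.
move=> MM XX [s [sn sX fs]]; exists s; split=> // [x /sX /XX //|].
exact: free_modS MM fs.
Qed.

(** Dimensions add up along a chain: vectors of [X'] independent modulo
[M'], which contains [X], extend any independent family of [X].  All
quadratic lower bounds below are sums of this kind. *)
Lemma dim_geD M M' X X' m n : M `<=` M' -> X `<=` M' -> X `<=` X' ->
  dim_ge M X m -> dim_ge M' X' n -> dim_ge M X' (m + n).
Proof.
move=> MM XM XX [t [tn tX ft]] [s [sn sX fs]]; exists (s ++ t); split.
- by rewrite size_cat sn tn addnC.
- by move=> x; rewrite mem_cat => /orP[/sX //|/tX /XX].
- apply: free_mod_cat => //; apply: free_modS fs; apply: addS_le => //.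
  by apply: fspan_le => x /tX /XM.
Qed.

Definition findim_mod M X := exists n, dim_le M X n.

Lemma dim_le_fspan M X s : X `<=` M + fspan s -> dim_le M X (size s).
Proof.
move=> XM; apply: dim_geNdim_le => -[t [tn tX ft]].
suff : (size t <= size s)%N by rewrite tn ltnn.
by apply: (steinitz ft) => x /tX /XM.
Qed.

Lemma dim_ge_fspan M X m t : dim_ge M X m -> X `<=` M + fspan t -> (m <= size t)%N.
Proof. by move=> dm /dim_le_fspan; exact: dim_ge_dim_le. Qed.

Lemma dim_le0_fspan X : findim_mod 0 X -> exists s, X = fspan s.
Proof.
move=> [n [s [_ sX Xs]]]; exists s; apply: subsp_eqP; last exact: fspan_le.
by rewrite add0r in Xs.
Qed.

Lemma fd_fspan s : findim_mod 0 (fspan s).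
Proof. by exists (size s); apply: dim_le_fspan; rewrite add0r. Qed.

Lemma fd_sub X Y : Y `<=` X -> findim_mod 0 X -> findim_mod 0 Y.
Proof. by move=> YX /dim_le0_fspan[s Es]; exists (size s); apply: dim_le_fspan;
  rewrite add0r -Es. Qed.

Lemma fdM X Y : findim_mod 0 X -> findim_mod 0 Y -> findim_mod 0 (X * Y).
Proof.
by move=> /dim_le0_fspan[s ->] /dim_le0_fspan[t ->]; rewrite fspanM; exact: fd_fspan.
Qed.

Lemma fdD X Y : findim_mod 0 X -> findim_mod 0 Y -> findim_mod 0 (X + Y).
Proof.
by move=> /dim_le0_fspan[s ->] /dim_le0_fspan[t ->]; rewrite -fspan_cat; exact: fd_fspan.
Qed.

Lemma fd_line x : findim_mod 0 (line x).
Proof.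
have -> : line x = fspan [:: x] by rewrite fspan_cons fspan_nil addr0.
exact: fd_fspan.
Qed.

Lemma fdX X n : findim_mod 0 X -> findim_mod 0 (X ^+ n).
Proof.
move=> fX; elim: n => [|n IH]; first exact: fd_line.
by rewrite exprS; exact: fdM.
Qed.

Lemma fd_sum (I : Type) (r : seq I) (P : pred I) (G : I -> subsp) :
  (forall i, P i -> findim_mod 0 (G i)) -> findim_mod 0 (\sum_(i <- r | P i) G i).
Proof.
move=> h; elim/big_ind: _ => //; last by move=> X Y; exact: fdD.
by have := fd_fspan [::]; rewrite fspan_nil.
Qed.

Lemma fd_dim X : findim_mod 0 X -> exists n, dim_ge 0 X n /\ dim_le 0 X n.
Proof.
move=> [n Xn]; elim: n Xn => [|n IH] Xn; first by exists 0%N; split=> //; exact: dim_ge0.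
have [d|/dim_geNdim_le/IH //] := pselect (dim_ge 0 X n.+1).
by exists n.+1.
Qed.

(** If [Y n.+1] is contained in [M + Y n] for a single [n], applying [Phi]
repeatedly shows that the sequence stays in [M + Y n] for ever.  If that never
happens, every step contributes a new vector. *)
Lemma growth (M : subsp) (Phi : subsp -> subsp) (Y : nat -> subsp) :
  (forall X X', X `<=` X' -> Phi X `<=` Phi X') ->
  (forall X X', Phi (X + X') = Phi X + Phi X') ->
  Phi M `<=` M -> (forall n, Y n.+1 = Phi (Y n)) -> (forall n, Y n `<=` Y n.+1) ->
  (exists c, forall n, Y n `<=` M + Y c) \/ (forall n, dim_ge M (Y n) n.+1).
Proof.
move=> Pmono PD PM YS Yinc.
have Yle m n : (m <= n)%N -> Y m `<=` Y n.
  by move=> /subnK <-; elim: (n - m)%N => // k IH x /IH; exact: Yinc.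
have [[c hc]|h] := pselect (exists c, Y c.+1 `<=` M + Y c).
  left; exists c => n; have [nc|cn] := leqP n c.
    by move=> x /(Yle _ _ nc); exact: le_addr.
  rewrite -(subnK (ltnW cn)); elim: (n - c)%N => [|k IH]; first exact: le_addr.
  rewrite addSn YS => x /(Pmono _ _ IH); rewrite PD.
  move: x; apply: addS_le => x; first by move=> /PM; exact: le_addl.
  by rewrite -YS; exact: hc.
have [Y0|Y0] := pselect (Y 0%N `<=` M).
  left; exists 0%N => n x; suff h' : Y n `<=` M by move=> /h'; exact: le_addl.
  by elim: n => // n IH; rewrite YS => y /(Pmono _ _ IH) /PM.
right; elim=> [|n [s [sn sY fs]]].
  apply: contrapT => /dim_geNdim_le[[|? ?] [//= _ _]].
  by rewrite fspan_nil addr0.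
have [x Yx Mx] : exists2 x, Y n.+1 x & ~ (M + Y n)%R x.
  apply: contrapT => hx; apply: h; exists n => x Yx; apply: contrapT => Mx.
  by apply: hx; exists x.
exists (x :: s); split=> /=; first by rewrite sn.
- by move=> y; rewrite inE => /orP[/eqP -> //|/sY]; exact: Yinc.
- split=> //; apply: contra_not Mx; apply: leD => //; exact: fspan_le.
Qed.

Definition lin (f : B -> B) := forall c x y, f (c *: x + y) = c *: f x + f y.

Lemma lin0 f : lin f -> f 0 = 0.
Proof.
by move=> lf; have := lf 1 0 0; rewrite !scale1r addr0 -[X in X = _]addr0 => /addrI.
Qed.

Fact lin_preim_closed (f : B -> B) (lf : lin f) M : (f @^-1` M) 0 /\
  forall c x y, (f @^-1` M) x -> (f @^-1` M) y -> (f @^-1` M) (c *: x + y).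
Proof.
split=> [|c x y]; rewrite /preimage /=; first by rewrite lin0 //; exact: sub0.
by rewrite lf; exact: subL.
Qed.
Definition lin_preim f lf M := Subsp (@lin_preim_closed f lf M).

Fact capS_closed X Y : (X `&` Y) 0 /\
  forall c x y, (X `&` Y) x -> (X `&` Y) y -> (X `&` Y) (c *: x + y).
Proof.
split; first by split; exact: sub0.
by move=> c x y [? ?] [? ?]; split; exact: subL.
Qed.
Definition capS X Y := Subsp (capS_closed X Y).

(** Each vector of [s] accounts for at most one dimension of the quotient: a
vector [x0] of [X] whose image involves the head of [s] can be used to clear
that head from the images of all others. *)
Lemma lin_preim_cofin f (lf : lin f) X M s :
  (forall x, X x -> (M + fspan s)%R (f x)) ->
  exists2 t, (size t <= size s)%N & X `<=` capS X (lin_preim lf M) + fspan t.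
Proof.
elim: s X => [|y s IH] X h.
  exists [::] => // x Xx; apply: le_addl; split=> //=.
  by have := h x Xx; rewrite fspan_nil addr0.
have [hX|/existsNP[x0 /not_implyP[Xx0 fx0]]] :=
    pselect (forall x, X x -> (M + fspan s)%R (f x)).
  by have [t ts XM] := IH X hX; exists t => //=; exact: leqW.
pose X' := capS X (lin_preim lf (M + fspan s)).
have [x [Xx hx]|t ts X'M] := IH X'; first exact: hx.
exists (x0 :: t) => // x Xx.
have h0 := h x0 Xx0; rewrite fspan_cons addrCA addrC in h0.
have hx := h x Xx; rewrite fspan_cons addrCA addrC in hx.
have [//|[m Mm [_ [d _ <-] Ey]]] := line_addP h0.
have [m' Mm' [_ [c _ <-] Ex]] := hx.
have X'x : X' (x - (c * d) *: x0).
  split; first by apply: subB => //; exact: subZ.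
  have -> : lin_preim lf (M + fspan s) (x - (c * d) *: x0) =
    (M + fspan s)%R (f (x - (c * d) *: x0)) by [].
  have -> : f (x - (c * d) *: x0) = m' + c *: m.
    rewrite addrC -scaleNr lf scaleNr -Ex -Ey scalerDr scalerA (addrA m').
    by rewrite [_ + _ *: f x0]addrC addKr.
  by apply: subD => //; exact: subZ.
rewrite -[x](subrK ((c * d) *: x0)); apply: subD; last first.
  by apply: subZ; apply: le_addr; apply: mem_fspan; exact: mem_head.
have := X'M _ X'x; apply: leD; first by move=> z [[? _] ?].
by rewrite fspan_cons; exact: le_addr.
Qed.

End Subspaces.

Arguments sub_set : simpl never.

(** * Periods of words *)
Section Periods.
Local Open Scope nat_scope.
Context {T : eqType}.
Implicit Types (w : nat -> T) (p g d lo hi : nat).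

Definition has_period w p lo hi :=
  forall j, lo <= j -> j + p < hi -> w j = w (j + p).

Lemma has_period_sub w p lo hi lo' hi' : lo <= lo' -> hi' <= hi ->
  has_period w p lo hi -> has_period w p lo' hi'.
Proof. by move=> ll hh h j lj jh; apply: h; lia. Qed.

Lemma has_periodM w p lo hi m j : has_period w p lo hi ->
  lo <= j -> j + m * p < hi -> w j = w (j + m * p).
Proof.
move=> h lj; elim: m => [|m IH] mh; first by rewrite mul0n addn0.
rewrite IH; last by rewrite mulSn in mh; lia.
by rewrite mulSn [p + _]addnC addnA; apply: h; rewrite mulSn in mh; lia.
Qed.

Lemma has_period_mod w p lo hi i j : has_period w p lo hi ->
  lo <= i < hi -> lo <= j < hi -> i = j %[mod p] -> w i = w j.
Proof.
move=> h; wlog ij : i j / i <= j => [hw hi1 hj e|].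
  have [ij|/ltnW ji] := leqP i j; first exact: hw.
  by apply/esym/hw.
move=> /andP[li _] /andP[_ jh] /eqP; rewrite eq_sym eqn_mod_dvd // => /dvdnP[m Em].
have -> : j = i + m * p by rewrite -Em subnKC.
by apply: has_periodM h li _; rewrite -Em subnKC.
Qed.

(** A period [g] of the large window carries every position to one in the small
window, where the divisor [d] of [g] is a period too. *)
Lemma has_period_ext w g d lo hi lo' hi' : 0 < g -> d %| g ->
  lo <= lo' -> hi' <= hi -> lo' + g <= hi' ->
  has_period w g lo hi -> has_period w d lo' hi' -> has_period w d lo hi.
Proof.
move=> g0 dg ll hh gap hg hd.
have rep j : lo <= j < hi -> exists r, [/\ lo' <= r < hi', w j = w r & j = r %[mod d]].
  move=> /andP[lj jh].
  suff [r [rb e]] : exists r, lo' <= r < lo' + g /\ j = r %[mod g].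
    exists r; split; first lia.
      by apply: has_period_mod hg _ _ e; lia.
    by rewrite -(modn_dvdm j dg) e modn_dvdm.
  have [lj'|jl'] := leqP lo' j.
    exists (lo' + (j - lo') %% g).
    rewrite -{3}(subnKC lj') modnDmr; split=> //.
    by have := ltn_pmod (j - lo') g0; lia.
  pose m := lo' + g - 1 - j.
  have Em : lo' + g - 1 = j + m by rewrite /m; lia.
  have lm := ltn_pmod m g0.
  exists (lo' + g - 1 - m %% g); split; first lia.
  rewrite Em {1}(divn_eq m g) addnA addnK.
  by rewrite addnC modnMDl.
move=> j lj jh.
have [r [rb -> er]] : exists r, [/\ lo' <= r < hi', w j = w r & j = r %[mod d]].
  by apply: rep; lia.
have [s [sb -> es]] : exists s,
    [/\ lo' <= s < hi', w (j + d) = w s & j + d = s %[mod d]].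
  by apply: rep; lia.
by apply: has_period_mod hd rb sb _; rewrite -er -es modnDr.
Qed.

(** The theorem of Fine and Wilf, by the Euclidean algorithm: if [g < p], then
[p - g] is a period of the window shortened by [g]. *)
Lemma fine_wilf w g p lo hi : 0 < g -> 0 < p -> lo + g + p <= hi.+1 ->
  has_period w g lo hi -> has_period w p lo hi ->
  has_period w (gcdn g p) lo hi.
Proof.
have [n] := ubnP (g + p); elim: n g p hi => // n IH g p hi gpn g0 p0 gap hg hp.
wlog gp : g p gpn g0 p0 gap hg hp / g <= p => [hw|].
  have [gp|/ltnW pg] := leqP g p; first exact: hw.
  by rewrite gcdnC; apply: hw => //; lia.
have [e|ne] := eqVneq g p; first by rewrite e gcdnn.
have -> : gcdn g p = gcdn g (p - g).
  by rewrite -[in LHS](subnK gp) gcdnDr.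
apply: (@has_period_ext w g _ lo hi lo (hi - g)) => //; try lia.
  exact: dvdn_gcdl.
apply: IH => //; try lia.
  by apply: has_period_sub hg; lia.
move=> j lj jh; rewrite hp //; last lia.
have -> : j + p = j + (p - g) + g by lia.
by apply/esym/hg; lia.
Qed.

Lemma has_period_merge w g lo hi p lo2 hi2 : 0 < g -> 0 < p ->
  maxn lo lo2 + g + p <= (minn hi hi2).+1 ->
  has_period w g lo hi -> has_period w p lo2 hi2 ->
  has_period w (gcdn g p) (minn lo lo2) (maxn hi hi2).
Proof.
move=> g0 p0 gap hg hp; set d := gcdn g p.
have hd : has_period w d (maxn lo lo2) (minn hi hi2).
  by apply: fine_wilf => //; [apply: has_period_sub hg|apply: has_period_sub hp]; lia.
have h1 : has_period w d lo hi.
  by apply: has_period_ext hg hd => //; [exact: dvdn_gcdl|lia|lia|lia].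
have h2 : has_period w d lo2 hi2.
  by apply: has_period_ext hp hd => //; [exact: dvdn_gcdr|lia|lia|lia].
have dg : d <= g by apply: dvdn_leq => //; exact: dvdn_gcdl.
move=> j lj jh.
have [a|b] : (lo <= j /\ j + d < hi) \/ (lo2 <= j /\ j + d < hi2) by lia.
  by apply: h1; case: a.
by apply: h2; case: b.
Qed.

(** Consecutive windows overlap just enough for [has_period_merge], so the local
periods combine into one for the whole range.  The inequalities in the
invariant say how far the merged stretch reaches to both sides of the current
window. *)
Lemma window_period w k l : 0 < k -> k + k <= l ->
  (forall i, i + (k + k) <= l -> exists a p, [/\ 0 < p, i <= a, a + p <= i + k
     & has_period w p a (a + p + k)]) ->
  exists p, 0 < p <= k /\ has_period w p k (l - k).+1.
Proof.
move=> k0 kl H.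
suff [g [lo [hi [gk h1 h2 h3 [h4 hg]]]]] : exists g lo hi,
    [/\ 0 < g <= k, l - (k + k) + k + g <= hi, lo + g <= l - (k + k) + k,
        lo + k + g <= hi & lo <= k /\ has_period w g lo hi].
  by exists g; split=> //; apply: has_period_sub hg; lia.
have : l - (k + k) + (k + k) <= l by lia.
elim: (l - (k + k)) => [|i IH] il.
  have [a [p [p0 _ ap hp]]] := H 0 il.
  by exists p, a, (a + p + k); split=> //; [lia..|split=> //; lia].
have [|g [lo [hi [gk h1 h2 h3 [h4 hg]]]]] := IH; first lia.
have [a [p [p0 ia ap hp]]] := H _ il.
have gp : 0 < gcdn g p by rewrite gcdn_gt0 p0 orbT.
have gg : gcdn g p <= g by apply: dvdn_leq; [lia|exact: dvdn_gcdl].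
have pp : gcdn g p <= p by apply: dvdn_leq; [lia|exact: dvdn_gcdr].
exists (gcdn g p), (minn lo a), (maxn hi (a + p + k)); split; [lia..|].
by split; [lia|apply: has_period_merge => //; lia].
Qed.

(** A version of the Morse-Hedlund theorem for finite words.  Among [k + 1]
consecutive factors of length [k] two coincide, which is a local period; only
[k] letters at either end may escape the common period. *)
Lemma few_factors_period (x0 : T) (w : seq T) (S : seq (seq T)) k : 0 < k ->
  k + k <= size w -> size S <= k ->
  (forall i, i + k <= size w -> take k (drop i w) \in S) ->
  exists p, 0 < p <= k /\ has_period (nth x0 w) p k (size w - k).+1.
Proof.
move=> k0 kw Sk HS; apply: window_period => // i il.
pose f a := take k (drop a w).
have : ~~ uniq [seq f a | a <- iota i k.+1].
  apply/negP => us; suff : k < size S by lia.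
  have := uniq_leq_size (s2 := S) us; rewrite size_map size_iota; apply.
  by move=> _ /mapP[a ai ->]; apply: HS; move: ai; rewrite mem_iota; lia.
move=> /(uniqPn [::])[m [n [mn nk]]]; rewrite size_map size_iota in nk.
rewrite !(nth_map 0) ?size_iota //; last lia.
rewrite !nth_iota //; last lia.
move=> e; exists (i + m), (n - m); split; [lia..|].
move=> j ij jb; have := congr1 (fun s => nth x0 s (j - (i + m))) e.
rewrite /f !nth_take; try lia.
rewrite !nth_drop; have -> : i + m + (j - (i + m)) = j by lia.
by have -> : i + n + (j - (i + m)) = j + (n - m) by lia.
Qed.

End Periods.

(** * Bergman's gap argument *)
Section Words.
Context {F : fieldType} {B : algType F}.
Context {q : nat} (x : 'I_q.+1 -> B).
Implicit Types (w : seq 'I_q.+1) (N : nat -> @subsp F B).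

Definition letters : @subsp F B := fspan [seq x i | i : 'I_q.+1].
Definition wval w : B := \prod_(i <- w) x i.

Lemma wval_cat (u v : seq _) : wval (u ++ v) = wval u * wval v.
Proof. by rewrite /wval big_cat. Qed.

Lemma mem_letters i : letters (x i).
Proof. by apply: mem_fspan; apply/fintype.imageP; exists i. Qed.

Lemma mem_wval w : (letters ^+ size w)%R (wval w).
Proof.
elim: w => [|i w IH]; rewrite /wval ?big_nil ?big_cons /=; first exact: mem_line.
by rewrite exprS; apply: memM; [exact: mem_letters|exact: IH].
Qed.

Definition words_span l (P : pred (l.-tuple 'I_q.+1)) : @subsp F B :=
  \sum_(w : l.-tuple 'I_q.+1 | P w) line (wval w).

Lemma words_span_le l (P : pred (l.-tuple 'I_q.+1)) (N : @subsp F B) :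
  (forall w : l.-tuple 'I_q.+1, P w -> N (wval w)) -> words_span P `<=` N.
Proof. by move=> h; apply: sum_le => w _ Pw; apply: line_le; exact: h. Qed.

Lemma mem_words_span l (P : pred (l.-tuple 'I_q.+1)) (w : l.-tuple 'I_q.+1) :
  P w -> words_span P (wval w).
Proof.
move=> Pw; apply: (@le_sum F B _ _ _ _ w) => //; first exact: mem_index_enum.
exact: mem_line.
Qed.

Lemma letters_exp_le l (N : @subsp F B) :
  (forall w, size w = l -> N (wval w)) -> letters ^+ l `<=` N.
Proof.
elim: l N => [|l IH] N h.
  by apply: line_le; have := h [::] erefl; rewrite /wval big_nil.
rewrite exprS; apply: mulS_le => y z Ly Lz.
have lin_mull : lin (fun z => y * z) by move=> c a b; rewrite mulrDr scalerAr.
suff /(_ z Lz) : letters ^+ l `<=` lin_preim lin_mull N by [].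
apply: IH => w sw.
have lin_mulr : lin (fun y => y * wval w) by move=> c a b; rewrite mulrDl scalerAl.
suff /(_ y Ly) : letters `<=` lin_preim lin_mulr N by [].
apply: fspan_le => _ /fintype.imageP[i _ ->].
by have := h (i :: w); rewrite /wval big_cons /= sw; apply.
Qed.

(** The value of a word read as a number in base [q.+1].  It orders the words of
a given length lexicographically, and being a number it allows induction. *)
Fixpoint word_rank w : nat :=
  if w is c :: w' then (c * q.+1 ^ size w' + word_rank w')%N else 0%N.

Lemma word_rank_cat (u v : seq _) :
  word_rank (u ++ v) = (word_rank u * q.+1 ^ size v + word_rank v)%N.
Proof.
elim: u => //= c u ->; rewrite size_cat mulnDl -addnA; congr (_ + _)%N.
by rewrite -mulnA -expnD addnC.
Qed.

Lemma word_rank_lt w : (word_rank w < q.+1 ^ size w)%N.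
Proof.
elim: w => //= c w IH; rewrite expnS.
apply: (@leq_trans ((c.+1) * q.+1 ^ size w)%N).
  by rewrite mulSn addnC ltn_add2r.
by rewrite leq_mul2r ltn_ord orbT.
Qed.

Lemma word_rank_inj (u v : seq _) : size u = size v -> word_rank u = word_rank v -> u = v.
Proof.
elim: u v => [|c u IH] [|d v] //= [suv] e.
have lu := word_rank_lt u; have lv := word_rank_lt v.
have q0 : (0 < q.+1 ^ size u)%N by rewrite expn_gt0.
have Ec := congr1 (divn^~ (q.+1 ^ size u)%N) e.
have Eu := congr1 (modn^~ (q.+1 ^ size u)%N) e.
rewrite /= -suv in lv Ec Eu.
rewrite !divnMDl // !divn_small // !addn0 in Ec.
rewrite !modnMDl !modn_small // in Eu.
by congr (_ :: _); [exact: val_inj | exact: IH].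
Qed.

(** Words are rewritten modulo subspaces [N l] that absorb letters on both sides.
Two choices are used: shorter words ([shifted]), and longer words, for powers
of an ideal ([idgen_growth]). *)
Section Rewriting.
Context (N : nat -> @subsp F B) (k : nat).
Hypotheses (NL : forall l, letters * N l `<=` N l.+1)
  (NR : forall l, N l * letters `<=` N l.+1).

Definition lower (u : k.-tuple 'I_q.+1) :=
  words_span [pred v : k.-tuple 'I_q.+1 | (word_rank v < word_rank u)%N].

Definition normal (u : k.-tuple 'I_q.+1) : bool :=
  `[< ~ (N k + lower u)%R (wval u) >].

Definition normal_words : seq (seq 'I_q.+1) := [seq tval t | t : k.-tuple 'I_q.+1 in normal].

(** Listed by decreasing rank, the values of the normal words are independent
modulo [N k] by the very definition of normality. *)
Lemma size_normal_words m : dim_le (N k) (letters ^+ k) m -> (size normal_words <= m)%N.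
Proof.
move=> hm; rewrite size_image cardE.
pose le (u v : k.-tuple 'I_q.+1) := (word_rank v <= word_rank u)%N.
pose lt (u v : k.-tuple 'I_q.+1) := (word_rank v < word_rank u)%N.
rewrite -(size_sort le); set s := sort le _.
have sn u : u \in s -> normal u by rewrite mem_sort mem_enum.
have sle : sorted le s by apply: sort_sorted => u v; rewrite /le; exact: leq_total.
have slt : sorted lt s.
  have us : uniq s by rewrite sort_uniq enum_uniq.
  elim: s us sle {sn} => //= u s IH /andP[us un] ule.
  have le_tr : transitive le by move=> a b c; rewrite /le => h1 h2; exact: leq_trans h2 h1.
  have lt_tr : transitive lt by move=> a b c; rewrite /lt => h1 h2; exact: ltn_trans h2 h1.
  rewrite path_sortedE // IH ?(path_sorted ule) // andbT.
  apply/allP => v vs; rewrite /lt ltn_neqAle; apply/andP; split; last first.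
    by have /allP := order_path_min le_tr ule; apply.
  apply: contraNneq us => /word_rank_inj e.
  by rewrite -(val_inj (e _)) // !size_tuple.
have fs : free_mod (N k) [seq wval (tval u) | u <- s].
  elim: s sn slt {sle} => //= u s IH sn ult.
  have lt_tr : transitive lt by move=> a b c; rewrite /lt => h1 h2; exact: ltn_trans h2 h1.
  split; last first.
    by apply: IH (path_sorted ult) => v vs; apply: sn; rewrite inE vs orbT.
  have /asboolP := sn u (mem_head _ _); apply: contra_not.
  apply: leD => //; apply: fspan_le => _ /mapP[v vs ->].
  apply: (@mem_words_span k [pred v : k.-tuple 'I_q.+1 | (word_rank v < word_rank u)%N]) => /=.
  by have /allP := order_path_min lt_tr ult; apply.
have := @dim_ge_dim_le F B (N k) (letters ^+ k) (size s) m; apply=> //.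
exists [seq wval (tval u) | u <- s]; rewrite size_map; split=> // _ /mapP[u us ->].
by have := mem_wval u; rewrite size_tuple.
Qed.

Lemma ctx_le (u v : seq _) l (y : B) : N l y -> N (size u + l + size v) (wval u * y * wval v).
Proof.
move=> Ny; have {Ny} : N (size u + l) (wval u * y).
  elim: u => [|i u IH]; rewrite /wval ?big_nil ?mul1r ?big_cons //= -mulrA addSn.
  by apply: NL; apply: memM => //; exact: mem_letters.
elim/last_ind: v => [|v i IH] Ny; rewrite /wval ?big_nil ?mulr1 ?addn0 //.
rewrite size_rcons addnS big_rcons /= mulrA.
by apply: NR; apply: memM; [exact: IH|exact: mem_letters].
Qed.

Definition all_normal w := forall i, (i + k <= size w)%N ->
  take k (drop i w) \in normal_words.

(** Replacing a factor that is not normal by smaller words of the same length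
lowers the rank of the whole word, so the process ends. *)
Lemma rewrite_word l w : size w = l ->
  (N l + words_span [pred v : l.-tuple 'I_q.+1 | `[< all_normal v >]])%R (wval w).
Proof.
have [n] := ubnP (word_rank w); elim: n w => // n IH w wn wl.
have [aw|/existsNP[i /not_implyP[ik]]] := pselect (all_normal w).
  apply: le_addr; have sw : size w == l by rewrite wl.
  by apply: (mem_words_span (w := Tuple sw)) => /=; exact/asboolP.
set u := take k (drop i w) => nu.
have su : size u == k by rewrite size_takel // size_drop; lia.
have {nu} : (N k + lower (Tuple su))%R (wval u).
  apply: contrapT => h; apply: nu; apply/fintype.imageP; exists (Tuple su) => //.
  by apply/asboolP.
set a := take i w; set b := drop k (drop i w).
have Ew : w = a ++ u ++ b by rewrite !cat_take_drop.
have sab : (size a + k + size b = l)%N.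
  by rewrite -wl Ew !size_cat (eqP su) addnA.
move=> [y Ny [z lz Eu]].
rewrite Ew !wval_cat -Eu mulrDl mulrDr !mulrA; apply: subD.
  by apply: le_addl; rewrite -sab; exact: ctx_le.
have lin_ctx : lin (fun z => wval a * z * wval b).
  by move=> c y' z'; rewrite mulrDr mulrDl -scalerAr -scalerAl.
suff /(_ z lz) : lower (Tuple su) `<=` lin_preim lin_ctx
  (N l + words_span [pred v : l.-tuple 'I_q.+1 | `[< all_normal v >]]) by [].
apply: words_span_le => v /= vu.
suff : (N l + words_span [pred v : l.-tuple 'I_q.+1 | `[< all_normal v >]])%R
  (wval (a ++ v ++ b)) by rewrite !wval_cat mulrA.
apply: IH; last by rewrite !size_cat size_tuple addnA.
move: wn; rewrite ltnS; apply: leq_trans.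
rewrite Ew !word_rank_cat !size_cat size_tuple (eqP su).
by rewrite ltn_add2l ltn_add2r ltn_mul2r vu andbT expn_gt0.
Qed.

Definition periodic_word l (w : seq 'I_q.+1) :=
  exists p, (0 < p <= k)%N /\ has_period (nth ord0 w) p k (l - k).+1.

Lemma periodic_span l : (0 < k)%N -> dim_le (N k) (letters ^+ k) k -> (k + k <= l)%N ->
  letters ^+ l `<=`
    N l + words_span [pred v : l.-tuple 'I_q.+1 | `[< periodic_word l v >]].
Proof.
move=> k0 hk kl; apply: letters_exp_le => w wl.
apply: leD (rewrite_word wl) => //; apply: words_span_le => v /= /asboolP nv.
apply: mem_words_span => /=; apply/asboolP.
have := @few_factors_period _ ord0 v normal_words k k0.
by rewrite size_tuple; apply=> //; [exact: size_normal_words | move=> i il; apply: nv;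
  rewrite size_tuple].
Qed.

(** A word with a period [p] on the middle range is recovered from [p], its first
[k + k] letters and its last [k] letters; this bounds their number
independently of the length. *)
Definition periodic_build l (u : seq 'I_q.+1) (p : nat) (v : seq 'I_q.+1) :=
  mkseq (fun j => if (j < k + k)%N then nth ord0 u j
    else if (j < l - k)%N then nth ord0 u (k + (j - k) %% p)
    else nth ord0 v (j - (l - k))) l.

Lemma periodic_bound : (0 < k)%N -> dim_le (N k) (letters ^+ k) k ->
  exists c, forall l, (k + k <= l)%N -> dim_le (N l) (letters ^+ l) c.
Proof.
move=> k0 hk.
pose I := ((k + k).-tuple 'I_q.+1 * 'I_k.+1 * k.-tuple 'I_q.+1)%type.
exists #|{: I}| => l kl.
pose G (i : I) := wval (periodic_build l i.1.1 i.1.2 i.2).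
suff h : letters ^+ l `<=` N l + fspan [seq G i | i : I].
  by have [s [ss sL Ls]] := dim_le_fspan h; exists s; split=> //; rewrite size_image in ss.
move=> y /(periodic_span k0 hk kl); apply: leD => //.
apply: words_span_le => w /= /asboolP[p [/andP[p0 pk] hp]].
have su : size (take (k + k) w) == (k + k)%N by rewrite size_takel ?size_tuple.
have sv : size (drop (l - k) w) == k by rewrite size_drop size_tuple; apply/eqP; lia.
have pk' : (p < k.+1)%N by [].
apply: mem_fspan; apply/fintype.imageP; exists (Tuple su, Ordinal pk', Tuple sv) => //.
congr wval; apply: (@eq_from_nth _ ord0); rewrite ?size_mkseq size_tuple // => j jl.
rewrite nth_mkseq //=; case: ltnP => kj; first by rewrite nth_take.
case: ltnP => lj; last by rewrite nth_drop; congr nth; lia.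
have pm := ltn_pmod (j - k) p0.
rewrite nth_take; last lia.
apply: has_period_mod hp _ _ _; [lia|lia|].
by rewrite modnDmr subnKC //; lia.
Qed.

(** Kept explicit because the growth argument needs to know that long normal words
contain high powers of one short word. *)
Lemma periodic_power l (w : seq 'I_q.+1) : (0 < k)%N -> size w = l -> periodic_word l w ->
  forall e, (k * e + k + k <= l)%N ->
  exists a b t, [/\ (0 < size t <= k)%N, (size a + size t * e + size b = l)%N &
    wval w = wval a * wval t ^+ e * wval b].
Proof.
move=> k0 wl [p [/andP[p0 pk] hp]] e el.
have pe : (p * e <= k * e)%N by rewrite leq_mul2r pk orbT.
exists (take k w), (drop (k + p * e) w), (take p (drop k w)).
have st : size (take p (drop k w)) = p by rewrite size_takel // size_drop; lia.
split; first by rewrite st p0.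
  by rewrite st size_takel ?size_drop ?wl; lia.
have wX : wval (take p (drop k w)) ^+ e = wval (take (p * e) (drop k w)).
  elim: e el pe => [|e IH] el pe; first by rewrite muln0 take0 /wval big_nil.
  rewrite !mulnS in el pe; rewrite exprSr IH; [|lia|by rewrite leq_mul2r pk orbT].
  rewrite -wval_cat; congr wval.
  have s1 : size (take (p * e) (drop k w)) = (p * e)%N.
    by rewrite size_takel // size_drop; lia.
  have s2 : size (take (p * e.+1) (drop k w)) = (p * e.+1)%N.
    by rewrite size_takel // size_drop; lia.
  apply: (@eq_from_nth _ ord0); first by rewrite size_cat st s1 s2; lia.
  rewrite size_cat st s1 => j jb.
  rewrite nth_cat s1 [RHS]nth_take; last lia.
  case: ltnP => jp; first by rewrite nth_take.
  rewrite nth_take; last by lia.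
  rewrite !nth_drop; apply: has_period_mod hp _ _ _; [lia|lia|].
  have {2}-> : j = (e * p + (j - p * e))%N by rewrite mulnC subnKC.
  by rewrite addnCA modnMDl.
rewrite wX -!wval_cat; congr wval.
by rewrite -catA addnC -drop_drop cat_take_drop cat_take_drop.
Qed.

End Rewriting.
End Words.

(** * Ideals of finite codimension in prime algebras *)
Section Frames.
Context {F : fieldType} {B : algType F}.
Implicit Types (X Y M N P U V W : @subsp F B) (x y z b r : B).

Definition frame V := [/\ V 1, findim_mod 0 V & forall x, exists n, (V ^+ n)%R x].

Lemma le_top X : X `<=` (top : @subsp F B). Proof. by []. Qed.

Lemma top_mul X : top * (top * X) `<=` top * X.
Proof. by rewrite mulrA; exact: leM. Qed.

Lemma mul_top X : X * top * top `<=` X * top.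
Proof. by rewrite -mulrA; exact: leM. Qed.

Lemma frame_mulr V Y x : frame V -> (Y * top)%R x ->
  exists n, (Y * V ^+ n)%R x.
Proof.
move=> [V1 fV gV] [s sP ->]; elim: s sP => [|p s IH] sP.
  by exists 0%N; rewrite big_nil; exact: sub0.
have [|n hn] := IH; first by move=> q qs; apply: sP; rewrite inE qs orbT.
have [Yp _] := sP p (mem_head _ _); have [m hm] := gV p.2.
exists (m + n)%N; rewrite big_cons; apply: subD.
  by apply: memM => //; apply: (le_exp V1 (leq_addr n m)).
by apply: leM hn => //; apply: le_exp => //; exact: leq_addl.
Qed.

Lemma frame_fspan V Y s : frame V -> (forall x, x \in s -> (Y * top)%R x) ->
  exists n, fspan s `<=` Y * V ^+ n.
Proof.
move=> fr; elim: s => [|x s IH] h.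
  by exists 0%N; rewrite fspan_nil; exact: le0S.
have [|n hn] := IH; first by move=> y ys; apply: h; rewrite inE ys orbT.
have [m hm] := frame_mulr fr (h x (mem_head _ _)).
have [V1 _ _] := fr.
exists (m + n)%N; rewrite fspan_cons; apply: addS_le.
  by apply: line_le; apply: leM hm => //; apply: le_exp => //; exact: leq_addr.
by move=> y /hn; apply: leM => //; apply: le_exp => //; exact: leq_addl.
Qed.

Lemma frame_mul_top V X Y : frame V -> findim_mod 0 X -> X `<=` Y * top ->
  exists n, X `<=` Y * V ^+ n.
Proof.
move=> fr /dim_le0_fspan[s ->] h; apply: frame_fspan => // x xs; apply: h; exact: mem_fspan.
Qed.

Lemma frame_fd V X : frame V -> findim_mod 0 X -> exists n, X `<=` V ^+ n.
Proof.
move=> fr fX; have [|n hn] := frame_mul_top (Y := 1) fr fX.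
  by rewrite mul1r; exact: le_top.
by exists n; rewrite mul1r in hn.
Qed.

Lemma frame_exp V n : frame V -> (0 < n)%N -> frame (V ^+ n).
Proof.
move=> [V1 fV gV] n0; split; [exact: mem1X|exact: fdX|move=> x].
have [m hm] := gV x; exists m; rewrite -exprM.
by apply: le_exp hm => //; rewrite leq_pmull.
Qed.

Fact residr_closed X Y : [set b | forall x, X x -> Y (x * b)] 0 /\
  forall c b b', [set b | forall x, X x -> Y (x * b)] b ->
  [set b | forall x, X x -> Y (x * b)] b' ->
  [set b | forall x, X x -> Y (x * b)] (c *: b + b').
Proof.
split=> [x _|c b b' hb hb' x Xx]; first by rewrite mulr0; exact: sub0.
by rewrite mulrDr -scalerAr; apply: subL; [exact: hb|exact: hb'].
Qed.
(** The elements that right multiplication uses to carry [X] into [Y]; for right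
ideals [Y] inside [X] it is the annihilator of the module [X / Y]. *)
Definition residr X Y := Subsp (residr_closed X Y).

Fact residl_closed X Y : [set b | forall x, X x -> Y (b * x)] 0 /\
  forall c b b', [set b | forall x, X x -> Y (b * x)] b ->
  [set b | forall x, X x -> Y (b * x)] b' ->
  [set b | forall x, X x -> Y (b * x)] (c *: b + b').
Proof.
split=> [x _|c b b' hb hb' x Xx]; first by rewrite mul0r; exact: sub0.
by rewrite mulrDl -scalerAl; apply: subL; [exact: hb|exact: hb'].
Qed.
Definition residl X Y := Subsp (residl_closed X Y).

Definition ideal P := top * P `<=` P /\ P * top `<=` P.

(** Each map costs at most the dimension of its target modulo [M]; it is applied to
the common preimage under the maps before it. *)
Lemma cofin_family (f : B -> B -> B) (us : seq B) X M s :
  (forall u, lin (f u)) ->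
  (forall u, u \in us -> forall x, X x -> (M + fspan s)%R (f u x)) ->
  exists N, exists t, [/\ forall x, N x -> X x /\ forall u, u \in us -> M (f u x),
    (size t <= size us * size s)%N & X `<=` N + fspan t].
Proof.
move=> lf; elim: us X => [|u us IH] X h.
  by exists X, [::]; split=> //; exact: le_addl.
have [t ts Xt] := lin_preim_cofin (lf u) (h u (mem_head _ _)).
have [|N [t' [NX ts' Xt']]] := IH (capS X (lin_preim (lf u) M)).
  by move=> v vs x [Xx _]; apply: h => //; rewrite inE vs orbT.
exists N, (t' ++ t); split.
- move=> x /NX[[Xx Mx] hx]; split=> // v; rewrite inE => /orP[/eqP -> //|]; exact: hx.
- by rewrite size_cat mulSn addnC leq_add.
- move=> x /Xt; rewrite fspan_cat addrA; exact: leD.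
Qed.

(** The annihilator of a finite-dimensional module has finite codimension: it is
cut out by the images of finitely many generators of the module. *)
Lemma residr_ideal M1 M2 : M1 * top `<=` M1 -> M2 * top `<=` M2 ->
  findim_mod M2 M1 -> ideal (residr M1 M2) /\ findim_mod (residr M1 M2) top.
Proof.
move=> R1 R2 [n [s [_ sM1 Ms]]]; split.
  split; apply: mulS_le => b c.
    by move=> _ hc x Mx; rewrite mulrA; apply: hc; apply: R1; exact: memM.
  by move=> hb _ x Mx; rewrite mulrA; apply: R2; apply: memM => //; exact: hb.
have [|u us b _|N [t [hN _ topN]]] := @cofin_family *%R s top M2 s.
- by move=> u c x y; rewrite mulrDr scalerAr.
- by apply: Ms; apply: R1; apply: memM => //; exact: sM1.
exists (size t); apply: dim_le_fspan => b /topN; apply: leD => // {}b /hN[_ hb] x /Ms.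
move=> [m Mm [y ys <-]]; rewrite mulrDl; apply: subD.
  by apply: R2; exact: memM.
have lb : lin (fun y => y * b) by move=> c z z'; rewrite mulrDl scalerAl.
by suff /(_ y ys) : fspan s `<=` lin_preim lb M2 by []; apply: fspan_le.
Qed.

Lemma residl_ideal M1 M2 : top * M1 `<=` M1 -> top * M2 `<=` M2 ->
  findim_mod M2 M1 -> ideal (residl M1 M2) /\ findim_mod (residl M1 M2) top.
Proof.
move=> R1 R2 [n [s [_ sM1 Ms]]]; split.
  split; apply: mulS_le => b c.
    by move=> _ hc x Mx; rewrite -mulrA; apply: R2; apply: memM => //; exact: hc.
  by move=> hb _ x Mx; rewrite -mulrA; apply: hb; apply: R1; exact: memM.
have [|u us b _|N [t [hN _ topN]]] := @cofin_family (fun x b => b * x) s top M2 s.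
- by move=> u c x y; rewrite mulrDl scalerAl.
- by apply: Ms; apply: R1; apply: memM => //; exact: sM1.
exists (size t); apply: dim_le_fspan => b /topN; apply: leD => // {}b /hN[_ hb] x /Ms.
move=> [m Mm [y ys <-]]; rewrite mulrDr; apply: subD.
  by apply: R2; exact: memM.
have lb : lin (fun y => b * y) by move=> c z z'; rewrite mulrDr scalerAr.
by suff /(_ y ys) : fspan s `<=` lin_preim lb M2 by []; apply: fspan_le.
Qed.

Lemma mul_killr X Y r : (forall u, Y u -> u * r = 0) ->
  forall x, (X * Y)%R x -> x * r = 0.
Proof.
move=> h _ [s sP ->]; rewrite mulr_suml big_seq big1 // => p /sP[_ Yp].
by rewrite -mulrA h // mulr0.
Qed.

Definition rann0 X := forall r, (forall u, X u -> u * r = 0) -> r = 0.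

Section Prime.
Hypothesis primeB : forall x y, (forall b, x * b * y = 0) -> x = 0 \/ y = 0.
Hypothesis infB : ~ findim_mod (0 : @subsp F B) top.

Lemma cofin_neq0 P : findim_mod P top -> exists2 p, P p & p != 0.
Proof. by move=> fP; apply: neq0_ex => P0; apply: infB; rewrite -P0. Qed.

Lemma prime_ideal_kill P y : ideal P -> findim_mod P top ->
  (forall p, P p -> p * y = 0) -> y = 0.
Proof.
move=> [_ PT] /cofin_neq0[p Pp p0] h.
have [e|//] : p = 0 \/ y = 0.
  by apply: primeB => b; apply: h; apply: PT; exact: memM.
by rewrite e eqxx in p0.
Qed.

Lemma prime_ideal_killr P y : ideal P -> findim_mod P top ->
  (forall p, P p -> y * p = 0) -> y = 0.
Proof.
move=> [TP _] /cofin_neq0[p Pp p0] h.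
have [//|e] : y = 0 \/ p = 0.
  by apply: primeB => b; rewrite -mulrA; apply: h; apply: TP; exact: memM.
by rewrite e eqxx in p0.
Qed.

Lemma frame_le_top V Y M : frame V -> findim_mod 0 Y ->
  (exists c, forall n, V ^+ n * Y `<=` M + V ^+ c * Y) -> findim_mod M (top * Y).
Proof.
move=> [V1 fV gV] fY [c h].
have /dim_le0_fspan[s Es] : findim_mod 0 (V ^+ c * Y) by apply: fdM => //; exact: fdX.
exists (size s); apply: dim_le_fspan; rewrite -Es; apply: mulS_le => b y _ Yy.
by have [n bn] := gV b; apply: (h n); exact: memM.
Qed.

(** The left ideals [L k], generated by [Y V^k], increase.  If every quotient
[L k.+1 / L k] is infinite-dimensional, each contributes [n] dimensions to
[V^n Y V^n].  If one of them is finite-dimensional, its annihilator [P] is a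
nonzero ideal, and [U = Y V^k] has zero right annihilator: from [U r = 0] one
gets [P U V r = 0], hence [U V r = 0] by primeness, so that the annihilator is
stable under [V] and [U B r = 0]. *)
Lemma rann_dichotomy V Y : frame V -> findim_mod 0 Y -> Y <> 0 ->
  (forall n, dim_ge 0 (V ^+ n * Y * V ^+ n) (n * n)) \/
  exists k, rann0 (Y * V ^+ k).
Proof.
move=> fr fY Y0; have [V1 fV gV] := fr.
pose L k := top * (Y * V ^+ k).
have [[k hk]|h] := pselect (exists k, findim_mod (L k) (L k.+1)); [right|left].
  exists k; set U := Y * V ^+ k.
  have [iP fP] : ideal (residl (L k.+1) (L k)) /\ findim_mod (residl (L k.+1) (L k)) top.
    by apply: residl_ideal hk; exact: top_mul.
  have annV r : (forall u, U u -> u * r = 0) ->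
      forall v, V v -> forall u, U u -> u * (v * r) = 0.
    move=> Ur v Vv u Uu; rewrite mulrA; apply: (prime_ideal_kill iP fP) => p Pp.
    rewrite mulrA; apply: (mul_killr Ur); apply: Pp; rewrite /L.
    by rewrite -[u * v]mul1r exprSr (mulrA Y); apply: memM => //; exact: memM.
  have annVn n r : (forall u, U u -> u * r = 0) ->
      forall v, (V ^+ n)%R v -> forall u, U u -> u * (v * r) = 0.
    move=> Ur; elim: n => [v [c _ <-] u Uu|n IH v].
      by rewrite -scalerAl mul1r -scalerAr Ur // scaler0.
    rewrite exprS => -[s sP ->] u Uu; rewrite mulr_suml mulr_sumr big_seq big1 //.
    move=> p /sP[Vp Vnp]; rewrite -mulrA; apply: annV => //; exact: IH.
  move=> r Ur; have [y Yy y0] := neq0_ex Y0.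
  have Uy : U y by rewrite -[y]mulr1; apply: memM => //; exact: mem1X.
  have [e|//] : y = 0 \/ r = 0.
    by apply: primeB => b; have [n bn] := gV b; rewrite -mulrA; exact: annVn bn _ Uy.
  by rewrite e eqxx in y0.
have gr k n : dim_ge (L k) (V ^+ n * (Y * V ^+ k.+1)) n.+1.
  have fYk : findim_mod 0 (Y * V ^+ k.+1) by apply: fdM => //; exact: fdX.
  have [|||||hc|//] := @growth F B (L k) (fun X => V * X)
    (fun n => V ^+ n * (Y * V ^+ k.+1)).
  - by move=> X X'; exact: leM.
  - by move=> X X'; rewrite mulrDr.
  - by move=> x; rewrite /L mulrA; apply: leM.
  - by move=> m /=; rewrite exprS -mulrA.
  - by move=> m; apply: leM => //; apply: le_exp.
  by case: h; exists k; exact: frame_le_top fr fYk hc.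
move=> n; suff H k : dim_ge 0 (V ^+ n * (Y * V ^+ k)) (k * n) by rewrite -mulrA.
elim: k => [|k IH]; first exact: dim_ge0.
rewrite mulSn addnC; apply: (dim_geD (M' := L k)) IH (dim_geS (gr k n)).
- exact: le0S.
- exact: leM.
- by do 2 apply: leM => //; apply: le_exp.
Qed.

End Prime.

(** Here the chain decreases; its terms between [W^n B] and [W^(2n) B] are all
reached by [W^n V^(2n)]. *)
Lemma right_chain_dichotomy V W : frame V -> findim_mod 0 W -> W `<=` V ->
  (forall n, dim_ge 0 (W ^+ n * V ^+ (n + n)) (n * n)) \/
  exists m, findim_mod (W ^+ m.+1 * top) (W ^+ m * top).
Proof.
move=> fr fW WV; have [V1 fV gV] := fr.
have [|h] := pselect (exists m, findim_mod (W ^+ m.+1 * top) (W ^+ m * top)); [by right|left].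
have gr m n : dim_ge (W ^+ m.+1 * top) (W ^+ m * V ^+ n) n.+1.
  have [|||||[c hc]|//] := @growth F B (W ^+ m.+1 * top) (fun X => X * V)
    (fun n => W ^+ m * V ^+ n).
  - by move=> X X' XX; exact: leM.
  - by move=> X X'; rewrite mulrDl.
  - by rewrite -mulrA; exact: leM.
  - by move=> k /=; rewrite exprSr mulrA.
  - by move=> k; apply: leM => //; apply: le_exp.
  case: h; exists m.
  have /dim_le0_fspan[s Es] : findim_mod 0 (W ^+ m * V ^+ c) by apply: fdM; exact: fdX.
  exists (size s); apply: dim_le_fspan; rewrite -Es; apply: mulS_le => x b Wx _.
  by have [k bk] := gV b; apply: (hc k); exact: memM.
move=> n.
suff H k : (k <= n)%N -> dim_ge 0 (W ^+ (n - k + n) * V ^+ (n + k)) (k * n).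
  by have := H n (leqnn n); rewrite subnn.
elim: k => [|k IH] kn; first exact: dim_ge0.
have E : (n - k + n = (n - k.+1 + n).+1)%N by lia.
have := IH (ltnW kn); rewrite E mulSn [(n + k * n)%N]addnC => {}IH.
apply: (dim_geD (M' := W ^+ (n - k.+1 + n).+1 * top)) IH _.
- exact: le0S.
- exact: leM.
- rewrite exprSr addnS exprS -mulrA; apply: leM => //; exact: leM.
- by apply: dim_ge_leq (gr _ _); lia.
Qed.

End Frames.

(** * The standard polynomial *)
Section FreeCoordinates.
Context {F : fieldType} {B : algType F} {I : eqType}.
Implicit Types (s : seq I) (e : I -> B) (c : I -> F).

Lemma fspan_coord s e y : uniq s -> fspan [seq e i | i <- s] y ->
  exists c, y = \sum_(i <- s) c i *: e i.
Proof.
elim: s y => [|i s IH] y /=.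
  by rewrite fspan_nil => _ ->; exists (fun=> 0); rewrite big_nil.
move=> /andP[si us]; rewrite fspan_cons => -[_ [a _ <-] [z /IH[//|c ->] <-]].
exists (fun j => if j == i then a else c j); rewrite big_cons eqxx; congr (_ + _).
apply: eq_big_seq => j js.
by case: eqP => // E; rewrite -E js in si.
Qed.

Lemma fspan_coords s e c : fspan [seq e i | i <- s] (\sum_(i <- s) c i *: e i).
Proof.
by rewrite big_seq; apply: sub_sum => i si; apply: subZ; apply: mem_fspan; exact: map_f.
Qed.

Lemma free_mod0P s e : uniq s ->
  free_mod 0 [seq e i | i <- s] <->
  forall c, \sum_(i <- s) c i *: e i = 0 -> forall i, i \in s -> c i = 0.
Proof.
elim: s => [|i s IH] /=; first by split.
move=> /andP[si us]; rewrite add0r; split.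
  move=> [ni /IH -/(_ us) fs] c; rewrite big_cons => E.
  have ci0 : c i = 0.
    apply: contra_notP ni => /eqP ci0.
    have -> : e i = - (c i)^-1 *: (\sum_(j <- s) c j *: e j).
      move/eqP: E; rewrite addrC addr_eq0 => /eqP ->.
      by rewrite scaleNr scalerN opprK scalerA mulVf // scale1r.
    by apply: subZ; exact: fspan_coords.
  move=> j; rewrite inE => /orP[/eqP -> //|]; apply: fs.
  by rewrite ci0 scale0r add0r in E.
move=> h; split.
  move=> /(fspan_coord us)[c Ec].
  have := h (fun j => if j == i then -1 else c j) _ i (mem_head _ _).
  rewrite eqxx => hE; suff /hE/eqP : \sum_(j <- i :: s)
      (if j == i then -1 else c j) *: e j = 0 by rewrite oppr_eq0 oner_eq0.
  rewrite big_cons eqxx scaleN1r Ec.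
  apply/eqP; rewrite addrC subr_eq0; apply/eqP.
  apply: eq_big_seq => j js.
  by case: eqP => // E; rewrite -E js in si.
apply/IH => // c E j js.
have := h (fun j => if j == i then 0 else c j) _ j.
rewrite inE js orbT; have -> : j == i = false.
  by apply/eqP => E'; rewrite -E' js in si.
apply=> //; rewrite big_cons eqxx scale0r add0r -[RHS]E.
apply: eq_big_seq => l ls.
by case: eqP => // E'; rewrite -E' ls in si.
Qed.

End FreeCoordinates.

Section StandardPolynomial.

Definition stdpoly (R : pzRingType) m (a : 'I_m -> R) : R :=
  \sum_(s : 'S_m) (-1) ^+ s * \prod_(i < m) a (s i).

Lemma stdpoly_alternate (R : pzRingType) m (a : 'I_m -> R) i1 i2 :
  i1 != i2 -> a i1 = a i2 -> stdpoly a = 0.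
Proof.
move=> ni E; pose t := tperm i1 i2.
have oddMt s : (s * t)%g = ~~ s :> bool by rewrite odd_permM odd_tperm ni addbT.
rewrite /stdpoly (bigID (@odd_perm _)) /=.
apply: canLR (subrK _) _; rewrite add0r -sumrN.
rewrite (reindex_inj (mulIg t)) /=; apply: eq_big => [s|s _]; first by rewrite oddMt.
rewrite oddMt signrN mulNr; congr (- (_ * _)).
apply: eq_bigr => i _; rewrite permM /t.
by case: tpermP => // ->.
Qed.

Lemma prod_slot_lin (F : fieldType) (B : algType F) (I : eqType) (r : seq I)
    (j : I) (G : I -> B) : count_mem j r = 1%N ->
  lin (fun y => \prod_(i <- r) (if i == j then y else G i)).
Proof.
elim: r => //= i r IH; have [->|ni] /= := eqVneq i j.
  move=> [] /eqP; rewrite -leqn0 leqNgt -has_count => /hasPn nj c y z.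
  have E w : \prod_(i <- r) (if i == j then w else G i) = \prod_(i <- r) G i.
    apply: eq_big_seq => l lr.
    by case: eqP => // lj; have := nj l lr; rewrite /= lj eqxx.
  by rewrite !big_cons !eqxx !E mulrDl scalerAl.
rewrite add0n => /IH h c y z; rewrite !big_cons (negbTE ni) h.
by rewrite mulrDr scalerAr.
Qed.

(** The standard polynomial is multilinear and alternating, so it vanishes on
linearly dependent arguments. *)
Lemma stdpoly_dep (F : fieldType) (B : algType F) m (a : 'I_m -> B) (t : seq B) :
  (size t < m)%N -> (forall i, fspan t (a i)) -> stdpoly a = 0.
Proof.
move=> tm ta.
have nfree : ~ free_mod 0 [seq a i | i <- enum 'I_m].
  move=> fa; have := steinitz (t := t) fa; rewrite size_map size_enum_ord leqNgt tm => h.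
  suff /h : forall y, y \in [seq a i | i <- enum 'I_m] -> (0 + fspan t)%R y by [].
  by move=> _ /mapP[i _ ->]; rewrite add0r; exact: ta.
have [c [E [j cj]]] : exists c : 'I_m -> F, \sum_i c i *: a i = 0 /\ exists j, c j != 0.
  apply: contra_notP nfree => h; apply/(free_mod0P _ (enum_uniq _)) => c E i _.
  apply: contrapT => /eqP ci; apply: h; exists c; split; last by exists i.
  by rewrite -[RHS]E big_enum.
pose f y := stdpoly (fun i => if i == j then y else a i).
have lf : lin f.
  move=> k y z; rewrite /f /stdpoly scaler_sumr -big_split /=.
  apply: eq_bigr => s _; rewrite scalerAr -mulrDr; congr (_ * _).
  have G w : \prod_(i < m) (if s i == j then w else a (s i)) =
      \prod_(i <- index_enum 'I_m) (if i == (s^-1)%g j then w else a (s i)).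
    by apply: eq_bigr => i _; rewrite (canF_eq (permK s)).
  rewrite !G; apply: prod_slot_lin.
  by rewrite count_uniq_mem ?index_enum_uniq // mem_index_enum.
have fsum : f (\sum_i c i *: a i) = \sum_i c i *: f (a i).
  elim/big_rec2: _ => [|i y z _ <-]; first exact: lin0 lf.
  exact: lf.
have : c j *: stdpoly a = 0.
  rewrite E lin0 // in fsum; rewrite fsum (bigD1 j) //= big1 ?addr0.
    congr (_ *: stdpoly _); apply/funext => i; by case: eqP => // ->.
  move=> i ij; rewrite /f (@stdpoly_alternate _ _ _ i j) ?scaler0 //.
  by rewrite eqxx (negbTE ij).
by move/eqP; rewrite scaler_eq0 (negbTE cj) => /eqP.
Qed.

Lemma stdpoly_matrix (L : fieldType) n m (a : 'I_m -> 'M[L]_n.+1) :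
  (n.+1 * n.+1 < m)%N -> stdpoly a = 0.
Proof.
move=> nm.
pose t := codom (fun p : 'I_n.+1 * 'I_n.+1 => delta_mx p.1 p.2 : 'M[L]_n.+1).
apply: (@stdpoly_dep L _ _ a t).
  by rewrite size_codom card_prod card_ord.
move=> i; rewrite [a i]matrix_sum_delta; do 2 apply: sub_sum => ? _.
apply: subZ; apply: mem_fspan; apply/codomP.
by eexists (_, _).
Qed.

End StandardPolynomial.

(** * Growth of the algebra itself *)
Section Transcendental.
Context {F : fieldType} {B : algType F}.
Implicit Types (X Y M N P U V W : @subsp F B) (x y z b r t : B).

Definition transc t := forall f : {poly F}, horner_alg t f = 0 -> f = 0.

Lemma Ntransc t : ~ transc t ->
  exists2 e, (0 < e)%N & fspan [seq t ^+ i | i <- iota 0 e] (t ^+ e).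
Proof.
move=> /existsNP[f /not_implyP[ft /eqP f0]].
have sf : size f = (size f).-1.+1 by rewrite prednK // lt0n size_poly_eq0.
have lc : lead_coef f != 0 by rewrite lead_coef_eq0.
have E : \sum_(i < size f) f`_i *: t ^+ i = 0.
  rewrite -[RHS]ft -[in RHS](coefK f) poly_def raddf_sum /=.
  by apply: eq_bigr => i _; rewrite linearZ /= rmorphXn /= horner_algX mulr_algl.
exists (size f).-1.
  rewrite lt0n; apply/eqP => s0; move: E; rewrite sf s0 big_ord1 expr0 => /eqP.
  have -> : f`_(@ord0 0) = lead_coef f by rewrite lead_coefE s0.
  by rewrite scaler_eq0 oner_eq0 orbF (negbTE lc).
rewrite sf big_ord_recr /= -lead_coefE in E.
have -> : t ^+ (size f).-1 =
    - (lead_coef f)^-1 *: (\sum_(i < (size f).-1) f`_i *: t ^+ i).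
  move/eqP: E; rewrite addr_eq0 => /eqP ->.
  by rewrite scaleNr scalerN opprK scalerA mulVf // scale1r.
apply: subZ; apply: sub_sum => i _; apply: subZ; apply: mem_fspan.
by apply: map_f; rewrite mem_iota /= add0n.
Qed.

(** The letter added at the end has value zero; it makes the alphabet nonempty,
which provides a default letter. *)
Lemma fd_letters X : findim_mod 0 X -> exists q (x : 'I_q.+1 -> B), X = letters x.
Proof.
move=> /dim_le0_fspan[s ->]; exists (size s), (fun i => nth 0 s i).
apply: subsp_eqP; apply: fspan_le.
  move=> x xs; apply: mem_fspan; apply/fintype.imageP.
  have ix : (index x s < (size s).+1)%N by rewrite ltnS index_size.
  by exists (Ordinal ix) => //=; rewrite nth_index.
move=> _ /fintype.imageP[i _ ->]; have [lt|ge] := ltnP i (size s).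
  by apply: mem_fspan; exact: mem_nth.
by rewrite nth_default //; exact: sub0.
Qed.

Lemma frame_quadratic V : frame V ->
  (forall n, exists2 m, (n * n <= 2 * m)%N & dim_ge 0 (V ^+ n) m) \/
  exists k, dim_le (V ^+ k) (V ^+ k.+1) k.+1.
Proof.
move=> [V1 fV gV].
have [|h] := pselect (exists k, dim_le (V ^+ k) (V ^+ k.+1) k.+1); [by right|left].
elim=> [|n [m nm dm]]; first by exists 0%N; [|exact: dim_ge0].
exists (m + n.+2)%N; first by rewrite mulSn mulnS; lia.
apply: (dim_geD (M' := V ^+ n)) dm _ => //; first exact: le0S.
  by apply: le_exp.
by apply: contrapT => /dim_geNdim_le hn; apply: h; exists n.
Qed.

(** Words of length [l] are rewritten modulo shorter words; the value at [l = 0]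
keeps the family absorbing. *)
Definition shifted V l := if l is l'.+1 then V ^+ l' else 0.

Lemma shiftedL V l : V * shifted V l `<=` shifted V l.+1.
Proof. by case: l => [|l] /=; [rewrite mulr0; exact: le0S|rewrite exprS]. Qed.

Lemma shiftedR V l : shifted V l * V `<=` shifted V l.+1.
Proof. by case: l => [|l] /=; [rewrite mul0r; exact: le0S|rewrite exprSr]. Qed.

Lemma linear_growth V k : frame V -> dim_le (V ^+ k) (V ^+ k.+1) k.+1 ->
  exists c d, forall n, dim_le 0 (V ^+ n) (c * n + d).
Proof.
move=> [V1 fV gV] hk; have [q [x Ex]] := fd_letters fV.
have [||||c hc] := @periodic_bound F B q x (shifted V) k.+1.
- by move=> l; rewrite -Ex; exact: shiftedL.
- by move=> l; rewrite -Ex; exact: shiftedR.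
- by [].
- by rewrite -Ex.
set l0 := (k.+1 + k.+1)%N in hc.
have [d dd] : findim_mod 0 (V ^+ l0) by exact: fdX.
exists c, d; elim=> [|n IH].
  have [s [sd sV Vs]] := dd; suff [s' [ss s'V Vs']] : dim_le 0 (V ^+ 0) (size s).
    by exists s'; split=> //; lia.
  by apply: dim_le_fspan => y /(le_exp V1 (leq0n l0)) /Vs.
have [nl|ln] := leqP n.+1 l0.
  have [s [sd sV Vs]] := dd; have [s' [ss s'V Vs']] : dim_le 0 (V ^+ n.+1) (size s).
    by apply: dim_le_fspan => y /(le_exp V1 nl) /Vs.
  by exists s'; split=> //; lia.
have [s [sd sV Vs]] := IH.
have [t [td tV Vt]] := hc n.+1 (ltnW ln); rewrite -Ex /= in tV Vt.
have [u [us uV Vu]] : dim_le 0 (V ^+ n.+1) (size (s ++ t)).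
  apply: dim_le_fspan; rewrite fspan_cat addrA; move=> y /Vt; exact: leD.
by exists u; split=> //; rewrite size_cat in us; lia.
Qed.

(** If every element were algebraic, a high power of a short word would reduce to
lower powers, hence to shorter words.  Long words all contain such powers, so
they would all reduce and the algebra would be finite-dimensional. *)
Lemma exists_transc V k : frame V -> ~ findim_mod (0 : @subsp F B) top ->
  dim_le (V ^+ k) (V ^+ k.+1) k.+1 -> exists t, transc t.
Proof.
move=> [V1 fV gV] infB hk; apply: contrapT => nt; apply: infB.
have [q [x Ex]] := fd_letters fV.
pose good e (w : seq 'I_q.+1) := (V ^+ (size w * e).-1)%R (wval x w ^+ e).
have goodS e e' w : (0 < e)%N -> (e <= e')%N -> (0 < size w)%N -> good e w -> good e' w.
  move=> e0 /subnK <- w0 ge; elim: (e' - e)%N => // m IH.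
  have E : ((size w * (m.+1 + e)).-1 = size w + (size w * (m + e)).-1)%N.
    by rewrite addSn mulnS -!subn1 addnBA // muln_gt0 w0 addn_gt0 e0 orbT.
  rewrite /good addSn in E *; rewrite E exprS exprD; apply: memM => //.
  by rewrite Ex; exact: mem_wval.
have ex_good w : (0 < size w)%N -> exists2 e, (0 < e)%N & good e w.
  move=> w0; have [e e0 he] : exists2 e, (0 < e)%N &
      fspan [seq wval x w ^+ i | i <- iota 0 e] (wval x w ^+ e).
    by apply: Ntransc => h; apply: nt; exists (wval x w).
  exists e => //; move: he; apply: fspan_le => _ /mapP[i ie ->].
  rewrite mem_iota /= add0n in ie.
  have : (size w * i <= (size w * e).-1)%N.
    have : (size w * i.+1 <= size w * e)%N by rewrite leq_mul2l ie orbT.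
    by rewrite mulnS; lia.
  move=> /(le_exp V1); apply; rewrite exprM.
  have : (V ^+ size w)%R (wval x w) by rewrite Ex; exact: mem_wval.
  move: (V ^+ size w) => X Xw; elim: (i) => [|j IH]; first exact: mem_line.
  by rewrite !exprS; exact: memM.
(* One exponent serves the finitely many words of length at most k.+1. *)
have [e [e0 he]] : exists e, (0 < e)%N /\
    forall w, (0 < size w <= k.+1)%N -> good e w.
  have [e [e0 he]] : exists e, (0 < e)%N /\ forall (i : 'I_k.+2) (w : i.-tuple 'I_q.+1),
      (0 < i)%N -> good e w.
    have /choice[ee hee] (p : {i : 'I_k.+2 & i.-tuple 'I_q.+1}) : exists e,
        (0 < e)%N /\ ((0 < tag p)%N -> good e (tagged p)).
      case: p => i w /=.
      have [i0|i0] := posnP i; first by exists 1%N; split=> //; rewrite lt0n i0.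
      by have [|e e0 he] := ex_good w; [rewrite size_tuple|exists e].
    exists (\max_p ee p).+1; split=> // i w i0.
    pose p : {i : 'I_k.+2 & i.-tuple 'I_q.+1} := Tagged _ w.
    apply: (@goodS (ee p)); [exact: (hee p).1| |by rewrite size_tuple|exact: (hee p).2].
    by apply: leqW; exact: (leq_bigmax p).
  exists e; split=> // w /andP[w0 wk].
  by have := he (Ordinal (wk : (size w < k.+2)%N)) (in_tuple w) w0.
pose l := (k.+1 * e + k.+1 + k.+1)%N.
have VV : V ^+ l `<=` V ^+ l.-1.
  have Vp : V ^+ l `<=` shifted V l +
      words_span x [pred v : l.-tuple 'I_q.+1 | `[< periodic_word k.+1 l v >]].
    rewrite Ex; apply: periodic_span; rewrite -?Ex //.
    - exact: shiftedL.
    - exact: shiftedR.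
    - by rewrite /l; lia.
  have El : shifted V l = V ^+ l.-1 by rewrite /l !addnS.
  have h : words_span x [pred v : l.-tuple 'I_q.+1 | `[< periodic_word k.+1 l v >]]
      `<=` V ^+ l.-1.
    apply: words_span_le => w /= /asboolP pw.
    have [a [b [t [tk sl ->]]]] := periodic_power x (ltn0Sn k) (size_tuple w) pw (leqnn l).
    have t0 : (0 < size t * e)%N by rewrite muln_gt0 e0 andbT; case/andP: tk.
    have -> : l.-1 = (size a + (size t * e).-1 + size b)%N by rewrite -sl; lia.
    rewrite !exprD; apply: memM; last by rewrite Ex; exact: mem_wval.
    by apply: memM; [rewrite Ex; exact: mem_wval|exact: he].
  by move=> y /Vp; apply: addS_le; rewrite ?El.
have Vl m : V ^+ (m + l) `<=` V ^+ l.-1.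
  elim: m => // m IH; rewrite addSn exprSr.
  apply: (@subset_trans _ (V ^+ l.-1 * V)); first exact: leM.
  by rewrite -exprSr prednK // /l; lia.
have [s Es] := dim_le0_fspan (fdX l.-1 fV).
exists (size s); apply: dim_le_fspan; rewrite add0r -Es => y _.
have [n yn] := gV y; apply: (Vl n); apply: le_exp yn => //; exact: leq_addr.
Qed.

End Transcendental.

(** * Linear growth is impossible *)
Section Rank.
Context {F : fieldType} {B : algType F} (t : B) (transc_t : transc t).
Implicit Types (V : @subsp F B) (b : B) (bs : seq B) (f h : {poly F}).
Local Notation ev := (horner_alg t).
Local Notation L := {fraction {poly F}}.
Local Notation "x %:F" := (FracField.tofrac x).

Lemma evC f h : ev f * ev h = ev h * ev f.
Proof. by rewrite -!rmorphM mulrC. Qed.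

Definition tcomb bs (g : nat -> {poly F}) : B := \sum_(i < size bs) bs`_i * ev (g i).

Definition tfree bs := forall g : nat -> {poly F},
  tcomb bs g = 0 -> forall i, (i < size bs)%N -> g i = 0.

Lemma tcombD bs g g' : tcomb bs (fun i => g i + g' i) = tcomb bs g + tcomb bs g'.
Proof. by rewrite /tcomb -big_split; apply: eq_bigr => i _ /=; rewrite rmorphD mulrDr. Qed.

Lemma tcombN bs g : tcomb bs (fun i => - g i) = - tcomb bs g.
Proof. by rewrite /tcomb -sumrN; apply: eq_bigr => i _ /=; rewrite rmorphN mulrN. Qed.

Lemma tcombM bs g h : tcomb bs (fun i => g i * h) = tcomb bs g * ev h.
Proof. by rewrite /tcomb mulr_suml; apply: eq_bigr => i _ /=; rewrite rmorphM mulrA. Qed.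

Lemma tfree_inj bs g g' : tfree bs -> tcomb bs g = tcomb bs g' ->
  forall i, (i < size bs)%N -> g i = g' i.
Proof.
move=> fb E i ib; apply/eqP; rewrite -subr_eq0; apply/eqP.
apply: (fb (fun i => g i - g' i)) => //.
by rewrite (tcombD bs g (fun i => - g' i)) tcombN E subrr.
Qed.

(** The products of [m] powers of [t] with each element of a family independent
over [F[t]] are independent over [F]. *)
Lemma tfree_size V bs n p : frame V -> (forall b, b \in bs -> (V ^+ n)%R b) ->
  (V ^+ p)%R t -> tfree bs -> forall m, dim_ge 0 (V ^+ (n + p * m)) (size bs * m).
Proof.
move=> [V1 fV gV] hb ht fb m.
pose e (k : 'I_(size bs) * 'I_m) : B := bs`_k.1 * t ^+ k.2.
exists [seq e k | k <- enum {: 'I_(size bs) * 'I_m}]; split.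
- by rewrite size_map -cardT card_prod !card_ord.
- move=> _ /mapP[[i j] _ ->]; rewrite /e exprD; apply: memM.
    by apply: hb; exact: mem_nth.
  apply: (le_exp V1 (_ : p * j <= _)%N); first by rewrite leq_mul2l (ltnW (ltn_ord j)) orbT.
  rewrite exprM; elim: (nat_of_ord j) => [|k IH]; first exact: mem_line.
  by rewrite !exprS; exact: memM.
apply/(free_mod0P _ (enum_uniq _)) => c E [i j] _.
pose g (i : nat) : {poly F} := if insub i is Some i then \poly_(j < m)
  (if insub j is Some j then c (i, j) else 0) else 0.
have gi : g i = 0.
  apply: fb => //; rewrite -[RHS]E big_enum /=.
  transitivity (\sum_i \sum_j c (i, j) *: e (i, j)); last first.
    by rewrite pair_bigA; apply: eq_bigr => -[].
  apply: eq_bigr => {}i _; rewrite /g insubT //= => hi.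
  rewrite poly_def raddf_sum mulr_sumr /=; apply: eq_bigr => {}j _.
  rewrite insubT //= => hj; rewrite linearZ /= rmorphXn /= horner_algX mulr_algl.
  by rewrite /e /= -scalerAr; congr (c (_, _) *: _); exact: val_inj.
have := congr1 (fun f : {poly F} => f`_j) gi; rewrite coef0 /g insubT //= => hi.
rewrite coef_poly ltn_ord insubT //= => hj <-.
by congr c; congr (_, _); exact: val_inj.
Qed.

Lemma tfree_cons bs b : tfree bs -> ~ tfree (b :: bs) ->
  exists f, f != 0 /\ exists g, b * ev f = tcomb bs g.
Proof.
move=> fb /existsNP[g /not_implyP[E /existsNP[i /not_implyP[ib /eqP gi]]]].
rewrite /tcomb /= big_ord_recl /= in E.
exists (g 0%N); split; last first.
  exists (fun i => - g i.+1); rewrite (tcombN bs (fun i => g i.+1)).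
  by move/eqP: E; rewrite addr_eq0 => /eqP.
apply/eqP => g0; rewrite g0 rmorph0 mulr0 add0r in E.
case: i ib gi => [|i] /= ib; first by rewrite g0 eqxx.
by rewrite (fb (fun i => g i.+1) E) ?eqxx.
Qed.

Lemma tfree1 : tfree [:: 1].
Proof.
move=> g; rewrite /tcomb /= big_ord1 mul1r => /transc_t g0 i.
by rewrite ltnS leqn0 => /eqP ->.
Qed.

(** Linear growth bounds the size of families independent over [F[t]], since each
of their elements contributes a term linear in [m] to [tfree_size].  A maximal
family generates [B] up to torsion. *)
Lemma tbasis V c d : frame V -> (forall n, dim_le 0 (V ^+ n) (c * n + d)) ->
  exists bs, [/\ (0 < size bs)%N, tfree bs & forall b, exists f, f != 0 /\
    exists g, b * ev f = tcomb bs g].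
Proof.
move=> fr hV; have [V1 fV gV] := fr.
suff [bs [sb fb hb]] : exists bs, [/\ (0 < size bs)%N, tfree bs & forall b, ~ tfree (b :: bs)].
  by exists bs; split=> // b; exact: tfree_cons.
apply: contrapT => h.
have [p tp] := gV t.
(* Without a maximal family, independent families of every size exist. *)
have ext m : exists bs, size bs = m.+1 /\ tfree bs.
  elim: m => [|m [bs [sb fb]]]; first by exists [:: 1]; split=> //; exact: tfree1.
  apply: contrapT => hm; apply: h; exists bs; rewrite sb; split=> // b fbb.
  by apply: hm; exists (b :: bs); rewrite /= sb.
have [bs [sb fb]] := ext (c * p)%N.
have [n hn] := frame_fd fr (fd_fspan bs).
have bn b : b \in bs -> (V ^+ n)%R b by move=> /mem_fspan/hn.
have := dim_ge_dim_le (tfree_size fr bn tp fb (c * n + d).+1) (hV _).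
by rewrite sb mulSn mulnDr mulnA; lia.
Qed.

Section Coordinates.
Variables (n : nat) (bs : seq B).
Hypotheses (sb : size bs = n.+1) (fb : tfree bs).
Hypothesis hbs : forall b, exists f, f != 0 /\ exists g, b * ev f = tcomb bs g.

(** Coordinates in [F(t)^r]: with [b f(t) = sum b_i g_i(t)], those of [b] are the
fractions [g_i / f], which do not depend on the choice of the relation. *)
Lemma coord_ex : exists phi : B -> 'cV[L]_n.+1, forall b f g, f != 0 ->
  b * ev f = tcomb bs g -> phi b = \col_i ((g i)%:F / f%:F).
Proof.
have /choice[phi hphi] b : exists v : 'cV[L]_n.+1, forall f g, f != 0 ->
    b * ev f = tcomb bs g -> v = \col_i ((g i)%:F / f%:F).
  have [f [f0 [g Eg]]] := hbs b.
  exists (\col_i ((g i)%:F / f%:F)) => f' g' f'0 Eg'; apply/colP => i; rewrite !mxE.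
  have : tcomb bs (fun i => g i * f') = tcomb bs (fun i => g' i * f).
    by rewrite !tcombM -Eg -Eg' -!mulrA evC.
  move=> /(tfree_inj fb)/(_ i); rewrite sb => /(_ (ltn_ord i)) E.
  apply/eqP; rewrite eqr_div ?tofrac_eq0 // -!tofracM E //.
by exists phi.
Qed.

(** Left multiplication commutes with the right action of [F[t]], so it acts by
matrices on the coordinates; only torsion elements have zero coordinates. *)
Lemma coord_rep : exists (phi : B -> 'cV[L]_n.+1) (rho : B -> 'M[L]_n.+1),
  [/\ forall b b', phi (b + b') = phi b + phi b',
      forall a b, phi (a * b) = rho a *m phi b &
      forall b, phi b = 0 -> exists2 f, f != 0 & b * ev f = 0].
Proof.
have [phi hphi] := coord_ex.
have phiD b b' : phi (b + b') = phi b + phi b'.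
  have [f [f0 [g Eg]]] := hbs b; have [f' [f'0 [g' Eg']]] := hbs b'.
  rewrite (hphi _ _ _ f0 Eg) (hphi _ _ _ f'0 Eg').
  rewrite (hphi _ (f * f') (fun i => g i * f' + g' i * f)) ?mulf_neq0 //.
    apply/colP => i; rewrite !mxE addf_div ?tofrac_eq0 //.
    by rewrite tofracM tofracD !tofracM.
  rewrite tcombD !tcombM -Eg -Eg' rmorphM mulrDl mulrA; congr (_ + _).
  by rewrite evC mulrA.
have phiM b h : phi (b * ev h) = h%:F *: phi b.
  have [f [f0 [g Eg]]] := hbs b.
  rewrite (hphi _ _ _ f0 Eg) (hphi _ f (fun i => g i * h)) //.
    by apply/colP => i; rewrite !mxE tofracM mulrA [_ * h%:F]mulrC.
  by rewrite tcombM -Eg -!mulrA evC.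
have phi0 : phi 0 = 0 by apply: (addrI (phi 0)); rewrite -phiD !addr0.
pose rho a : 'M[L]_n.+1 := \matrix_(i, j) phi (a * bs`_j) i 0.
exists phi, rho; split=> // [a b|b].
- have [f [f0 [g Eg]]] := hbs b.
  have fF : f%:F != 0 :> L by rewrite tofrac_eq0.
  apply: (scalerI fF); rewrite -phiM -mulrA Eg scalemxAr -phiM Eg.
  rewrite /tcomb sb mulr_sumr.
  have phis (G : 'I_n.+1 -> B) : phi (\sum_i G i) = \sum_i phi (G i).
    by elim/big_rec2: _ => // i y1 y2 _ <-.
  rewrite !phis mulmx_sumr; apply: eq_bigr => j _.
  rewrite mulrA !phiM -scalemxAr; congr (_ *: _).
  rewrite (hphi bs`_j 1 (fun i => (i == j)%:R)) ?oner_neq0 //.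
    apply/colP => i; rewrite !mxE (bigD1 j) //= big1 ?addr0 => [|k kj].
      by rewrite !mxE eqxx tofrac1 divr1 mulr1.
    have kj' : (k == j :> nat) = false by apply/negbTE.
    by rewrite !mxE kj' tofrac0 mul0r mulr0.
  rewrite rmorph1 mulr1 /tcomb sb (bigD1 j) //= eqxx rmorph1 mulr1 big1 ?addr0 //.
  move=> k kj; have -> : (k == j :> nat) = false by apply/negbTE.
  by rewrite rmorph0 mulr0.
- have [f [f0 [g Eg]]] := hbs b; rewrite (hphi _ _ _ f0 Eg) => /colP E.
  exists f => //; rewrite Eg /tcomb big1 // => i _.
  have ib : (i < n.+1)%N by rewrite -sb.
  have /eqP := E (Ordinal ib); rewrite !mxE /= mulf_eq0 invr_eq0 !tofrac_eq0.
  by rewrite (negbTE f0) orbF => /eqP ->; rewrite rmorph0 mulr0.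
Qed.

Lemma stdpoly_torsion m (a : 'I_m -> B) b : (n.+1 * n.+1 < m)%N ->
  exists2 f, f != 0 & stdpoly a * b * ev f = 0.
Proof.
move=> nm; have [phi [rho [phiD phiM phi0]]] := coord_rep.
apply: phi0; have <- : stdpoly (fun i => rho (a i)) *m phi b = 0.
  by rewrite stdpoly_matrix // mul0mx.
have phiz : phi 0 = 0 by apply: (addrI (phi 0)); rewrite -phiD !addr0.
have phiN x : phi (- x) = - phi x.
  by apply/eqP; rewrite -addr_eq0 -phiD addNr phiz.
rewrite /stdpoly mulr_suml mulmx_suml.
elim/big_rec2: _ => // s y1 y2 _ <-; rewrite phiD; congr (_ + _).
have E : phi (\prod_(i < m) a (s i) * b) = (\prod_(i < m) rho (a (s i))) *m phi b.
  elim: (index_enum _) => [|i r IH].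
    by rewrite !big_nil mul1r mul1mx.
  by rewrite !big_cons -mulrA phiM IH mulmxA.
by case: (odd_perm s); rewrite ?expr1 ?expr0 ?mulN1r ?mul1r ?mulNr ?phiN E ?mulNmx.
Qed.

End Coordinates.
End Rank.

Section LinearGrowth.
Context {F : fieldType} {B : algType F}.
Implicit Types V : @subsp F B.
Hypothesis primeB : forall x y : B, (forall b, x * b * y = 0) -> x = 0 \/ y = 0.
Hypothesis notSI : forall m, exists a : 'I_m -> B, stdpoly a != 0.

Lemma notSI_infinite : ~ findim_mod (0 : @subsp F B) top.
Proof.
move=> /dim_le0_fspan[s Es]; have [a] := notSI (size s).+1.
by rewrite (@stdpoly_dep _ _ _ a s) ?eqxx // => i; rewrite -Es.
Qed.

(** The value [y] of a standard polynomial of large degree makes [y B] a torsion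
[F[t]]-module.  By [rann_dichotomy] applied to the line of [y], either
[V^n y V^n] has quadratic growth or finitely many torsion elements have zero
common right annihilator; but a common nonzero [f] satisfies [f(t) <> 0] and
kills them. *)
Lemma no_linear_growth V k : frame V -> ~ dim_le (V ^+ k) (V ^+ k.+1) k.+1.
Proof.
move=> fr hk; have [V1 fV gV] := fr.
have [t tt] := exists_transc fr notSI_infinite hk.
have [c [d hV]] := linear_growth fr hk.
have [bs [sb fb hb]] := tbasis tt fr hV.
have sb' : size bs = (size bs).-1.+1 by rewrite prednK.
have [a a0] := notSI (size bs * size bs).+1.
have tors b : exists2 f : {poly F}, f != 0 & stdpoly a * b * horner_alg t f = 0.
  by apply: (stdpoly_torsion sb' fb hb); rewrite -sb'.
set y := stdpoly a in a0 tors.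
have ly0 : line y <> 0.
  by move=> E; have := mem_line y; rewrite E => /eqP; rewrite (negbTE a0).
have [h|[n hn]] := rann_dichotomy primeB notSI_infinite fr (fd_line y) ly0.
  have [p yp] := gV y.
  pose n := (c * 2 + c * p + d).+1.
  have : dim_ge 0 (V ^+ (n + p + n)) (n * n).
    apply: dim_ge_mono (h n) => //; rewrite !exprD; apply: leM => //; apply: leM => //.
    exact: line_le.
  by move=> /dim_ge_dim_le/(_ (hV _)); rewrite /n; nia.
have [s Es] := dim_le0_fspan (fdM (fd_line y) (fdX n fV)).
have [f f0 hf] : exists2 f : {poly F}, f != 0 & forall u, u \in s -> u * horner_alg t f = 0.
  have sy u : u \in s -> exists2 f : {poly F}, f != 0 & u * horner_alg t f = 0.
    move=> us; have : (line y * V ^+ n)%R u by rewrite Es; exact: mem_fspan.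
    have yV : line y * V ^+ n `<=` [set x | exists b, x = y * b].
      move=> _ [r rP ->]; elim: r rP => [|q r IH] rP.
        by exists 0; rewrite big_nil mulr0.
      have [|b Eb] := IH; first by move=> q' q'r; apply: rP; rewrite inE q'r orbT.
      have [[k' _ Ek] _] := rP q (mem_head _ _); exists (k' *: q.2 + b).
      by rewrite big_cons Eb -Ek mulrDr -scalerAl scalerAr.
    by move=> /yV[b ->]; exact: tors.
  elim: (s) sy => [|u r IH] sy; first by exists 1; rewrite ?oner_neq0.
  have [|f f0 hf] := IH; first by move=> v vr; apply: sy; rewrite inE vr orbT.
  have [g g0 hg] := sy u (mem_head _ _).
  exists (g * f); first by rewrite mulf_neq0.
  move=> v; rewrite inE rmorphM => /orP[/eqP ->|/hf vf].
    by rewrite mulrA hg mul0r.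
  by rewrite evC mulrA vf mul0r.
have : horner_alg t f = 0.
  apply: hn => u; rewrite Es => us.
  have lf : lin (fun u => u * horner_alg t f) by move=> k' x z; rewrite mulrDl scalerAl.
  suff /(_ u us) : fspan s `<=` lin_preim lf 0 by [].
  by apply: fspan_le => v vs; exact: hf.
by move=> /tt ff; rewrite ff eqxx in f0.
Qed.

Lemma quadratic_growth V n : frame V -> exists2 m, (n * n <= 2 * m)%N & dim_ge 0 (V ^+ n) m.
Proof. by move=> fr; have [//|[k /no_linear_growth []]] := frame_quadratic fr. Qed.

End LinearGrowth.

(** * Quadratic growth of powers of a subspace *)
Section PowerSums.
Context {F : fieldType} {B : algType F}.
Implicit Types (N P Q U V W X Y : @subsp F B).

Definition pwsum Q i l : @subsp F B := \sum_(i <= j < l) Q ^+ j.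

Lemma pwsum_le Q i l N : (forall j, (i <= j < l)%N -> Q ^+ j `<=` N) ->
  pwsum Q i l `<=` N.
Proof. by move=> h; apply: sum_le => j; rewrite mem_index_iota => /h. Qed.

Lemma le_pwsum Q i l j : (i <= j < l)%N -> Q ^+ j `<=` pwsum Q i l.
Proof.
move=> h; apply: (@le_sum _ _ _ (index_iota i l) xpredT (fun j => Q ^+ j)) => //.
by rewrite mem_index_iota.
Qed.

Lemma le_pwsum1 Q l : (1 < l)%N -> Q `<=` pwsum Q 1 l.
Proof. by move=> l1; have := @le_pwsum Q 1 l 1 l1; rewrite expr1. Qed.

Lemma pwsumS Q i l i' l' : (i' <= i)%N -> (l <= l')%N -> pwsum Q i l `<=` pwsum Q i' l'.
Proof. by move=> ii ll; apply: pwsum_le => j /andP[? ?]; apply: le_pwsum; lia. Qed.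

Lemma fd_pwsum Q i l : findim_mod 0 Q -> findim_mod 0 (pwsum Q i l).
Proof. by move=> fQ; apply: fd_sum => j _; exact: fdX. Qed.

Lemma mul_pwsum Q i l N Y : (forall j, (i <= j < l)%N -> Y * Q ^+ j `<=` N) ->
  Y * pwsum Q i l `<=` N.
Proof.
by move=> h; rewrite /pwsum mulr_sumr; apply: sum_le => j; rewrite mem_index_iota => /h.
Qed.

Lemma pwsum_mul Q i l N Y : (forall j, (i <= j < l)%N -> Q ^+ j * Y `<=` N) ->
  pwsum Q i l * Y `<=` N.
Proof.
by move=> h; rewrite /pwsum mulr_suml; apply: sum_le => j; rewrite mem_index_iota => /h.
Qed.

Lemma exp_pwsum Q n i l : Q ^+ n * pwsum Q i l `<=` pwsum Q (n + i) (n + l).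
Proof. by apply: mul_pwsum => j h; rewrite -exprD; apply: le_pwsum; lia. Qed.

Lemma pwsum_frame Q V n i l : V 1 -> Q `<=` V ^+ n -> pwsum Q i l `<=` V ^+ (n * l).
Proof.
move=> V1 QV; apply: pwsum_le => j /andP[_ jl].
move=> x /(leXS QV); rewrite -exprM; apply: le_exp => //.
by rewrite leq_mul2l (ltnW jl) orbT.
Qed.

(** The map that sends [x] to the family of all [u x] is injective on [X]. *)
Lemma rann_dim (us : seq B) X m : rann0 (fspan us) -> findim_mod 0 X -> dim_ge 0 X m ->
  exists m', (m <= size us * m')%N /\ dim_ge 0 (fspan us * X) m'.
Proof.
move=> ann fX dX; have [m' [ge [s [sm sY Ys]]]] := fd_dim (fdM (fd_fspan us) fX).
exists m'; split=> //.
have [|u uus x Xx|N [t [hN st Xt]]] := @cofin_family F B *%R us X 0 s.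
- by move=> u c x y; rewrite mulrDr scalerAr.
- by apply: Ys; apply: memM => //; exact: mem_fspan.
have Xt0 : X `<=` 0 + fspan t.
  move=> x /Xt; apply: leD => // {}x /hN[_ hx] /=.
  apply: ann => u uus.
  have lf : lin (fun u => u * x) by move=> c y z; rewrite mulrDl scalerAl.
  by suff /(_ u uus) : fspan us `<=` lin_preim lf 0 by []; apply: fspan_le => v /hx.
apply: leq_trans (dim_ge_fspan dX Xt0) (leq_trans st _).
by rewrite leq_mul2l sm orbT.
Qed.

End PowerSums.

Section CofiniteIdeal.
Context {F : fieldType} {B : algType F}.
Implicit Types (N U W X Y : @subsp F B).
Hypothesis primeB : forall x y : B, (forall b, x * b * y = 0) -> x = 0 \/ y = 0.
Hypothesis notSI : forall m, exists a : 'I_m -> B, stdpoly a != 0.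
Context (V P : @subsp F B) (frV : frame V) (idP : ideal P) (topPV : top `<=` P + V).

(** Generators of [P] as an algebra without unit ([P_pwsum]).  The elements of [P]
found in [V V] are surrounded by factors [V] in order that products with [V] stay
within [Q + Q^2] ([V_idgen]). *)
Definition idgen : @subsp F B := V * capS (V * V) P * V.
Local Notation Q := idgen.

Let V1 : V 1. Proof. by case: frV. Qed.
Let fV : findim_mod 0 V. Proof. by case: frV. Qed.

Lemma capS_idgen : capS (V * V) P `<=` Q.
Proof. by move=> x Qx; apply: le_mulr => //; exact: le_mull. Qed.

Lemma idgen_P : Q `<=` P.
Proof.
case: idP => TP PT; apply: mulS_le => x v h Vv; apply: PT; apply: memM => //.
move: x h; apply: mulS_le => w x Vw [_ Px]; apply: TP; exact: memM.
Qed.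

Lemma fd_idgen : findim_mod 0 Q.
Proof.
apply: fdM => //; apply: fdM => //; apply: fd_sub (fdM fV fV).
by move=> x [].
Qed.

Lemma idgen_V4 : Q `<=` V ^+ 4.
Proof.
rewrite !exprS expr0 mulr1 /idgen -mulrA; apply: leM => //.
by rewrite mulrA; apply: leM => // x [].
Qed.

(** As [V] meets every class modulo [P], a product of two elements of [V] is
congruent to an element of [V], and the difference is one of the generators. *)
Lemma V2_idgen : V * V `<=` V + Q.
Proof.
move=> x VVx; have [p Pp [v Vv E]] := topPV (I : top x).
rewrite -E [p + v]addrC; apply: subD; first exact: le_addl.
apply: le_addr; apply: capS_idgen; split=> //.
have VVv : (V * V)%R v by exact: (le_mulr V1).
by apply: sub_cancelr VVv _; rewrite E.
Qed.

Lemma V_idgen : V * Q `<=` Q + Q * Q.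
Proof.
have VcQ : V * capS (V * V) P `<=` Q by exact: le_mulr.
apply: (@subset_trans _ (V * V * (capS (V * V) P * V))); first by rewrite /idgen !mulrA.
apply: (@subset_trans _ ((V + Q) * (capS (V * V) P * V))).
  by apply: leM => //; exact: V2_idgen.
rewrite mulrDl; apply: leD; first by rewrite /idgen mulrA.
by apply: leM => //; rewrite /idgen -mulrA; exact: le_mull.
Qed.

Lemma V_exp_idgen j : (0 < j)%N -> V * Q ^+ j `<=` Q ^+ j + Q ^+ j.+1.
Proof.
case: j => // j _; rewrite exprS mulrA.
apply: (@subset_trans _ ((Q + Q * Q) * Q ^+ j)).
  by apply: leM => //; exact: V_idgen.
by rewrite mulrDl -mulrA -!exprS.
Qed.

Lemma V_pwsum i l : (0 < i)%N -> V * pwsum Q i l `<=` pwsum Q i l.+1.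
Proof.
move=> i0; apply: mul_pwsum => j /andP[ij jl] x /V_exp_idgen h.
have /h : (0 < j)%N by lia.
by move: x {h}; apply: addS_le; apply: le_pwsum; lia.
Qed.

(** Moving [V] through a power of [Q] only lengthens it, by one for each factor
[V].  In particular the exponents grow additively, never multiplicatively. *)
Lemma Vn_pwsum n i l : (0 < i)%N -> V ^+ n * pwsum Q i l `<=` pwsum Q i (n + l).
Proof.
move=> i0; elim: n => [|n IH]; first by rewrite mul1r.
rewrite exprS -mulrA addSn.
apply: (@subset_trans _ (V * pwsum Q i (n + l))); first exact: leM.
exact: V_pwsum.
Qed.

Lemma Vn_le n : V ^+ n.+1 `<=` V + pwsum Q 1 n.+1.
Proof.
elim: n => [|n IH]; first by rewrite expr1; exact: le_addl.
rewrite exprS; apply: (@subset_trans _ (V * (V + pwsum Q 1 n.+1))); first exact: leM.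
rewrite mulrDr; apply: addS_le => x.
  move=> /V2_idgen; apply: leD => //.
  exact: le_pwsum1.
by move=> /V_pwsum h; apply: le_addr; exact: h.
Qed.

Lemma P_pwsum p : P p -> exists n, pwsum Q 1 n p.
Proof.
case: frV => _ _ gV Pp; have [n pn] := gV p.
have {pn} : (V ^+ n.+1)%R p by apply: le_exp pn.
move=> /Vn_le[v Vv [x Xx E]]; exists n.+2; rewrite -E; apply: subD; last first.
  by apply: pwsumS Xx.
have Px : P x.
  suff : pwsum Q 1 n.+1 `<=` P by apply.
  apply: pwsum_le => -[//|j] _; rewrite exprS => y Qy.
  by case: idP => _; apply; apply: leM Qy => //; exact: idgen_P.
suff : Q v by exact: le_pwsum1.
apply: capS_idgen; split; first exact: le_mulr.
by apply: (sub_cancelr (y := x)); rewrite ?E.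
Qed.

Lemma cofinP : findim_mod P top.
Proof. by have /dim_le0_fspan[s Es] := fV; exists (size s); apply: dim_le_fspan; rewrite -Es. Qed.

Lemma mul_idgen_neq0 U n : U <> 0 -> U * Q ^+ n <> 0.
Proof.
move=> U0; elim: n => [|n IH]; first by rewrite mulr1.
have [y Uy y0] := neq0_ex IH; rewrite exprSr mulrA => E.
suff : y = 0 by apply/eqP.
apply: (prime_ideal_killr primeB (notSI_infinite notSI) idP cofinP) => p /P_pwsum[m].
have yQ q : Q q -> y * q = 0.
  by move=> Qq; have : (U * Q ^+ n * Q)%R (y * q) by [exact: memM]; rewrite E.
have lf : lin (fun x => y * x) by move=> c x z; rewrite mulrDr scalerAr.
move: p; suff h : pwsum Q 1 m `<=` lin_preim lf 0 by move=> p /h.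
apply: pwsum_le => -[//|j] _; rewrite exprS.
apply: mulS_le => q x Qq _.
by suff : y * (q * x) = 0 by []; rewrite mulrA yQ // mul0r.
Qed.

(** One factor [Q] is given up for a factor [W]; the factors [V] that appear are
absorbed by the remaining power of [Q], which is why [i] must be positive. *)
Lemma idgen_shift U W c : U * Q `<=` W * U * V ^+ c ->
  forall i l, (0 < i)%N -> U * pwsum Q i.+1 l `<=` W * U * pwsum Q i (c + l).
Proof.
move=> h i l i0; apply: mul_pwsum => -[//|j] /andP[ij jl].
rewrite exprS mulrA.
apply: (@subset_trans _ (W * U * V ^+ c * Q ^+ j)); first exact: leM.
rewrite -mulrA; apply: leM => //.
apply: (@subset_trans _ (V ^+ c * pwsum Q i l)).
  by apply: leM => //; apply: le_pwsum; lia.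
exact: Vn_pwsum.
Qed.

Lemma idgen_shiftn U W c : U * Q `<=` W * U * V ^+ c ->
  forall n l, U * pwsum Q n.+1 l `<=` W ^+ n * U * pwsum Q 1 (n * c + l).
Proof.
move=> h; elim=> [|n IH] l; first by rewrite mul1r.
move=> x /(idgen_shift h (ltn0Sn n)); rewrite -mulrA.
rewrite exprS -!mulrA; apply: leM => //; move=> y /IH; rewrite mulrA.
by rewrite mulSn addnA [(n * c + c)%N]addnC.
Qed.

(** When [Q^k] has dimension at most [k] modulo the next powers, [Q^l] is for every
large [l] contained in [Q^(l+1) + ... + Q^(l+c)] up to a bounded number [c0]
of dimensions.  So [V^n] can be pushed up into [Q^n + ... + Q^(n+c)] at the
cost of [c0 n] dimensions. *)
Lemma idgen_growth : exists C, (0 < C)%N /\ forall n, (C <= n)%N ->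
  exists m, (n * n <= C * m)%N /\ dim_ge 0 (pwsum Q n (C * n)) m.
Proof.
have [[k [c [k0 hk]]]|h] := pselect (exists k c, (0 < k)%N /\
    dim_le (pwsum Q k.+1 (k.+1 + c)) (Q ^+ k) k); last first.
  exists 2%N; split=> // n n2; exists (n * n)%N; split; first by rewrite leq_pmull.
  suff H j : (j <= n)%N -> dim_ge 0 (pwsum Q (n - j + n) (2 * n)) (j * n).
    by have := H n (leqnn n); rewrite subnn add0n.
  elim: j => [|j IH] jn; first exact: dim_ge0.
  have E : (n - j + n = (n - j.+1 + n).+1)%N by lia.
  have := IH (ltnW jn); rewrite [(j.+1 * n)%N]mulSn [(n + j * n)%N]addnC => {}IH.
  apply: (dim_geD (M' := pwsum Q (n - j + n) (2 * n))) IH _ => //.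
  - exact: le0S.
  - by apply: pwsumS => //; lia.
  apply: (dim_ge_mono (M := pwsum Q (n - j + n) (2 * n)) (X := Q ^+ (n - j.+1 + n))) => //.
    by apply: le_pwsum; lia.
  rewrite E; apply: (@dim_ge_leq _ _ _ _ _ (n - j.+1 + n).+1); first lia.
  apply: contrapT => /dim_geNdim_le hn; apply: h.
  exists (n - j.+1 + n)%N, (2 * n - (n - j.+1 + n).+1)%N; split; first lia.
  by rewrite subnKC //; lia.
have [q [x Ex]] := fd_letters fd_idgen.
pose NN l := pwsum Q l.+1 (l.+1 + c).
have [c0 hc0] : exists c0, forall l, (k + k <= l)%N -> dim_le (NN l) (letters x ^+ l) c0.
  apply: periodic_bound => //; rewrite -?Ex //.
  - by move=> l; apply: mul_pwsum => j jb; rewrite -exprS; apply: le_pwsum; lia.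
  - by move=> l; apply: pwsum_mul => j jb; rewrite -exprSr; apply: le_pwsum; lia.
set l0 := (k + k)%N in hc0.
(* The lowest power is traded for the next ones, one length at a time. *)
have red n : exists s, (size s <= c0 * n)%N /\
    pwsum Q l0 (n + l0 + c) `<=` pwsum Q (n + l0) (n + l0 + c) + fspan s.
  elim: n => [|n [s [ss hs]]].
    by exists [::]; split=> //; exact: le_addl.
  have [|t [st _ ht]] := hc0 (n + l0)%N; first exact: leq_addl.
  exists (t ++ s); split; first by rewrite size_cat mulnS leq_add.
  have l1 : pwsum Q (n + l0) (n + l0 + c).+1 `<=` NN (n + l0)%N + fspan t.
    apply: pwsum_le => j jb; have [->|jn] := eqVneq j (n + l0)%N.
      by rewrite {1}Ex.
    by move=> y Qy; apply: le_addl; apply: le_pwsum Qy; lia.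
  apply: (@subset_trans _ (pwsum Q (n + l0) (n + l0 + c).+1 + fspan s)); last first.
    rewrite fspan_cat addrA; apply: leD => //.
  apply: pwsum_le => j jb; have [jn|jn] := ltnP j (n + l0 + c).
    move=> y Qy; have /hs : pwsum Q l0 (n + l0 + c) y by apply: le_pwsum Qy; lia.
    by apply: leD => //; apply: pwsumS; lia.
  by move=> y Qy; apply: le_addl; apply: le_pwsum Qy; lia.
have /dim_le0_fspan[s0 Es0] : findim_mod 0 (V + pwsum Q 1 l0).
  by apply: fdD => //; apply: fd_pwsum; exact: fd_idgen.
(* The constant makes c0 n + d at most n ^ 2 / 4. *)
pose d := size s0; exists (4 + 4 * c0 + 4 * d + l0 + c)%N; split=> // n nC.
have n0 : n = n.-1.+1 by rewrite prednK //; lia.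
have [m nm dm] := quadratic_growth primeB notSI n frV.
have [m' [ge' [s' [ss' _ hs']]]] := fd_dim (fd_pwsum n (n + c) fd_idgen).
have [s [ss hs]] := red (n - l0)%N.
have mle : (m <= d + c0 * n + m')%N.
  have Vs : V ^+ n `<=` 0 + fspan (s0 ++ s ++ s').
    rewrite add0r !fspan_cat -Es0.
    rewrite n0; move=> y /Vn_le; rewrite -n0.
    move: y; apply: addS_le => y; first by move=> Vy; apply: le_addl; exact: le_addl.
    suff : pwsum Q 1 n `<=` V + pwsum Q 1 l0 + (fspan s + fspan s') by apply.
    apply: pwsum_le => j jb {}y Qy; have [jl|lj] := ltnP j l0.
      by apply: le_addl; apply: le_addr; apply: le_pwsum Qy; lia.
    have : pwsum Q l0 (n - l0 + l0 + c) y by apply: le_pwsum Qy; lia.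
    move=> /hs; rewrite subnK; last lia.
    rewrite addrC => h; apply: le_addr; move: h; apply: leD => //.
    by move=> z /hs'; rewrite add0r.
  have := dim_ge_fspan dm Vs; rewrite !size_cat -/d.
  have : (c0 * (n - l0) <= c0 * n)%N by rewrite leq_mul2l leq_subr orbT.
  by lia.
exists m'; split; last first.
  apply: dim_ge_mono ge' => //; apply: pwsumS => //.
  by apply: (@leq_trans (4 * n + c * n)); [nia|rewrite -mulnDl leq_mul2r; lia].
have h4 : (n * n <= 4 * m')%N by nia.
by apply: leq_trans h4 _; rewrite leq_mul2r; lia.
Qed.

Lemma cofinite_power_growth W k c : W `<=` V -> W ^+ k <> 0 ->
  W ^+ k * Q `<=` W * W ^+ k * V ^+ c ->
  exists C, forall n, (C <= n)%N -> exists m, (n * n <= C * m)%N /\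
    dim_ge 0 (V ^+ (C * n) * W ^+ n * V ^+ (C * n)) m.
Proof.
move=> WV U0; set U := W ^+ k in U0 *; move=> UQ.
have UV : U `<=` V ^+ k by exact: leXS.
have fQ := fd_idgen.
have fU : findim_mod 0 U by apply: fdX; exact: fd_sub WV fV.
have bound n l : U * pwsum Q n.+1 l `<=` W ^+ n * V ^+ (k + 4 * (n * c + l)).
  move=> x /(idgen_shiftn UQ); rewrite -mulrA exprD; apply: leM => //; apply: leM => //.
  exact: pwsum_frame idgen_V4.
have [[p [j ann]]|h] := pselect (exists p j, rann0 (U * Q ^+ p * V ^+ j)); last first.
  (* The exponents of V add up to k + 4 (n c + n + 2) + n, as Q lies in V^4. *)
  exists (k + 4 * c + 9)%N => n nC; exists (n * n)%N; split; first by rewrite leq_pmull; lia.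
  have fUQ : findim_mod 0 (U * Q ^+ n.+1) by apply: fdM => //; exact: fdX.
  have [ge|[j hj]] := rann_dichotomy primeB (notSI_infinite notSI) frV fUQ
    (mul_idgen_neq0 (n := n.+1) U0); last by case: h; exists n.+1, j.
  apply: dim_ge_mono (ge n) => //.
  apply: (@subset_trans _ (V ^+ n * (W ^+ n * V ^+ (k + 4 * (n * c + n.+2))) * V ^+ n)).
    apply: leM => //; apply: leM => //.
    apply: subset_trans (bound n n.+2); apply: leM => //; apply: le_pwsum; lia.
  rewrite [V ^+ n * (_ * _)]mulrA -[_ * V ^+ _ * V ^+ n]mulrA -exprD.
  by apply: leM; [apply: leM => //|]; apply: le_exp => //; nia.
set U' := U * Q ^+ p * V ^+ j in ann.
have [us Eus] : exists us, U' = fspan us.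
  by apply: dim_le0_fspan; do 2 (apply: fdM; last exact: fdX).
have [C [C0 hC]] := idgen_growth.
pose r := size us.
(* The product C r comes from the dimensions, the rest from the exponents of V. *)
exists (C * r + k + 4 * p + 4 * j + 8 * C + 4 * c + 1)%N => n nC.
have [|m [nm dm]] := hC n.+1; first lia.
rewrite Eus in ann.
have [m' [mm dm']] := rann_dim ann (fd_pwsum _ _ fQ) dm.
exists m'; split.
  apply: (@leq_trans (C * (r * m')))%N.
    by apply: leq_trans (leq_trans nm _); [nia|rewrite leq_mul2l mm orbT].
  by rewrite mulnA leq_mul2r; apply/orP; right; rewrite -!addnA leq_addr.
apply: dim_ge_mono dm' => //; rewrite -Eus /U'.
apply: (@subset_trans _ (W ^+ n * V ^+ (k + 4 * (n * c + (p + (j + C * n.+1)))))).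
  apply: subset_trans (bound _ _); rewrite -!mulrA; apply: leM => //.
  apply: (@subset_trans _ (Q ^+ p * pwsum Q n.+1 (j + C * n.+1))).
    by apply: leM => //; exact: Vn_pwsum.
  by move=> y /exp_pwsum; apply: pwsumS; lia.
rewrite -mulrA; apply: subset_trans; last by apply: le_mull; exact: mem1X.
by apply: leM => //; apply: le_exp => //; nia.
Qed.

End CofiniteIdeal.

Section PowerGrowth.
Context {F : fieldType} {B : algType F}.
Hypothesis primeB : forall x y : B, (forall b, x * b * y = 0) -> x = 0 \/ y = 0.
Hypothesis notSI : forall m, exists a : 'I_m -> B, stdpoly a != 0.

(** The ideal used here annihilates [W^k B / W^(k+1) B].  The frame is first
replaced by a power of itself that meets every class modulo that ideal. *)
Lemma power_growth (V W : @subsp F B) : frame V -> W `<=` V ->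
  (forall n, W ^+ n <> 0) ->
  exists C, forall n, (C <= n)%N -> exists m, (n * n <= C * m)%N /\
    dim_ge 0 (V ^+ (C * n) * W ^+ n * V ^+ (C * n)) m.
Proof.
move=> fr WV W0; have [V1 fV gV] := fr; have fW := fd_sub WV fV.
have [h|[k hk]] := right_chain_dichotomy fr fW WV.
  exists 2%N => n n2; exists (n * n)%N; split; first by rewrite leq_pmull.
  apply: dim_ge_mono (h n) => //; rewrite addnn -mul2n -mulrA.
  by apply: le_mull; exact: mem1X.
have [idP cofP] : ideal (residr (W ^+ k * top) (W ^+ k.+1 * top)) /\
    findim_mod (residr (W ^+ k * top) (W ^+ k.+1 * top)) top.
  by apply: residr_ideal hk; exact: mul_top.
set P := residr _ _ in idP cofP.
have [e [s [_ _ Ps]]] := cofP.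
have [a ha] := frame_fd fr (fd_fspan s).
pose V' := V ^+ a.+1.
have fr' : frame V' by exact: frame_exp.
have [V'1 fV' _] := fr'.
have VV' : V `<=` V' by have := le_exp V1 (ltn0Sn a); rewrite expr1.
have PV' : top `<=` P + V'.
  by move=> x /Ps; apply: leD => // y /ha; exact: le_exp.
have fQ := fd_idgen P fr'.
have [|c hc] := frame_mul_top (Y := W * W ^+ k) fr' (fdM (fdX k fW) fQ).
  apply: mulS_le => x q Wx /(idgen_P idP) Pq; rewrite -exprS; apply: Pq.
  exact: le_mulr.
have WV' : W `<=` V' by move=> x /WV; exact: VV'.
have [C hC] := cofinite_power_growth primeB notSI fr' idP PV' WV' (W0 k) hc.
exists (a.+1 * C)%N => n Cn; have [|m [nm dm]] := hC n.
  by apply: leq_trans Cn; rewrite leq_pmull.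
exists m; split; first by apply: leq_trans nm _; rewrite -mulnA leq_pmull.
by rewrite /V' -!exprM mulnA in dm.
Qed.

End PowerGrowth.

(** * The central closure of a prime algebra *)
Section CentralClosure.
Context {K : fieldType} {A : algType K} (primeA : prime_algebra A).
Implicit Types (x y e : A) (I J : set A) (p : mpair A).
Local Notation mtd := (martindale primeA).
Local Notation Z := (extended_centre primeA).

Lemma ideal_neq0_ex I : is_ideal I -> I <> [set 0] -> exists2 x, I x & x != 0.
Proof.
move=> idI I0; apply: contrapT => h; apply: I0; apply/seteqP; split.
  by move=> x Ix; apply: contrapT => /eqP x0; apply: h; exists x.
by move=> _ ->; exact: Defs.ideal0.
Qed.

Definition principal x : set A := [set z | exists s : seq (A * A), z = \sum_(c <- s) c.1 * x * c.2].

Lemma principal_ideal x : is_ideal (principal x).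
Proof.
split; first by exists [::]; rewrite big_nil.
  by move=> _ _ [s ->] [t ->]; exists (s ++ t); rewrite big_cat.
move=> a _ [s ->]; split.
  exists [seq (a * c.1, c.2) | c <- s]; rewrite big_map mulr_sumr.
  by apply: eq_bigr => p _ /=; rewrite !mulrA.
exists [seq (c.1, c.2 * a) | c <- s]; rewrite big_map mulr_suml.
by apply: eq_bigr => p _ /=; rewrite !mulrA.
Qed.

(** Primeness for elements, from the product of two principal ideals. *)
Lemma prime_elements x y : (forall b, x * b * y = 0) -> x = 0 \/ y = 0.
Proof.
move=> h.
have px z : principal z z by exists [:: (1, 1)]; rewrite big_seq1 mul1r mulr1.
have : ideal_mul (principal x) (principal y) = [set 0].
  apply/seteqP; split; last by move=> _ ->; exists [::]; rewrite ?big_nil.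
  move=> _ [s sP ->] /=; rewrite big_seq big1 // => p /sP[[t ->] [u ->]].
  rewrite mulr_suml big1 // => a _; rewrite mulr_sumr big1 // => b _.
  have -> : a.1 * x * a.2 * (b.1 * y * b.2) = a.1 * (x * (a.2 * b.1) * y) * b.2.
    by rewrite !mulrA.
  by rewrite h mulr0 mul0r.
move=> /(primeA (principal_ideal x) (principal_ideal y))[E|E]; [left|right].
  by have := px x; rewrite E.
by have := px y; rewrite E.
Qed.

Lemma ideal_kill_right I e : is_ideal I -> I <> [set 0] ->
  (forall y, I y -> e * y = 0) -> e = 0.
Proof.
move=> idI /(ideal_neq0_ex idI)[y Iy y0] h.
have [//|E] : e = 0 \/ y = 0.
  by apply: prime_elements => b; rewrite -mulrA; apply: h; exact: Defs.idealMl.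
by rewrite E eqxx in y0.
Qed.

Lemma ideal_kill_left I e : is_ideal I -> I <> [set 0] ->
  (forall y, I y -> y * e = 0) -> e = 0.
Proof.
move=> idI /(ideal_neq0_ex idI)[y Iy y0] h.
have [E|//] : y = 0 \/ e = 0.
  by apply: prime_elements => b; apply: h; exact: Defs.idealMr.
by rewrite E eqxx in y0.
Qed.

Local Notation cls x := (\pi_mtd x)%qT.

(** The difference of the two values annihilates the smaller ideal on which the pairs
are known to agree, so it is zero. *)
Lemma mpair_agree p p' : mequiv p p' ->
  forall x, mdom p x -> mdom p' x -> Defs.mfun p x = Defs.mfun p' x.
Proof.
move=> /asboolP[I [idI I0 sI eI]] x px p'x; apply/eqP; rewrite -subr_eq0; apply/eqP.
apply: (ideal_kill_right idI I0) => y Iy.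
by rewrite mulrBl -!Defs.mfunM // eI ?subrr //; exact: Defs.idealMl.
Qed.

Definition mtd_of x : mtd := cls (plmul x).

Lemma mtd_of_zmod : zmod_morphism mtd_of.
Proof.
move=> x y; rewrite /mtd_of.
have -> : cls (plmul x) - cls (plmul y) = mtd_add (cls (plmul x)) (mtd_opp (cls (plmul y))) by [].
rewrite Defs.pi_opp Defs.pi_add; apply/martindale_eqP/mequivI => // z _ _ /=.
by rewrite mulrBl.
Qed.

Lemma mtd_of_monoid : monoid_morphism mtd_of.
Proof.
split=> // x y; rewrite /mtd_of.
have -> : cls (plmul x) * cls (plmul y) = mtd_mul (cls (plmul x)) (cls (plmul y)) by [].
by rewrite Defs.pi_mul; apply/martindale_eqP/mequivI => // z _ _ /=; rewrite mulrA.
Qed.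

HB.instance Definition _ := GRing.isZmodMorphism.Build A mtd mtd_of mtd_of_zmod.
HB.instance Definition _ := GRing.isMonoidMorphism.Build A mtd mtd_of mtd_of_monoid.

Lemma mtd_ofZ k x : mtd_of (k *: x) = k *: mtd_of x.
Proof.
have -> : k *: mtd_of x = mtd_scale k (mtd_of x) by [].
by rewrite Defs.pi_scale; apply/martindale_eqP/mequivI => // z _ _ /=; rewrite scalerAl.
Qed.

Lemma mtd_of_inj : injective mtd_of.
Proof.
move=> x y /martindale_eqP/mpair_agree/(_ 1 I I) /=; by rewrite !mulr1.
Qed.

Lemma mtd_mul_of p x : mdom p x -> cls p * mtd_of x = mtd_of (Defs.mfun p x).
Proof.
move=> px; have -> : cls p * mtd_of x = mtd_mul (cls p) (mtd_of x) by [].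
by rewrite Defs.pi_mul; apply/martindale_eqP/mequivI => // z _ _ /=; rewrite Defs.mfunM.
Qed.

(** Such a [q] agrees with zero on the intersection of [I] and its domain. *)
Lemma mtd_faithful (q : mtd) I : is_ideal I -> I <> [set 0] ->
  (forall x, I x -> q * mtd_of x = 0) -> q = 0.
Proof.
elim/(@martindale_ind _ _ primeA): q => p idI I0 h.
apply/martindale_eqP/asboolP; exists (mdom p `&` I); split.
- by apply: is_idealI => //; exact: mdom_ideal.
- by apply: (idealI_neq0 primeA) => //; [exact: mdom_ideal|exact: mdom_neq0].
- by move=> x [].
- move=> x [px Ix] /=; apply: mtd_of_inj; rewrite -mtd_mul_of // h //.
  by rewrite rmorph0.
Qed.

(** Commuting with [A] makes the homomorphism left linear. *)
Lemma central_bimod p : cls p \in central (primeA := primeA) ->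
  forall a x, mdom p x -> Defs.mfun p (a * x) = a * Defs.mfun p x.
Proof.
move=> /asboolP cp a x px; apply: mtd_of_inj.
rewrite -mtd_mul_of; last exact: Defs.idealMl (mdom_ideal p) px.
by rewrite rmorphM mulrA cp -mulrA mtd_mul_of // -rmorphM.
Qed.

(** A nonzero central class is represented by an injective homomorphism of
bimodules, since its kernel annihilates its image.  The inverse is the inverse
map, defined on the image. *)
Section Inverse.
Variables (p : mpair A) (cp : cls p \in central (primeA := primeA)) (p0 : cls p != 0 :> mtd).

Lemma central_mfun_inj x y : mdom p x -> mdom p y -> Defs.mfun p x = Defs.mfun p y -> x = y.
Proof.
move=> px py E; have idp := mdom_ideal p.
apply/eqP; rewrite -subr_eq0; apply/eqP; set u := x - y.
have pu : mdom p u.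
  by apply: Defs.idealD => //; rewrite -mulN1r; exact: Defs.idealMl.
have fu : Defs.mfun p u = 0.
  rewrite /u Defs.mfunD //; last by rewrite -mulN1r; exact: Defs.idealMl.
  by rewrite -mulN1r central_bimod // mulN1r E subrr.
apply: contrapT => u0; move/eqP: p0; apply.
apply: (mtd_faithful idp (@mdom_neq0 _ _ p)) => v pv.
rewrite mtd_mul_of //; suff -> : Defs.mfun p v = 0 by rewrite rmorph0.
have [//|//] : u = 0 \/ Defs.mfun p v = 0.
apply: prime_elements => b; have pbv : mdom p (b * v) by exact: Defs.idealMl.
by rewrite -mulrA -central_bimod // -central_bimod // Defs.mfunM // fu mul0r.
Qed.

Definition inv_dom : set A := [set y | exists2 x, mdom p x & Defs.mfun p x = y].
Definition inv_fun y := xget 0 [set x | mdom p x /\ Defs.mfun p x = y].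

Lemma inv_funK x : mdom p x -> inv_fun (Defs.mfun p x) = x.
Proof.
move=> px; rewrite /inv_fun; case: xgetP => [y _ [py E]|/(_ x)[]] //.
exact: central_mfun_inj.
Qed.

Fact inv_dom_ideal : is_ideal inv_dom.
Proof.
have idp := mdom_ideal p; split.
- by exists 0; [exact: Defs.ideal0 | exact: Defs.mfun0].
- by move=> _ _ [x px <-] [y py <-]; exists (x + y); [exact: Defs.idealD|exact: Defs.mfunD].
- move=> a _ [x px <-]; split.
    by exists (a * x); [exact: Defs.idealMl|exact: central_bimod].
  by exists (x * a); [exact: Defs.idealMr|exact: Defs.mfunM].
Qed.

Fact inv_dom_neq0 : inv_dom <> [set 0].
Proof.
move=> E; have [x px x0] := ideal_neq0_ex (mdom_ideal p) (@mdom_neq0 _ _ p).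
have : inv_dom (Defs.mfun p x) by exists x.
rewrite E /= -(Defs.mfun0 p) => /central_mfun_inj x0'.
by rewrite x0' ?eqxx // in x0; exact: Defs.ideal0 (mdom_ideal p).
Qed.

Fact inv_funD x y : inv_dom x -> inv_dom y -> inv_fun (x + y) = inv_fun x + inv_fun y.
Proof.
move=> [u pu <-] [v pv <-]; rewrite -Defs.mfunD // !inv_funK //.
exact: Defs.idealD (mdom_ideal p) pu pv.
Qed.

Fact inv_funM x a : inv_dom x -> inv_fun (x * a) = inv_fun x * a.
Proof.
move=> [u pu <-]; rewrite -Defs.mfunM // !inv_funK //.
exact: Defs.idealMr (mdom_ideal p) pu.
Qed.

Definition inv_pair := MPair inv_dom_ideal inv_dom_neq0 inv_funD inv_funM.

Lemma inv_pairK : cls inv_pair * cls p = 1 :> mtd.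
Proof.
have -> : cls inv_pair * cls p = mtd_mul (cls inv_pair) (cls p) by [].
rewrite Defs.pi_mul; apply/martindale_eqP/mequivI => // x px _ /=.
by rewrite mul1r inv_funK //; exact: ideal_mul_subl (mdom_ideal p) _ px.
Qed.

End Inverse.

Lemma central_inv (z : Z) : z != 0 -> exists w : Z, w * z = 1.
Proof.
move=> z0; have Ez : cls (generic_quotient.repr (ecval z)) = ecval z by exact: reprK.
have cz : cls (generic_quotient.repr (ecval z)) \in central (primeA := primeA) by rewrite Ez; exact: ecvalP.
have pz : cls (generic_quotient.repr (ecval z)) != 0 :> mtd.
  by rewrite Ez; apply: contraNneq z0 => E; apply/eqP/val_inj.
have := inv_pairK cz pz; rewrite Ez; set w := cls _ => wz.
have zC (y : mtd) : ecval z * y = y * ecval z by exact: (asboolP _ (ecvalP z)).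
have cw : w \in central (primeA := primeA).
  apply/asboolP => y; have zw : ecval z * w = 1 by rewrite zC.
  by rewrite -[w * y]mulr1 -zw mulrA -(mulrA w) -zC mulrA wz mul1r.
by exists (ExtendedCentre cw); apply: val_inj; rewrite rmorphM rmorph1.
Qed.

Definition central_inverse (z : Z) : Z := xget 0 [set w | w * z = 1].

Fact central_mulVf z : z != 0 -> central_inverse z * z = 1.
Proof.
by move=> /central_inv[w wz]; rewrite /central_inverse; case: xgetP => [//|/(_ w)].
Qed.

Fact central_inv0 : central_inverse 0 = 0.
Proof.
rewrite /central_inverse; case: xgetP => [w _ /= /eqP|//].
by rewrite mulr0 eq_sym oner_eq0.
Qed.

HB.instance Definition _ :=
  GRing.ComNzRing_isField.Build Z central_mulVf central_inv0.

(** The Martindale ring already carries the structure of an algebra over [K]; the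
alias carries that of an algebra over the extended centre. *)
Definition mtdZ := mtd.
HB.instance Definition _ := GRing.NzRing.on mtdZ.

Definition zscale (z : Z) (q : mtdZ) : mtdZ := ecval z * q.

Fact zscaleA z w q : zscale z (zscale w q) = zscale (z * w) q.
Proof. by rewrite /zscale mulrA. Qed.
Fact zscale1 : left_id 1 zscale.
Proof. by move=> q; rewrite /zscale mul1r. Qed.
Fact zscaleDr : right_distributive zscale +%R.
Proof. by move=> z q q'; rewrite /zscale mulrDr. Qed.
Fact zscaleDl q : {morph zscale^~ q : z w / z + w}.
Proof. by move=> z w; rewrite /zscale mulrDl. Qed.

HB.instance Definition _ := GRing.Zmodule_isLmodule.Build Z mtdZ
  zscaleA zscale1 zscaleDr zscaleDl.

Fact zscaleAl (z : Z) (q q' : mtdZ) : z *: (q * q') = (z *: q) * q'.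
Proof. exact: (@mulrA mtd (ecval z) q q'). Qed.
HB.instance Definition _ := GRing.Lmodule_isLalgebra.Build Z mtdZ zscaleAl.

Fact zscaleAr (z : Z) (q q' : mtdZ) : z *: (q * q') = q * (z *: q').
Proof.
have zC (y : mtd) : ecval z * y = y * ecval z by exact: (asboolP _ (ecvalP z)).
by rewrite -[LHS]/(ecval z * ((q : mtd) * q')) mulrA zC -mulrA.
Qed.
HB.instance Definition _ := GRing.Lalgebra_isAlgebra.Build Z mtdZ zscaleAr.

Definition in_closure : {pred mtdZ} :=
  fun q => `[< Defs.span (range (mtd_of : A -> mtdZ)) q >].

Fact in_closure_subalg : GRing.subalg_closed in_closure.
Proof.
split=> [|z q q'|q q'].
- apply/asboolP; exists [:: (1, mtd_of 1)].
    by move=> c; rewrite inE => /eqP ->; exists 1.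
  by rewrite big_seq1 scale1r rmorph1.
- move=> /asboolP[s sP ->] /asboolP[t tP ->]; apply/asboolP.
  exists ([seq (z * c.1, c.2) | c <- s] ++ t).
    by move=> c; rewrite mem_cat => /orP[/mapP[u /sP us ->]//|/tP].
  rewrite big_cat big_map scaler_sumr; congr (_ + _).
  by apply: eq_bigr => c _; rewrite scalerA.
- move=> /asboolP[s sP ->] /asboolP[t tP ->]; apply/asboolP.
  exists [seq (c.1 * u.1, c.2 * u.2) | c <- s, u <- t].
    move=> _ /allpairsP[[c u] /= [/sP[a _ <-] /tP[b _ <-] ->]] /=.
    by exists (a * b) => //; rewrite rmorphM.
  rewrite big_allpairs_dep mulr_suml; apply: eq_bigr => c _.
  rewrite mulr_sumr; apply: eq_bigr => u _ /=.
  by rewrite -scalerAl -scalerAr scalerA.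
Qed.

HB.instance Definition _ :=
  GRing.isSubalgClosed.Build Z mtdZ in_closure in_closure_subalg.

Record central_closure := CentralClosure {
  ccval :> mtdZ;
  ccvalP : ccval \in in_closure }.

HB.instance Definition _ := [isSub for ccval].
HB.instance Definition _ := [Choice of central_closure by <:].
HB.instance Definition _ := [SubChoice_isSubAlgebra of central_closure by <:].

Fact mtd_of_in_closure x : (mtd_of x : mtdZ) \in in_closure.
Proof.
apply/asboolP; exists [:: (1, mtd_of x)]; last by rewrite big_seq1 scale1r.
by move=> c; rewrite inE => /eqP ->; exists x.
Qed.

Definition emb x : central_closure := CentralClosure (mtd_of_in_closure x).

Fact emb_zmod : zmod_morphism emb.
Proof. by move=> x y; apply: val_inj; rewrite /= rmorphB. Qed.
Fact emb_monoid : monoid_morphism emb.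
Proof. by split=> [|x y]; apply: val_inj; rewrite /= ?rmorph1 ?rmorphM. Qed.

HB.instance Definition _ := GRing.isZmodMorphism.Build A central_closure emb emb_zmod.
HB.instance Definition _ := GRing.isMonoidMorphism.Build A central_closure emb emb_monoid.

Lemma emb_inj : injective emb.
Proof. by move=> x y /(congr1 ccval)/mtd_of_inj. Qed.

Lemma embZ (k : K) x : emb (k *: x) = (k%:A : Z) *: emb x.
Proof.
apply: val_inj; rewrite linearZ /= mtd_ofZ.
by rewrite -[RHS]/(ecval (k%:A) * mtd_of x) -[ecval _]/(k *: 1) -scalerAl mul1r.
Qed.

Lemma closure_span (b : central_closure) :
  exists s : seq (Z * A), b = \sum_(c <- s) c.1 *: emb c.2.
Proof.
have /asboolP[s sP Eb] := ccvalP b.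
have [t Et] : exists t : seq (Z * A), s = [seq (c.1, mtd_of c.2 : mtdZ) | c <- t].
  elim: s sP {Eb} => [|c s IH] sP; first by exists [::].
  have [|t ->] := IH; first by move=> u us; apply: sP; rewrite inE us orbT.
  have [a _ Ea] := sP c (mem_head _ _).
  by exists ((c.1, a) :: t); rewrite /= Ea -surjective_pairing.
exists t; apply: val_inj; rewrite [RHS]raddf_sum /= Eb Et big_map.
by apply: eq_bigr => c _ /=.
Qed.

(** The intersection of the domains of finitely many representatives is still
nonzero in a prime algebra. *)
Lemma centre_domain (zs : seq Z) : exists I, [/\ is_ideal I, I <> [set 0] &
  forall z, z \in zs -> forall x, I x -> exists a, z *: emb x = emb a].
Proof.
elim: zs => [|z zs [I [idI I0 hI]]].
  by exists setT; split=> //; exact: setT_neq0.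
have Ez : cls (generic_quotient.repr (ecval z)) = ecval z by exact: reprK.
set p := generic_quotient.repr _ in Ez.
exists (I `&` mdom p); split.
- by apply: is_idealI => //; exact: mdom_ideal.
- by apply: (idealI_neq0 primeA) => //; [exact: mdom_ideal|exact: mdom_neq0].
- move=> w; rewrite inE => /orP[/eqP ->|wz] x [Ix px]; last exact: hI.
  exists (Defs.mfun p x); apply: val_inj; rewrite linearZ /=.
  by rewrite -[LHS]/(ecval z * mtd_of x) -Ez mtd_mul_of.
Qed.

Lemma closure_domain (b : central_closure) : exists I, [/\ is_ideal I, I <> [set 0] &
  forall x, I x -> (exists a, b * emb x = emb a) /\ (exists a, emb x * b = emb a)].
Proof.
have [s ->] := closure_span b.
have [I [idI I0 hI]] := centre_domain (unzip1 s).
exists I; split=> // x Ix.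
have hs c y : c \in s -> I y -> exists a, c.1 *: emb y = emb a.
  by move=> cs Iy; apply: hI => //; exact: map_f.
elim: s {hI} hs => [|c s IH] hs.
  by split; exists 0; rewrite big_nil ?mul0r ?mulr0 rmorph0.
have [|[a Ea] [a' Ea']] := IH; first by move=> u y us; apply: hs; rewrite inE us orbT.
have [e Ee] := hs c (c.2 * x) (mem_head _ _) (Defs.idealMl c.2 idI Ix).
have [e' Ee'] := hs c (x * c.2) (mem_head _ _) (Defs.idealMr c.2 idI Ix).
split; [exists (e + a)|exists (e' + a')]; rewrite big_cons rmorphD /=.
  by rewrite mulrDl Ea -scalerAl -rmorphM Ee.
by rewrite mulrDr Ea' -scalerAr -rmorphM Ee'.
Qed.

Lemma closure_faithful (b : central_closure) I : is_ideal I -> I <> [set 0] ->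
  (forall x, I x -> b * emb x = 0) -> b = 0.
Proof.
move=> idI I0 h; apply: val_inj; apply: (mtd_faithful idI I0) => x Ix.
by have := congr1 ccval (h x Ix).
Qed.

(** The definition of the Martindale ring favours right multiplication; the left
statement holds in the central closure because elements of [A Z] multiply some
nonzero ideal of [A] into [A] from the right as well. *)
Lemma closure_faithful_left (b : central_closure) I : is_ideal I -> I <> [set 0] ->
  (forall x, I x -> emb x * b = 0) -> b = 0.
Proof.
move=> idI I0 h; have [J [idJ J0 hJ]] := closure_domain b.
apply: (closure_faithful idJ J0) => y Jy; have [[a Ea] _] := hJ y Jy.
rewrite Ea; suff -> : a = 0 by rewrite rmorph0.
apply: (ideal_kill_left idI I0) => x Ix; apply: emb_inj.
by rewrite rmorphM /= -Ea mulrA h // mul0r rmorph0.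
Qed.

(** Two nonzero elements are brought into [A] without becoming zero, the first by
multiplication on the right and the second by multiplication on the left. *)
Lemma closure_prime (b b' : central_closure) :
  (forall c, b * c * b' = 0) -> b = 0 \/ b' = 0.
Proof.
move=> h; have [I [idI I0 hI]] := closure_domain b.
have [J [idJ J0 hJ]] := closure_domain b'.
have [hb|/existsNP[x /not_implyP[Ix bx]]] := pselect (forall x, I x -> b * emb x = 0).
  by left; exact: closure_faithful idI I0 hb.
right; apply: (closure_faithful_left idJ J0) => y Jy.
have [[a Ea] _] := hI x Ix; have [_ [a' Ea']] := hJ y Jy; rewrite Ea'.
have [a0|->] : a = 0 \/ a' = 0; last by rewrite rmorph0.
  apply: prime_elements => c; apply: emb_inj; rewrite !rmorphM /= -Ea -Ea' rmorph0.
  by rewrite -(h (emb x * emb c * emb y)) !mulrA.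
by rewrite Ea a0 rmorph0 in bx.
Qed.

End CentralClosure.

(** * Transcendental central elements and growth *)
Section StandardIdentity.
Context {K : fieldType} {A : algType K}.

Let word m (s : 'S_m) : monalg.fmonom nat :=
  monalg.FMonom [seq (s i : nat) | i <- enum 'I_m].

Lemma word_inj m : injective (@word m).
Proof.
move=> s t [E]; apply/permP => i; apply: val_inj.
by have /eq_in_map/(_ i) := E; rewrite mem_enum; apply.
Qed.

(** Distinct permutations give distinct words, so the standard polynomial is a
nonzero element of the free algebra. *)
Lemma standard_identity_PI m : (forall a : 'I_m -> A, stdpoly a = 0) -> PI_algebra A.
Proof.
move=> h; exists (\sum_(s : 'S_m) monalg.mkmalgU (word s) ((-1) ^+ s : K)); split.
  move=> /(congr1 (monalg.mcoeff (word (1%g : 'S_m)))).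
  rewrite (big_morph _ (monalg.mcoeffD _) (monalg.mcoeff0 _)) monalg.mcoeff0.
  rewrite (bigD1 1%g) //= big1 => [|s s1]; last first.
    by rewrite monalg.mcoeffU (inj_eq (@word_inj m)) (negbTE s1).
  by rewrite monalg.mcoeffUU odd_perm1 addr0 => /eqP; rewrite oner_eq0.
move=> a; rewrite (big_morph _ (@monalg.mmapD _ _ _ _ _) (@monalg.mmap0 _ _ _ _ _)).
rewrite -[RHS](h (fun i => a i)); apply: eq_bigr => s _.
rewrite monalg.mmapU /= big_map.
have -> : enum 'I_m = index_enum _ by rewrite enumT [index_enum _]unlock.
congr (_ * _).
by case: (odd_perm s); rewrite ?expr1 ?expr0 ?scaleN1r ?scale1r.
Qed.

End StandardIdentity.

Section DimK.
Context {K : fieldType} {A : algType K}.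
Implicit Types (N X Y : @subsp K A).

Lemma span_le (S : set A) N : S `<=` N -> Defs.span S `<=` N.
Proof.
by move=> SN _ [s sP ->]; rewrite big_seq; apply: sub_sum => p /sP/SN; exact: subZ.
Qed.

Fact span_closed (S : set A) : Defs.span S 0 /\ forall c x y,
  Defs.span S x -> Defs.span S y -> Defs.span S (c *: x + y).
Proof.
split; first by exists [::]; rewrite ?big_nil.
move=> c _ _ [s sP ->] [t tP ->]; exists ([seq (c * p.1, p.2) | p <- s] ++ t).
  by move=> p; rewrite mem_cat => /orP[/mapP[u /sP us ->]//|/tP].
rewrite big_cat big_map scaler_sumr; congr (_ + _).
by apply: eq_bigr => p _; rewrite scalerA.
Qed.
Definition spanS S := Subsp (span_closed S).

Lemma mem_span (S : set A) x : S x -> Defs.span S x.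
Proof.
move=> Sx; exists [:: (1, x)]; last by rewrite big_seq1 scale1r.
by move=> p; rewrite inE => /eqP ->.
Qed.

Lemma span_fspan (s : seq A) : Defs.span [set x | x \in s] = fspan s :> set A.
Proof.
apply/seteqP; split; first by apply: span_le => x; exact: mem_fspan.
suff : fspan s `<=` spanS [set x | x \in s] by [].
by apply: fspan_le => x xs; exact: mem_span.
Qed.

Lemma subspace_expE X n : subspace_exp X n = (X ^+ n)%R :> set A.
Proof.
apply/seteqP; split.
  apply: span_le => _ [v vX ->]; elim: n v vX => [|n IH] v vX.
    by rewrite big_ord0; exact: mem_line.
  by rewrite big_ord_recl exprS; apply: memM => //; apply: IH => i; exact: vX.
pose P n := [set x | exists2 v : 'I_n -> A, (forall i, X (v i)) & x = \prod_(i < n) v i].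
suff : X ^+ n `<=` spanS (P n) by [].
elim: n => [|n IH].
  apply: line_le; apply: mem_span; exists (fun=> 0); rewrite ?big_ord0 //.
  by case.
rewrite exprS; apply: mulS_le => x y Xx /IH.
have lf : lin (fun y => x * y) by move=> c a b; rewrite mulrDr scalerAr.
suff h : spanS (P n) `<=` lin_preim lf (spanS (P n.+1)) by move=> /h.
apply: span_le => _ [v vX ->]; apply: mem_span.
exists (fun i => if unlift ord0 i is Some j then v j else x).
  by move=> i; case: unliftP => [j _|_].
rewrite big_ord_recl unlift_none; congr (_ * _).
by apply: eq_bigr => i _; rewrite liftK.
Qed.

Lemma dimK_dim_ge X m : findim_mod 0 X -> dim_ge 0 X m -> (m <= dimK X)%N.
Proof.
move=> fX dX; rewrite /dimK; case: xgetP => [d _ [b [_ bX]]|h].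
  have : X `<=` 0 + fspan [seq b i | i <- enum 'I_d].
    rewrite add0r => x; rewrite -bX => -[s sP ->]; rewrite big_seq.
    apply: sub_sum => p /sP[i _ <-]; apply: subZ; apply: mem_fspan.
    by apply: map_f; rewrite mem_enum.
  by move=> /(dim_ge_fspan dX); rewrite size_map size_enum_ord.
have [n [[s [sn sX fs]] _]] := fd_dim fX.
have [d [[s' [sd sX' fs']] [t [td tX Xt]]]] := fd_dim fX.
case: (h d); pose e (i : 'I_d) := nth 0 s' i.
have Es : [seq e i | i <- enum 'I_d] = s'.
  by rewrite (@map_comp _ _ _ (nth 0 s') val) val_enum_ord -sd map_nth_iota0 ?take_size.
exists e; split.
  move=> c E i; rewrite -Es in fs'.
  apply: ((free_mod0P e (enum_uniq 'I_d)).1 fs' c); rewrite ?mem_enum //.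
  by rewrite big_enum.
apply/seteqP; split.
  by apply: span_le => _ [i _ <-]; apply: sX'; rewrite /e mem_nth // sd.
suff : X `<=` spanS (range e) by [].
have Xs : X `<=` fspan s'.
  move=> x Xx; apply: contrapT => nx.
  have : dim_ge 0 X d.+1.
    exists (x :: s'); split=> /=; [by rewrite sd| |by split=> //; rewrite add0r].
    by move=> y; rewrite inE => /orP[/eqP ->|/sX'].
  by move=> /dim_ge_fspan/(_ Xt); rewrite leqNgt ltnS td.
move=> x /Xs; move: x; apply: fspan_le; rewrite -Es => _ /mapP[i _ ->].
by apply: mem_span; exists i.
Qed.

Fixpoint word_list (s : seq A) n : seq A :=
  if n is n'.+1 then [seq x * y | x <- s, y <- word_list s n'] else [:: 1].

Lemma fspan_word_list s n : fspan (word_list s n) = fspan s ^+ n.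
Proof.
elim: n => [|n IH] /=; first by rewrite fspan_cons fspan_nil addr0.
by rewrite exprS -IH fspanM.
Qed.

End DimK.

Section FreeSublist.
Context {F : fieldType} {B : algType F} {T : eqType} (e : T -> B).

Lemma free_uniq (M : @subsp F B) (s : seq T) : free_mod M [seq e i | i <- s] -> uniq s.
Proof.
elim: s => //= x s IH [xs /IH ->]; rewrite andbT.
by apply: contra_notN xs => xs; apply: le_addr; apply: mem_fspan; exact: map_f.
Qed.

Lemma free_sublist (t : seq T) : exists s, [/\ {subset s <= t},
  free_mod (0 : @subsp F B) [seq e i | i <- s] &
  fspan [seq e i | i <- t] `<=` (fspan [seq e i | i <- s] : @subsp F B)].
Proof.
elim: t => [|x t [s [st fs ts]]]; first by exists [::]; split.
have [h|h] := pselect ((0 + fspan [seq e i | i <- s])%R (e x)).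
  exists s; split=> //; first by move=> y /st yt; rewrite inE yt orbT.
  rewrite /= fspan_cons; apply: addS_le => //.
  by apply: line_le; rewrite add0r in h.
exists (x :: s); split=> //=; last by rewrite !fspan_cons; exact: leD.
by move=> y; rewrite !inE => /orP[->//|/st ->]; rewrite orbT.
Qed.

End FreeSublist.

Section ClosureGrowth.
Context {K : fieldType} {A : algType K} (primeA : prime_algebra A).
Local Notation Z := (extended_centre primeA).
Local Notation B := (central_closure primeA).
Local Notation emb := (@emb K A primeA).
Local Notation subA := (@subsp K A).
Local Notation subB := (@subsp Z B).

Lemma emb_fspan (s : seq A) x : fspan s x -> (fspan [seq emb y | y <- s] : subB) (emb x).
Proof.
elim: s x => [|y s IH] x /=.
  by rewrite !fspan_nil => ->; rewrite rmorph0; exact: sub0.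
rewrite !fspan_cons => -[_ [c _ <-] [u us <-]]; rewrite rmorphD /= embZ.
apply: subD; first by apply: le_addl; apply: subZ; exact: mem_line.
by apply: le_addr; exact: IH.
Qed.

Lemma emb_word_list s n :
  [seq emb x | x <- word_list s n] = word_list [seq emb x | x <- s] n.
Proof.
elim: n => [|n IH] /=; first by rewrite rmorph1.
rewrite -IH map_allpairs allpairs_mapl allpairs_mapr.
by apply: eq_allpairs => x y /=; rewrite rmorphM.
Qed.

Section Absorb.
Context {d : nat} (z : 'I_d -> Z) (X : subA).

Definition zprod (l : seq 'I_d) : Z := \prod_(i <- l) z i.

(** Products of [n] elements of [X] that remain such products when multiplied by any
monomial of degree at most [n] in the [z_i].  Monomials are given as lists of
indices so that they can be cut in two. *)
Definition absorbs n : set A := [set y | forall l, (size l <= n)%N ->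
  exists2 y', (X ^+ n)%R y' & zprod l *: emb y = emb y'].

Fact absorbs_closed n : absorbs n 0 /\ forall c x y,
  absorbs n x -> absorbs n y -> absorbs n (c *: x + y).
Proof.
split=> [l _|c x y hx hy l ln].
  by exists 0; [exact: sub0|rewrite rmorph0 scaler0].
have [x' Xx' Ex] := hx l ln; have [y' Xy' Ey] := hy l ln.
exists (c *: x' + y'); first exact: subL.
by rewrite !rmorphD /= !embZ scalerDr Ey scalerA mulrC -scalerA Ex.
Qed.
Definition absorbing n : subA := Subsp (absorbs_closed n).

(** A monomial of degree at most [a + b] is cut after its first [a] factors. *)
Lemma absorbingM a b : absorbing a * absorbing b `<=` absorbing (a + b).
Proof.
apply: mulS_le => x y hx hy l ln.
have [|x' Xx' Ex] := hx (take a l); first by rewrite size_take_min geq_minl.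
have [|y' Xy' Ey] := hy (drop a l); first by rewrite size_drop leq_subLR.
exists (x' * y'); first by rewrite exprD; exact: memM.
rewrite /zprod -(cat_take_drop a l) big_cat /= rmorphM /=.
by rewrite -scalerA scalerAr -[\prod_(i <- drop _ _) _]/(zprod _) Ey scalerAl Ex rmorphM.
Qed.

Lemma absorbing_exp (W : subA) n : W `<=` absorbing 1 -> W ^+ n `<=` absorbing n.
Proof.
move=> W1; elim: n => [|n IH].
  apply: line_le; move=> [|i l] //= _; exists 1; first exact: mem_line.
  by rewrite /zprod big_nil scale1r.
rewrite exprS -add1n => x Wx; apply: absorbingM; move: x Wx; exact: leM.
Qed.

End Absorb.

Lemma zpow_list d n (z : 'I_d -> Z) (al : {ffun 'I_d -> 'I_n}) : exists l,
  (size l <= d * n)%N /\ zprod z l = \prod_i z i ^+ al i.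
Proof.
exists (flatten [seq nseq (al i) i | i <- enum 'I_d]); split.
  rewrite size_flatten /shape -map_comp sumnE big_map big_enum /=.
  rewrite -[X in (_ <= X * _)%N](card_ord d) -sum_nat_const.
  by apply: leq_sum => i _; rewrite size_nseq ltnW.
rewrite /zprod big_flatten big_map big_enum; apply: eq_bigr => i _ /=.
by rewrite big_nseq -Monoid.iteropE.
Qed.

Lemma alg_indep_monomials d n (z : 'I_d -> Z) (c : {ffun 'I_d -> 'I_n} -> K) :
  alg_indep z -> \sum_al (c al)%:A * \prod_i z i ^+ al i = 0 -> forall al, c al = 0.
Proof.
move=> zi E.
pose mon (al : {ffun 'I_d -> 'I_n}) := mpoly.Multinom [tuple (al i : nat) | i < d].
have mon_inj : injective mon.
  move=> al be /mpoly.mnmP h; apply/ffunP => i; apply: val_inj.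
  by have := h i; rewrite /mon !mpoly.multinomE !tnth_map !tnth_ord_tuple.
have p0 := zi (\sum_al c al *: mpoly.mpolyX K (mon al)).
have {p0} p0 : \sum_al c al *: mpoly.mpolyX K (mon al) = 0.
  apply: p0; rewrite raddf_sum /= -[RHS]E; apply: eq_bigr => al _.
  rewrite mpoly.mmapZ mpoly.mmapX; congr (_ * _).
  by apply: eq_bigr => i _; rewrite /mon mpoly.multinomE tnth_map tnth_ord_tuple.
move=> al; have := congr1 (mpoly.mcoeff (mon al)) p0.
rewrite raddf_sum raddf0 /= (bigD1 al) //= big1 ?addr0.
  by rewrite mpoly.mcoeffZ mpoly.mcoeffX eqxx mulr1.
by move=> be bal; rewrite mpoly.mcoeffZ mpoly.mcoeffX (inj_eq mon_inj) (negbTE bal) mulr0.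
Qed.

Lemma emb_neq0 x : x != 0 -> emb x != 0.
Proof. by apply: contra_neq => E; apply: (@emb_inj _ _ primeA); rewrite E rmorph0. Qed.

(** A relation over [K] between the products is one over [Z] between the [x] whose
coefficients are polynomials over [K] in the [z_i]. *)
Lemma monomial_multiples d n (z : 'I_d -> Z) (S : seq A) (Y : subA) : alg_indep z ->
  free_mod (0 : subB) [seq emb x | x <- S] ->
  (forall x, x \in S -> forall al : {ffun 'I_d -> 'I_n},
     exists2 y, Y y & (\prod_i z i ^+ al i) *: emb x = emb y) ->
  dim_ge 0 Y (size S * n ^ d).
Proof.
move=> zi fS hS; have uS := free_uniq fS.
have /choice[h hh] (p : A * {ffun 'I_d -> 'I_n}) : exists y, p.1 \in S ->
    Y y /\ (\prod_i z i ^+ p.2 i) *: emb p.1 = emb y.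
  have [pS|_] := boolP (p.1 \in S); last by exists 0.
  by have [y Yy E] := hS _ pS p.2; exists y.
pose L := [seq (x, al) | x <- S, al <- enum {: {ffun 'I_d -> 'I_n}}].
have uL : uniq L by apply: allpairs_uniq => // [|[? ?] [? ?] _ _ //]; exact: enum_uniq.
exists [seq h p | p <- L]; split.
- by rewrite size_map size_allpairs -cardE card_ffun !card_ord.
- move=> _ /mapP[_ /allpairsP[[x al] /= [xS _ ->]] ->].
  by have [] := hh (x, al) xS.
apply/(free_mod0P _ uL) => c E [x al] /allpairsP[[x' al'] /= [xS _ [-> ->]]].
have key : \sum_(u <- S) (\sum_(be : {ffun 'I_d -> 'I_n})
    (c (u, be))%:A * \prod_i z i ^+ be i) *: emb u = 0.
  rewrite -[RHS](rmorph0 emb) -E rmorph_sum big_allpairs_dep /=.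
  apply: eq_big_seq => u uS'; rewrite scaler_suml big_enum /=.
  apply: eq_bigr => be _.
  have [_ Eh] := hh (u, be) uS'.
  by rewrite embZ -Eh scalerA.
have := (free_mod0P _ uS).1 fS _ key x' xS.
by move=> /(alg_indep_monomials zi)/(_ al').
Qed.

Hypothesis notPI : ~ PI_algebra A.
Hypothesis no_locnil : forall I : set A, is_ideal I -> locally_nilpotent I -> I = [set 0].

Lemma closure_notSI m : exists a : 'I_m -> B, stdpoly a != 0.
Proof.
apply: contrapT => h; apply: notPI; apply: (@standard_identity_PI K A m) => a.
apply: (@emb_inj _ _ primeA); rewrite rmorph0.
have : stdpoly (fun i => emb (a i)) = 0.
  by apply: contrapT => /eqP h'; apply: h; exists (fun i => emb (a i)).
move=> <-; rewrite /stdpoly rmorph_sum; apply: eq_bigr => s _ /=.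
by rewrite rmorphM rmorph_sign rmorph_prod.
Qed.

Lemma non_nilpotent_subspace I : is_ideal I -> I <> [set 0] ->
  exists s : seq A, (forall x, x \in s -> I x) /\ forall n, (fspan s ^+ n : subA) <> 0.
Proof.
move=> idI I0.
have : ~ locally_nilpotent I by move=> /(no_locnil idI).
move=> /existsNP[_ /not_implyP[[s ->] /not_implyP[sI h]]].
exists s; split; first by move=> x xs; apply: sI; rewrite span_fspan; exact: mem_fspan.
case=> [|n] E.
  have := mem_line (1 : A); rewrite -[line 1]/(1 : subA) -(expr0 (fspan s)) E => /eqP.
  by rewrite oner_eq0.
by apply: h; exists n.+1; rewrite // span_fspan subspace_expE E.
Qed.

(** [W] is spanned by [s], and [X] is a power of the frame that contains [W] and all
[z_i W].  The exponent [n1 = (d + 1) n] leaves room for the monomials whose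
exponents are all less than [n], of degree at most [d n], and is at least [n]
also when [d = 0]. *)
Lemma trdeg_growth (V : subA) d (z : 'I_d -> Z) : frame V -> alg_indep z ->
  exists C e, [/\ (0 < C)%N, (0 < e)%N & forall n, (C <= n)%N ->
    exists m, (n ^ d.+2 <= C * m)%N /\ dim_ge 0 (V ^+ (e * n)) m].
Proof.
move=> fr zi.
have [I [idI I0 hI]] := centre_domain [seq z i | i <- enum 'I_d].
have [s [sI sn0]] := non_nilpotent_subspace idI I0.
have /choice[a ha] (p : 'I_d * A) : exists y, p.2 \in s -> z p.1 *: emb p.2 = emb y.
  have [ps|_] := boolP (p.2 \in s); last by exists 0.
  by have [|y E] := hI (z p.1) _ _ (sI _ ps); [apply: map_f; rewrite mem_enum|exists y].
have [c hc] := frame_fd fr (fd_fspan (s ++ [seq a (i, w) | i <- enum 'I_d, w <- s])).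
pose X := V ^+ c.+1.
have frX : frame X by exact: frame_exp.
have [V1 _ _] := fr; have [X1 fX gX] := frX.
have cX y : y \in s ++ [seq a (i, w) | i <- enum 'I_d, w <- s] -> X y.
  by move=> /mem_fspan/hc; exact: le_exp.
have [sX EX] := dim_le0_fspan fX.
pose VB : subB := fspan [seq emb x | x <- sX].
pose WB : subB := fspan [seq emb x | x <- s].
have VBn n x : (X ^+ n)%R x -> (VB ^+ n)%R (emb x).
  rewrite EX -fspan_word_list => /emb_fspan; rewrite emb_word_list fspan_word_list //.
have frVB : frame VB.
  split; [|exact: fd_fspan|].
    by have := VBn 1%N 1; rewrite !expr1 rmorph1; apply.
  move=> b; have [t ->] := closure_span b.
  elim: t => [|u t [n hn]]; first by exists 0%N; rewrite big_nil; exact: sub0.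
  have [m hm] := gX u.2; exists (n + m)%N; rewrite big_cons.
  have VB1 : VB 1 by have := VBn 1%N 1; rewrite !expr1 rmorph1; apply.
  apply: subD; first by apply: subZ; apply: (le_exp VB1 (leq_addl n m)); exact: VBn.
  exact: (le_exp VB1 (leq_addr m n)).
have WV : WB `<=` VB.
  apply: fspan_le => _ /mapP[w ws ->]; have := VBn 1%N w; rewrite !expr1; apply.
  by apply: cX; rewrite mem_cat ws.
have WB0 n : WB ^+ n <> 0.
  have [y Wy y0] := neq0_ex (sn0 n).
  rewrite -fspan_word_list in Wy; have := emb_fspan Wy; rewrite emb_word_list fspan_word_list.
  move=> h E; have : (WB ^+ n)%R (emb y) by exact: h.
  by rewrite E => /eqP; rewrite (negbTE (emb_neq0 y0)).
have Wabs : fspan s `<=` absorbing z X 1.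
  apply: fspan_le => w ws [|i [|? ?]] // _; rewrite expr1.
    exists w; first by apply: cX; rewrite mem_cat ws.
    by rewrite /zprod big_nil scale1r.
  exists (a (i, w)); last by rewrite /zprod big_seq1 (ha (i, w) ws).
  apply: cX; rewrite mem_cat; apply/orP; right; apply/allpairsP; exists (i, w).
  by rewrite mem_enum.
have [C hC] := power_growth (@closure_prime _ _ primeA) closure_notSI frVB WV WB0.
exists (C.+1), (c.+1 * (C * d.+1 + d.+1 + C * d.+1))%N; split=> //.
  by rewrite muln_gt0 /= addnAC addnS.
move=> n Cn.
pose n1 := (d.+1 * n)%N.
have [|m [nm dm]] := hC n1; first by rewrite /n1 mulSn; lia.
pose G := [seq g * v | g <- [seq u * w | u <- word_list sX (C * n1), w <- word_list s n1],
  v <- word_list sX (C * n1)].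
have [S [SG fS GS]] := free_sublist emb G.
have mS : (m <= size S)%N.
  rewrite -(size_map emb S); apply: (dim_ge_fspan dm); rewrite add0r.
  apply: subset_trans GS; rewrite -!fspan_word_list -!emb_word_list !fspanM.
  by apply: fspan_le => _ /allpairsP[[_ v'] /= [/allpairsP[[u' w'] /= [/mapP[u uX ->]
    /mapP[w ws ->] ->]] /mapP[v vX ->] ->]];
    rewrite -!rmorphM; apply: mem_fspan; apply: map_f;
    apply/allpairsP; exists (u * w, v); split=> //;
    apply/allpairsP; exists (u, w).
exists (size S * n ^ d)%N; split.
  have nn : (n * n <= C * size S)%N.
    apply: leq_trans (leq_trans nm _); last by rewrite leq_mul2l mS orbT.
    by rewrite /n1 leq_mul // mulSn leq_addr.
  rewrite !expnS !mulnA leq_mul2r; apply/orP; right.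
  by apply: leq_trans nn _; rewrite leq_mul2r leqnSn orbT.
have -> : (c.+1 * (C * d.+1 + d.+1 + C * d.+1) * n)%N =
    (c.+1 * (C * n1 + n1 + C * n1))%N by rewrite /n1; ring.
rewrite exprM -/X (exprD _ (C * n1 + n1)) (exprD _ (C * n1) n1).
apply: (monomial_multiples zi fS) => g gS al.
have /SG/allpairsP[[_ v] /= [/allpairsP[[u w] /= [uX ws ->]] vX ->]] := gS.
have Xu : (X ^+ (C * n1))%R u by rewrite EX -fspan_word_list; exact: mem_fspan.
have Xv : (X ^+ (C * n1))%R v by rewrite EX -fspan_word_list; exact: mem_fspan.
have [l [ln <-]] := zpow_list z al.
have wa : absorbing z X n1 w.
  by apply: absorbing_exp Wabs _ _; rewrite -fspan_word_list; exact: mem_fspan.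
have [|w' Xw' Ew] := wa l; first by apply: leq_trans ln _; rewrite leq_mul2r leqnSn orbT.
exists (u * w' * v); first by do 2?apply: memM.
by rewrite !rmorphM /= scalerAl scalerAr Ew.
Qed.

End ClosureGrowth.

(** Along the multiples [e n], the quotient is at least
[(r ln n - ln C) / (ln e + ln n)], which tends to [r]. *)
Lemma limn_esup_log (R : realType) (D : nat -> nat) (r C e : nat) :
  (0 < C)%N -> (0 < e)%N -> (forall n, (C <= n)%N -> (n ^ r <= C * D (e * n))%N) ->
  (r%:R%:E <= limn_esup (fun n => (ln (D n)%:R / ln n%:R : R)%:E))%E.
Proof.
move=> C0 e0 h; apply: le_ereal_inf_tmp => _ [A [N _ NA] <-].
apply/lee_addgt0Pr => eps eps0.
(* The required inequality amounts to r ln e + ln C <= eps (ln e + ln n). *)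
pose b : R := (r%:R * ln e%:R + ln C%:R) / eps.
near \oo => n.
have n1 : (1 < n)%N by near: n; exact: nbhs_infty_gt.
have Cn : (C <= n)%N by near: n; exact: nbhs_infty_ge.
have Nn : (N <= n)%N by near: n; exact: nbhs_infty_ge.
have bn : expR b <= n%:R by near: n; exact: nbhs_infty_ger.
have en1 : (1 < e * n)%N by apply: leq_trans n1 _; rewrite leq_pmull.
apply: (@le_trans _ _ ((ln (D (e * n))%:R / ln (e * n)%:R : R)%:E + eps%:E)%E); last first.
  apply: leeD => //; apply: ereal_sup_ubound; exists (e * n)%N => //.
  by apply: NA => /=; apply: leq_trans Nn _; rewrite leq_pmull.
rewrite -EFinD lee_fin.
have pe : (0 : R) < e%:R by rewrite ltr0n.
have pn : (0 : R) < n%:R by rewrite ltr0n; lia.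
have pC : (0 : R) < C%:R by rewrite ltr0n.
have len : 0 < ln ((e * n)%:R : R) by rewrite ln_gt0 // ltr1n.
have hn := h n Cn.
have D0 : (0 < D (e * n))%N.
  rewrite lt0n; apply: contraTneq hn => ->; rewrite muln0 leqn0 -lt0n expn_gt0.
  by rewrite (ltnW n1).
have pD : (0 : R) < (D (e * n))%:R by rewrite ltr0n.
have lnh : r%:R * ln (n%:R : R) <= ln C%:R + ln (D (e * n))%:R.
  rewrite mulr_natl -lnXn // -lnM ?posrE // -natrX -natrM ler_ln ?posrE ?ler_nat //.
    by rewrite ltr0n expn_gt0 (ltnW n1).
  by rewrite ltr0n muln_gt0 C0.
have lnb : b <= ln (n%:R : R) by rewrite -[b]expRK ler_ln ?posrE ?expR_gt0.
have lne : 0 <= ln (e%:R : R) by rewrite ln_ge0 // ler1n.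
have lnE : ln ((e * n)%:R : R) = ln e%:R + ln n%:R by rewrite natrM lnM ?posrE.
have bE : b * eps = r%:R * ln e%:R + ln C%:R by rewrite /b divfK // gt_eqF.
have beps : b * eps <= ln (n%:R : R) * eps by rewrite ler_pM2r.
rewrite -lerBlDr ler_pdivlMr // lnE mulrBl mulrDr.
have ee : 0 <= eps * ln (e%:R : R) by rewrite mulr_ge0 // ltW.
by nra.
Unshelve. all: by end_near.
Qed.

Section FrameOfStatement.
Context {K : fieldType} {A : algType K}.

Lemma frame_of_is_frame (V : set A) : is_frame V ->
  exists2 X : @subsp K A, V = X :> set A & frame X.
Proof.
move=> [[s ->] V1 gV]; rewrite span_fspan in V1 gV *.
exists (fspan s); first by [].
split=> //; first exact: fd_fspan.
pose B : {pred A} := fun x => `[< exists n, (fspan s ^+ n : @subsp K A) x >].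
have BP x : (x \in B) = `[< exists n, (fspan s ^+ n : @subsp K A) x >] by [].
move=> x; apply/asboolP; rewrite -BP; apply: gV => [|y sy]; last first.
  by rewrite BP; apply/asboolP; exists 1%N; rewrite expr1.
split.
- by rewrite BP; apply/asboolP; exists 0%N; exact: mem_line.
- move=> c y z; rewrite !BP => /asboolP[m ym] /asboolP[n zn]; apply/asboolP.
  exists (m + n)%N; apply: subD.
    by apply: subZ; exact: (le_exp V1 (leq_addr n m)).
  exact: (le_exp V1 (leq_addl m n)).
- move=> y z; rewrite !BP => /asboolP[m ym] /asboolP[n zn]; apply/asboolP.
  by exists (m + n)%N; rewrite exprD; exact: memM.
Qed.

End FrameOfStatement.

Theorem theorem1p1 (R : realType) (K : fieldType) (A : algType K)
    (V : set A) (frameV : is_frame V)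
    (primeA : prime_algebra A)
    (notPI : ~ PI_algebra A)
    (no_locnil : forall I : set A,
       is_ideal I -> locally_nilpotent I -> I = [set 0]) :
  (trdeg R (extended_centre primeA) + 2%:E <= GKdim R V)%E.
Proof.
have [X -> frX] := frame_of_is_frame frameV; have [X1 fX _] := frX.
rewrite -leeBrDr //; apply: ge_ereal_sup => _ [d [z zi] <-]; rewrite leeBrDr //.
have [C [e [C0 e0 hC]]] := trdeg_growth notPI no_locnil frX zi.
have -> : (d%:R%:E + 2%:E = d.+2%:R%:E :> \bar R)%E.
  by rewrite -EFinD -natrD addn2.
apply: (@limn_esup_log R (fun n => dimK (subspace_exp X n)) d.+2 C e) => // n Cn.
have [m [nm dm]] := hC n Cn; apply: leq_trans nm _; rewrite leq_mul2l.
by apply/orP; right; rewrite subspace_expE; apply: dimK_dim_ge dm; exact: fdX.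
Qed.
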